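(* Suppose that there are constants $c>0$ and $Q>0$ such that $$\frac{\mu(B(y,r))}{\mu(B(x,R))}\ge c\Big(\frac rR\Big)^Q\quad\text{for every } x\in\mathcal P,\ 0<r\le R,\ y\in B(x,R).$$ Let $p:\mathcal P\to(0,\infty)$ be a locally log-Hölder continuous function with $p_+<\infty$. Let $0<s\le1$ and let $u\in\dot M^{s,p(\cdot)}:=\dot M^{s,L^{p(\cdot)}}(\mathcal P)$ be quasicontinuous (with respect to the $M^{s,L^{p(\cdot)}}$-capacity). (1) If $p_->0$, then quasievery point is a generalized Lebesgue point of $u$. (2) If $p_->Q/(Q+s)$, then quasievery point is a Lebesgue point of $u$.
   Context: Space. $\mathcal P=(\mathcal P,d,\mu)$ is a metric space $(\mathcal P,d)$ with a Borel regular outer measure $\mu$ such that every ball $B(x,r)=\{y\in\mathcal P: d(y,x)<r\}$ ($r>0$) has positive and finite measure, and $\mu$ is doubling: there is a constant $c_d>0$ with $\mu(B(x,2r))\le c_d\,\mu(B(x,r))$ for all $x\in\mathcal P$, $r>0$. $L^0=L^0(\mathcal P)$ is the set of measurable, almost everywhere finite functions $u:\mathcal P\to[-\infty,\infty]$. Variable exponent spaces. For measurable $p:\mathcal P\to(0,\infty)$, $p_-=\operatorname{ess\,inf}_{x\in\mathcal P}p(x)$ and $p_+=\operatorname{ess\,sup}_{x\in\mathcal P}p(x)$. $p$ is locally log-Hölder continuous if it is measurable and there is $C_p>0$ with $|p(x)-p(y)|\le C_p/\log(e+1/d(x,y))$ for all $x,y\in\mathcal P$. $L^{p(\cdot)}$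 consists of $u\in L^0$ with $\int_{\mathcal P}(|u(x)|/\lambda)^{p(x)}d\mu(x)<\infty$ for some $\lambda>0$, with the quasinorm $\|u\|_{L^{p(\cdot)}}=\inf\{\lambda>0:\int_{\mathcal P}(|u(x)|/\lambda)^{p(x)}d\mu(x)\le1\}$. Hajłasz spaces (applied with $X=L^{p(\cdot)}$). A measurable $g:\mathcal P\to[0,\infty]$ is an $s$-gradient of $u\in L^0$ if there is $E\subset\mathcal P$ with $\mu(E)=0$ such that $|u(x)-u(y)|\le d(x,y)^s(g(x)+g(y))$ for all $x,y\in\mathcal P\setminus E$. $\mathcal D^s(u)$ is the set of all $s$-gradients of $u$. $\dot M^{s,X}$ consists of measurable $u$ with $\|u\|_{\dot M^{s,X}}=\inf_{g\in\mathcal D^s(u)}\|g\|_X<\infty$; $M^{s,X}=\dot M^{s,X}\cap X$ with $\|u\|_{M^{s,X}}=\|u\|_X+\|u\|_{\dot M^{s,X}}$. Capacity. $C_{M^{s,X}}(E)=\inf\{\|u\|_{M^{s,X}}: u\in M^{s,X},\ u\ge1 \text{ on a neighbourhood of } E\}$. A property holds for quasievery point (quasieverywhere) if it holds outside a set of $M^{s,X}$-capacity zero. A function $u:\mathcal P\to[-\infty,\infty]$ is quasicontinuous if for every $\varepsilon>0$ there is $E\subset\mathcal P$ with $C_{M^{s,X}}(E)<\varepsilon$ such that the restriction of $u$ to $\mathcal P\setminus E$ is continuous. Medians and Lebesgue points. For $0<\gamma<1$, measurable $u$ and a set $A$ of finite measure, $m_u^\gamma(A)=\inf\{a\in\mathbb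 R:\mu(\{x\in A:u(x)>a\})<\gamma\mu(A)\}$. A point $x$ is a Lebesgue point of $u$ if $\lim_{r\to0}\frac1{\mu(B(x,r))}\int_{B(x,r)}u\,d\mu=u(x)$. It is a generalized Lebesgue point of $u$ if $\lim_{r\to0}m^\gamma_{|u-u(x)|}(B(x,r))=0$ and $\lim_{r\to0}m^\gamma_u(B(x,r))=u(x)$ for every $0<\gamma<1$. *)

(* Defs.v *)
From HB Require Import structures.
From mathcomp Require Import all_boot all_order all_algebra.
From mathcomp Require Import all_classical all_reals all_analysis.
From mathcomp Require Import measurable_realfun ess_sup_inf.

Set Implicit Arguments.
Unset Strict Implicit.
Unset Printing Implicit Defensive.
Import Order.TTheory GRing.Theory Num.Theory.
Import numFieldNormedType.Exports.

Local Open Scope classical_set_scope.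
Local Open Scope ring_scope.
Local Open Scope ereal_scope.

(* Nonempty metric spaces: [caratheodory_type] carries a [measurableType]
   structure only over a pointed type. *)
#[short(type="pmetricType")]
HB.structure Definition PointedMetric (K : numDomainType) :=
  { M of Metric K M & Pointed M }.

Section space.
Context {R : realType} {T : pmetricType R}.
Variable mu : {outer_measure set T -> \bar R}.

Definition caratheodory_restriction :
    {measure set (caratheodory_type mu) -> \bar R} :=
  (mu : set (caratheodory_type mu) -> \bar R).

Definition mu_measurable d (V : sigmaRingType d) (f : T -> V) :=
  measurable_fun [set: caratheodory_type mu] (f : caratheodory_type mu -> V).

Definition borel_set (B : set T) := <<s [set U : set T | open U] >> B.

Definition borel_regular :=
  (forall B, borel_set B -> mu.-caratheodory B) /\
  (forall A : set T, exists B, [/\ borel_set B, A `<=` B & mu B = mu A]).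

Definition balls_positive_finite :=
  forall (x : T) (r : R), (0 < r)%R -> 0 < mu (ball x r) < +oo.

Definition doubling := exists2 cd : R, (0 < cd)%R &
  forall (x : T) (r : R), (0 < r)%R ->
    mu (ball x (2 * r)%R) <= cd%:E * mu (ball x r).

Definition L0 (u : T -> \bar R) :=
  mu_measurable u /\ \forall x \ae caratheodory_restriction, u x \is a fin_num.

Definition p_minus (p : T -> R) : \bar R :=
  ess_inf caratheodory_restriction (fun x => (p x)%:E).

Definition p_plus (p : T -> R) : \bar R :=
  ess_sup caratheodory_restriction (fun x => (p x)%:E).

(* For x = y the bound reads C, since 0^-1 = 0; the left-hand side is then 0. *)
Definition locally_log_holder (p : T -> R) :=
  mu_measurable p /\ exists2 C : R, (0 < C)%R &
    forall x y : T,
      (`|p x - p y| <= C / ln (expR 1 + (mdist x y)^-1))%R.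

Definition modular (p : T -> R) (u : T -> \bar R) (lambda : R) : \bar R :=
  \int[caratheodory_restriction]_x ((`|u x| / lambda%:E) `^ p x).

Definition Lp (p : T -> R) (u : T -> \bar R) :=
  L0 u /\ exists2 lambda : R, (0 < lambda)%R & modular p u lambda < +oo.

(* Equal to +oo when no lambda qualifies, in particular for a measurable u
   outside Lp. *)
Definition Lp_norm (p : T -> R) (u : T -> \bar R) : \bar R :=
  ereal_inf [set lambda%:E | lambda in
    [set lambda : R | (0 < lambda)%R /\ modular p u lambda <= 1]].

(* The points where u is infinite, and the conventions for oo - oo there, are
   irrelevant for u in L0: they can be put into the exceptional set E. *)
Definition s_gradient (s : R) (u g : T -> \bar R) :=
  [/\ mu_measurable g, forall x, 0 <= g x &
    exists2 E : set T, mu E = 0 &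
      forall x y, ~ E x -> ~ E y ->
        `|u x - u y| <= (mdist x y `^ s)%:E * (g x + g y)].

Definition hajlasz_seminorm (s : R) (p : T -> R) (u : T -> \bar R) : \bar R :=
  ereal_inf [set Lp_norm p g | g in s_gradient s u].

Definition hom_hajlasz (s : R) (p : T -> R) (u : T -> \bar R) :=
  L0 u /\ hajlasz_seminorm s p u < +oo.

Definition hajlasz (s : R) (p : T -> R) (u : T -> \bar R) :=
  hom_hajlasz s p u /\ Lp p u.

Definition hajlasz_norm (s : R) (p : T -> R) (u : T -> \bar R) : \bar R :=
  Lp_norm p u + hajlasz_seminorm s p u.

Definition capacity (s : R) (p : T -> R) (E : set T) : \bar R :=
  ereal_inf [set hajlasz_norm s p u | u in
    [set u | hajlasz s p u /\ set_nbhs E [set x | 1 <= u x]]].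

Definition quasieverywhere (s : R) (p : T -> R) (P : T -> Prop) :=
  exists2 E : set T, capacity s p E = 0 & forall x, ~ E x -> P x.

Definition quasicontinuous (s : R) (p : T -> R) (u : T -> \bar R) :=
  forall eps : R, (0 < eps)%R ->
    exists2 E : set T, capacity s p E < eps%:E & {within ~` E, continuous u}.

Definition median (gamma : R) (u : T -> \bar R) (A : set T) : \bar R :=
  ereal_inf [set a%:E | a in
    [set a : R | mu (A `&` [set x | a%:E < u x]) < gamma%:E * mu A]].

(* The library integral of u is \int u^\+ - \int u^\- with oo - oo = -oo; the
   first clause asks that this difference be defined on small balls. *)
Definition lebesgue_point (u : T -> \bar R) (x : T) :=
  (\forall r \near (0 : R)^'+,
    \int[caratheodory_restriction]_(y in ball x r) (u^\+ y) < +oo \/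
    \int[caratheodory_restriction]_(y in ball x r) (u^\- y) < +oo) /\
  (fun r : R => (\int[caratheodory_restriction]_(y in ball x r) u y) /
                mu (ball x r)) @ (0 : R)^'+ --> u x.

Definition generalized_lebesgue_point (u : T -> \bar R) (x : T) :=
  forall gamma : R, (0 < gamma < 1)%R ->
    (fun r : R => median gamma (fun y => `|u y - u x|) (ball x r))
      @ (0 : R)^'+ --> 0 /\
    (fun r : R => median gamma u (ball x r)) @ (0 : R)^'+ --> u x.

End space.

(* Main.v *)
Require Import Defs.
From HB Require Import structures.
From mathcomp Require Import all_boot all_order all_algebra.
From mathcomp Require Import all_classical all_reals all_analysis.
From mathcomp Require Import measurable_realfun ess_sup_inf.
From mathcomp Require Import ring lra.

(** Let [g] be a gradient of [u] of finite modular. Call energy at [x] and scale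
    [r] the integral over [B(x,r)] of [(r ^ s g) ^ p], the modular of the gradient
    rescaled to unit radius. Two properties hold at quasievery point and imply the
    theorem at each point where they hold.

    The first is that the energy is small compared with the measure of the ball
    as [r] tends to 0 ([energy_vanishes]). Where it is not small, Vitali's lemma
    selects disjoint balls that carry a definite part of an arbitrarily small tail
    of [g ^ p], and the capacity of a ball of radius [r] is at most a multiple of
    [r ^ (- s p)] times its measure; by log-Hölder continuity the exponent may be
    taken at the centre.

    The second is that [u x] is finite and that there is a set [E], not containing
    [x], off which [u] is continuous and which fills less than half of each small
    ball around [x] ([mcap_infinite], [mcap_not_approx_continuous]).
    Quasicontinuity gives such sets of small capacity, so what is needed is that
    the points of density of a set of small capacity form a set of small capacity
    ([mcap_dense]). If [v] is a test function of [E], then a ball half filled by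
    [E] is half filled by the set [v = 1]. The supremum of cones placed over the
    balls on half of which [v] is at least the height of the cone is a lower
    semicontinuous function that is 1 at the points of density, and its gradient
    is controlled by a maximal function of [v] and its gradient. That maximal
    function records, instead of averages, the levels exceeded on a small
    proportion of a ball, and is bounded for all positive exponents
    ([maximal_function], [variable_maximal]).

    At such a point [x], and in a small ball, [r ^ s g] exceeds [e] only on a small
    proportion of the ball. Elsewhere [u] oscillates by at most [4 e], and it takes
    a value near [u x] at a point off [E]; so [u] is within [5 e] of [u x] outside
    a small proportion of the ball ([oscillation]), which settles the medians.

    For the averages, let [G = r ^ s g] and join a point [y] with [G y <= 2 ^ k] to
    points [y_j] with [G y_j <= 2 ^ j], for [j] from [k] down to 0. The lower mass
    bound with exponent [Q] provides them at distance comparable to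
    [r 2 ^ (- j p_- / Q)] from [y], because the set [G > 2 ^ j] has measure at most
    a multiple of [2 ^ (- j p_-)] times that of the ball. The step from [y_(j+1)]
    to [y_j] costs at most a multiple of [2 ^ (j (1 - p_- s / Q))], and
    [1 - p_- s / Q <= p_-] is exactly the hypothesis [p_- >= Q / (Q + s)]. Hence
    [|u y - u x|] is at most a multiple of [1 + G y ^ p_-] ([growth]), and its
    integral over the points where [G > e] at most a multiple of the energy
    ([mean_oscillation]).

    Capacities are estimated through modulars rather than quasinorms, since the
    modular is countably subadditive ([mcap_le_bigcup]) and the two notions have
    the same null sets ([capacity_mcap_le], [mcap_le_capacity0]). *)

Set Implicit Arguments.
Unset Strict Implicit.
Unset Printing Implicit Defensive.
Import Order.TTheory GRing.Theory Num.Theory.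
Import numFieldNormedType.Exports.

Local Open Scope classical_set_scope.
Local Open Scope ring_scope.
Local Open Scope ereal_scope.

(** * Balls in a doubling space *)

Section vitali.
Context {R : realType} {T : pmetricType R}.
Implicit Types (V D : set (T * R)) (b : T * R) (x y z : T) (r : R).
Local Open Scope ring_scope.

Definition pball b : set T := ball b.1 b.2.

Lemma in_ballE x r y : ball x r y = (mdist x y < r) :> Prop.
Proof. by rewrite ballEmdist. Qed.

Lemma subset_ball x y r r' : mdist x y + r' <= r -> ball y r' `<=` ball x r.
Proof.
move=> xyr z; rewrite !in_ballE => yz.
by rewrite (le_lt_trans (metric_triangle x y z))// (lt_le_trans _ xyr)// ltrD2l.
Qed.

(** A maximal family is taken among the disjoint ones such that every ball
    meeting the family meets a member of at least half its own radius: this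
    replaces a selection by decreasing radii. *)
Lemma vitali_5r V (M : R) : (forall b, V b -> 0 < b.2 <= M) ->
  exists D, [/\ D `<=` V, trivIset D pball &
    forall b, V b -> exists2 b', D b' & pball b `<=` ball b'.1 (5 * b'.2)].
Proof.
move=> VM.
pose P D := [/\ D `<=` V, trivIset D pball &
  forall b, V b -> forall b', D b' -> pball b `&` pball b' !=set0 ->
    exists b'', [/\ D b'', pball b `&` pball b'' !=set0 & b.2 <= 2 * b''.2]].
have chainP (F : set (set (T * R))) : F `<=` P -> total_on F subset ->
    P (\bigcup_(X in F) X).
  move=> FP totF; split.
  - by apply: bigcup_sub => E /FP [].
  - move=> b1 b2 [X FX Xb1] [Y FY Yb2] b12.
    have [XY|YX] := totF _ _ FX FY.
    + by have [_ tY _] := FP _ FY; apply: tY => //; exact: XY.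
    + by have [_ tX _] := FP _ FX; apply: tX => //; exact: YX.
  - move=> b Vb b' [X FX Xb'] bb'.
    have [_ _ /(_ _ Vb _ Xb' bb')[b'' [Xb'' ? ?]]] := FP _ FX.
    by exists b''; split=> //; exists X.
have [D [[DV tD hD] maxD]] := Zorn_bigcup chainP.
exists D; split => // b Vb.
suff [b' Db' bb'] : exists2 b', D b' & pball b `&` pball b' !=set0.
  have [b'' [Db'' [y [by1 by2]] b2]] := hD _ Vb _ Db' bb'.
  exists b'' => //; apply: subset_ball.
  move: by1 by2; rewrite /pball !in_ballE => by1 by2.
  have := metric_triangle b''.1 y b.1; rewrite (metric_sym y b.1); lra.
(* Otherwise some ball misses D; one of nearly largest radius among those can
   be added to D, against maximality. *)
apply: contrapT => /forall2NP nD.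
pose W := [set c | V c /\ forall b', D b' -> ~ (pball c `&` pball b' !=set0)].
have Wb : W b by split => // b' Db' ; have [] := nD b'.
pose S := [set c.2 | c in W].
have supS : has_sup S.
  split; first by exists b.2; exists b.
  by exists M => _ [c [/VM /andP[_ ?] _] <-].
have S0 : 0 < sup S.
  have /andP[b0 _] := VM _ Vb; apply: (lt_le_trans b0).
  by apply: ub_le_sup; [case: supS|exists b].
have [|_ [c Wc <-] cS] := @sup_adherent _ S (sup S / 2) _ supS.
  by rewrite divr_gt0.
have SW c' : W c' -> c'.2 <= 2 * c.2.
  move=> Wc'; have : c'.2 <= sup S by apply: ub_le_sup; [case: supS|exists c'].
  by move: cS; lra.
have [Vc cD] := Wc.
apply: (maxD (D `|` [set c])).
  rewrite properEneq; split; last exact: subsetUl.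
  apply/eqP => DE; have Dc : D c by rewrite DE; right.
  apply: (cD _ Dc); exists c.1.
  by split; rewrite /pball in_ballE mdistxx; have /andP[] := VM _ Vc.
split.
- by move=> d [/DV//|->].
- move=> b1 b2 [D1|->] [D2|->] // b12.
  + exact: tD.
  + by exfalso; apply: (cD _ D1); rewrite setIC.
  + by exfalso; apply: (cD _ D2).
- move=> d Vd b' Db' db'.
  have [[b1 Db1 db1]|/forall2NP nd] :=
      pselect (exists2 b1, D b1 & pball d `&` pball b1 !=set0).
    by have [b'' [? ? ?]] := hD _ Vd _ Db1 db1; exists b''; split => //; left.
  have Wd : W d by split => // b1 Db1; have [] := nd b1.
  case: Db' => [Db'|b'c]; first by have [] := nd b'.
  by exists c; split; [right|rewrite -b'c|exact: SW].
Qed.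

End vitali.

(** The number of disjoint sets that carry an integral above [n^-1] is at most
    [n] times the total integral. *)
Lemma trivIset_integral_countable d (X : measurableType d) (R : realType)
    (m : {measure set X -> \bar R}) (I : pointedType) (A : I -> set X) (D : set I)
    (f : X -> \bar R) :
  (forall i, measurable (A i)) -> trivIset D A ->
  measurable_fun setT f -> (forall x, 0 <= f x) -> \int[m]_x f x < +oo ->
  (forall i, D i -> 0 < \int[m]_(x in A i) f x) -> countable D.
Proof.
move=> mA tA mf f0 foo fA.
pose c i := fine (\int[m]_(x in A i) f x).
have Af i : \int[m]_(x in A i) f x \is a fin_num.
  rewrite ge0_fin_numE ?integral_ge0//.
  by apply: le_lt_trans foo; exact: ge0_subset_integral.
have -> : D = \bigcup_n [set i | D i /\ (n.+1%:R^-1 < c i)%R].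
  apply/seteqP; split=> [i Di|i [k _ []]//].
  have : (0 < c i)%R by rewrite -lte_fin fineK// fA.
  by move=> /ltr_add_invr[k /[!add0r] kc]; exists k.
apply: bigcup_countable => // n _; apply: finite_set_countable.
apply: contrapT => /infiniteP/pcard_leP/injfunPex[/= q q_fun q_inj].
have tAq : trivIset setT (A \o q).
  move=> i j _ _ ij; apply: q_inj; rewrite ?inE//.
  by apply: tA => //; [have [] := q_fun i Logic.I|have [] := q_fun j Logic.I].
pose F := fine (\int[m]_x f x).
have Fn : \int[m]_x f x \is a fin_num by rewrite ge0_fin_numE// integral_ge0.
pose N := Num.truncn (F * n.+1%:R).
suff : (N.+1%:R * n.+1%:R^-1)%:E <= \int[m]_x f x.
  rewrite -(fineK Fn) lee_fin -/F ler_pdivrMr// leNgt.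
  by rewrite truncnS_gt.
apply: (@le_trans _ _ (\int[m]_(x in \big[setU/set0]_(i < N.+1) A (q i)) f x)).
  rewrite -(big_mkord xpredT (A \o q)) ge0_integral_bigsetU//=.
  - apply: (@le_trans _ _ (\sum_(0 <= i < N.+1) n.+1%:R^-1%:E)).
      by rewrite sumEFin lee_fin sumr_const_nat subn0 -[leRHS]mulr_natl.
    apply: lee_sum => i _; rewrite -(fineK (Af (q i))) lee_fin.
    by have [_ /ltW] := q_fun i Logic.I.
  - exact: (iota_uniq 0 N.+1).
  - by apply: sub_trivIset tAq.
  - exact: measurable_funTS.
by apply: ge0_subset_integral => //; apply: bigsetU_measurable.
Qed.

Section doubling_space.
Context {R : realType} {T : pmetricType R} (mu : {outer_measure set T -> \bar R}).
Hypothesis mu_regular : borel_regular mu.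
Hypothesis mu_balls : balls_positive_finite mu.
Local Notation X := (caratheodory_type mu).
Local Notation nu := (caratheodory_restriction mu).

Lemma open_mu_measurable (A : set T) : open A -> measurable (A : set X).
Proof. by move=> oA; apply: (mu_regular.1); apply: sub_sigma_algebra. Qed.

Lemma ball_open_mdist (x : T) (r : R) : open (ball x r).
Proof.
rewrite openE => y; rewrite in_ballE => xy; rewrite /interior.
apply/nbhs_ballP; exists (r - mdist x y)%R => /=; first by rewrite subr_gt0.
by apply: subset_ball; lra.
Qed.

Lemma ball_mu_measurable (x : T) r : measurable (ball x r : set X).
Proof. exact/open_mu_measurable/ball_open_mdist. Qed.

Lemma mu_measurable_mdist (x : T) : mu_measurable mu (mdist x).
Proof.
apply: (measurability _ (RGenInftyO.measurableE R)) => //.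
move=> /= _ [_ [a ->] <-]; rewrite setTI.
have -> : mdist x @^-1` `]-oo, a[ = ball x a.
  by apply/seteqP; split => y; rewrite in_ballE /= in_itv.
exact: ball_mu_measurable.
Qed.

Lemma mu0_measurable (N : set T) : mu N = 0 -> measurable (N : set X).
Proof.
move=> N0; apply: le_caratheodory_measurable => Y.
have -> : mu (Y `&` N) = 0.
  by apply/eqP; rewrite -measure_le0 -N0 le_outer_measure//; exact: subIsetr.
by rewrite add0e le_outer_measure//; exact: subIsetl.
Qed.

Lemma ball_le0 (x : T) r : (r <= 0)%R -> ball x r = set0.
Proof.
move=> r0; rewrite -subset0 => y; rewrite in_ballE => yr.
by have := le_lt_trans (mdist_ge0 x y) (lt_le_trans yr r0); rewrite ltxx.
Qed.

(** Degenerate balls pad the selected family to a sequence. *)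
Lemma vitali_sequence (V : set (T * R)) (M : R) (f : X -> \bar R) :
  (forall b, V b -> (0 < b.2 <= M)%R) ->
  measurable_fun setT f -> (forall x, 0 <= f x) -> \int[nu]_x f x < +oo ->
  (forall b, V b -> 0 < \int[nu]_(x in pball b) f x) ->
  exists b : nat -> T * R, [/\
    forall n, V (b n) \/ b n = (point, 0%R),
    trivIset setT (pball \o b),
    forall c, V c -> exists2 n, V (b n) &
      pball c `<=` ball (b n).1 (5 * (b n).2)%R &
    \sum_(n <oo) \int[nu]_(x in pball (b n)) f x <= \int[nu]_x f x].
Proof.
move=> VM mf f0 foo fV; have [D [DV tD VD]] := vitali_5r VM.
have mb (b : T * R) : measurable (pball b : set X) by exact: ball_mu_measurable.
have /countable_injP[h h_inj] : countable D.
  by apply: (trivIset_integral_countable mb tD mf f0 foo) => b /DV /fV.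
pose b n := xget (point, 0%R) [set b | D b /\ h b = n].
have bP n : (D (b n) /\ h (b n) = n) \/ b n = (point, 0%R).
  rewrite /b; case: (xgetP (point, 0%R) [set b | D b /\ h b = n]); last by right.
  by move=> y -> [? ?]; left.
have tb : trivIset setT (pball \o b).
  move=> i j _ _ [y []] /=.
  have [[Di hi]|->] := bP i; last by rewrite /pball/= (ball_le0 _ (lexx 0%R)).
  have [[Dj hj]|->] := bP j; last by rewrite /pball/= (ball_le0 _ (lexx 0%R)).
  by move=> yi yj; rewrite -hi -hj; congr h; apply: tD => //; exists y.
exists b; split => //.
- by move=> n; have [[/DV]|] := bP n; [left|right].
- move=> c /VD[c' Dc' cc'].
  have : D (b (h c')) /\ h (b (h c')) = h c'.
    have [//|b0] := bP (h c'); apply: (@xgetPex _ _ [set b | D b /\ h b = h c']).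
    by exists c'.
  move=> [Db hb]; exists (h c'); first exact: DV.
  by have -> : b (h c') = c' by apply: h_inj => //; exact: mem_set.
- rewrite -ge0_integral_bigcup//; last first.
    by apply: measurable_funTS.
  apply: ge0_subset_integral => //.
  by apply: bigcup_measurable.
Qed.

End doubling_space.

Section volume.
Context {R : realType} {T : pmetricType R} (mu : {outer_measure set T -> \bar R}).
Hypothesis mu_balls : balls_positive_finite mu.
Local Open Scope ring_scope.

Definition vol (x : T) (r : R) : R := fine (mu (ball x r)).

Lemma mu_ballE x r : 0 < r -> mu (ball x r) = (vol x r)%:E.
Proof.
by move=> r0; rewrite fineK// ge0_fin_numE//; have /andP[] := mu_balls x r0.
Qed.

Lemma vol_gt0 x r : 0 < r -> 0 < vol x r.
Proof.
by move=> r0; rewrite -lte_fin -mu_ballE//; have /andP[] := mu_balls x r0.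
Qed.

Lemma vol_ge0 x r : 0 <= vol x r.
Proof. exact: fine_ge0. Qed.

Lemma le_vol x y r r' : 0 < r -> 0 < r' -> mdist x y + r' <= r ->
  vol y r' <= vol x r.
Proof.
move=> r0 r'0 h; rewrite -lee_fin -!mu_ballE//.
exact/le_outer_measure/subset_ball.
Qed.

Lemma doubling_vol : doubling mu -> exists2 cd : R, 1 <= cd &
  forall x r, 0 < r -> vol x (2 * r) <= cd * vol x r.
Proof.
move=> [cd cd0 hcd].
have h x r : 0 < r -> vol x (2 * r) <= cd * vol x r.
  move=> r0; rewrite -lee_fin EFinM -!mu_ballE ?mulr_gt0//.
  exact: hcd.
exists cd => //; rewrite -(@ler_pM2r _ (vol point 1)) ?vol_gt0// mul1r.
by apply: le_trans (h point 1 ltr01); apply: le_vol => //; rewrite mdistxx; lra.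
Qed.

Variable cd : R.
Hypothesis cd_ge1 : 1 <= cd.
Hypothesis vol_dbl : forall x r, 0 < r -> vol x (2 * r) <= cd * vol x r.

Lemma vol_doubling_iter n x y r r' : 0 < r -> 0 < r' ->
  mdist x y + r' <= 2 ^+ n * r -> vol y r' <= cd ^+ n * vol x r.
Proof.
move=> r0 r'0 h.
have n0 k : 0 < 2 ^+ k * r by rewrite mulr_gt0// exprn_gt0.
apply: (@le_trans _ _ (vol x (2 ^+ n * r))); first exact: le_vol.
elim: n {h} => [|n ih]; first by rewrite !expr0 !mul1r.
rewrite exprS -mulrA (le_trans (vol_dbl _ (n0 n)))// exprS -mulrA.
by rewrite ler_wpM2l// (le_trans ler01).
Qed.

End volume.

(** * Log-Hölder exponents *)

Section exponent.
Context {R : realType} {T : pmetricType R} (mu : {outer_measure set T -> \bar R}).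
Hypothesis mu_balls : balls_positive_finite mu.
Local Notation nu := (caratheodory_restriction mu).
Local Open Scope ring_scope.
Variables (p : T -> R) (Cp : R).
Hypothesis Cp_gt0 : 0 < Cp.
Hypothesis p_lh : forall x y : T,
  `|p x - p y| <= Cp / ln (expR 1 + (mdist x y)^-1).

Lemma ln_e_ge1 (d : R) : 0 <= d -> 1 <= ln (expR 1 + d).
Proof.
move=> d0; have e0 : 0 < expR 1 + d by rewrite ltr_wpDr ?expR_gt0.
by rewrite -[leLHS]expRK ler_ln ?posrE ?expR_gt0// lerDl.
Qed.

(** Log-Hölder continuity in the form in which it is used: at points at
    distance at most [r], powers of any [t] whose logarithm is of the order of
    [ln r^-1] are comparable. *)
Lemma log_holder_powR x y r t a b : 0 < r -> mdist x y <= r -> 0 < t ->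
  0 <= a -> 0 <= b -> `|ln t| <= a + b * ln r^-1 ->
  t `^ p x <= expR (Cp * (a + b)) * t `^ p y.
Proof.
move=> r0 xyr t0 a0 b0 ht.
rewrite /powR gt_eqF// -expRD ler_expR.
have [xy|xy] := eqVneq x y.
  by rewrite xy lerDr mulr_ge0 ?addr_ge0// ltW.
have d0 : 0 < mdist x y by rewrite mdist_gt0.
set d := mdist x y in d0 xyr; pose L := ln (expR 1 + d^-1).
have L1 : 1 <= L by rewrite ln_e_ge1// invr_ge0 ltW.
have rL : ln r^-1 <= L.
  rewrite ler_ln ?posrE ?invr_gt0// ?addr_gt0 ?expR_gt0 ?invr_gt0//.
  by rewrite ler_wpDl ?expR_ge0// lef_pV2.
have tL : `|ln t| <= (a + b) * L.
  apply: (le_trans ht); rewrite mulrDl lerD//; first by rewrite ler_peMr.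
  by rewrite ler_wpM2l.
rewrite -lerBlDr -mulrBl (le_trans (ler_norm _))// normrM.
apply: (@le_trans _ _ (Cp / L * ((a + b) * L))).
  by apply: ler_pM.
by rewrite mulrCA -mulrA mulVf ?gt_eqF ?(lt_le_trans ltr01)// mulr1 mulrC.
Qed.

Lemma log_holder_continuous x eps : 0 < eps ->
  exists2 del, 0 < del & forall y, ball x del y -> `|p x - p y| < eps.
Proof.
move=> e0; exists (expR (- (2 * Cp / eps))); first exact: expR_gt0.
move=> y; rewrite in_ballE => xy.
have [->|nxy] := eqVneq x y; first by rewrite subrr normr0.
have d0 : 0 < mdist x y by rewrite mdist_gt0.
apply: (le_lt_trans (p_lh x y)).
have L0 : 2 * Cp / eps <= ln (expR 1 + (mdist x y)^-1).
  rewrite -[leLHS]expRK ler_ln ?posrE ?expR_gt0//; last first.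
    by rewrite addr_gt0 ?expR_gt0// invr_gt0.
  rewrite ler_wpDl ?expR_ge0// -[leLHS]invrK lef_pV2 ?posrE ?invr_gt0 ?expR_gt0//.
  by rewrite -expRN ltW.
have c0 : 0 < 2 * Cp / eps by rewrite divr_gt0// mulr_gt0.
rewrite ltr_pdivrMr ?(lt_le_trans c0)//.
apply: (@lt_le_trans _ _ (eps * (2 * Cp / eps))).
  by rewrite mulrCA divff ?gt_eqF// mulr1 ltr_pMl// ltr1n.
by rewrite ler_wpM2l// ltW.
Qed.

Lemma ae_near_point (P : T -> Prop) x del : 0 < del ->
  (\forall y \ae nu, P y) -> exists2 y, ball x del y & P y.
Proof.
move=> d0 [N [mN N0 hN]]; apply: contrapT => /forall2NP h.
have : (mu (ball x del) <= 0)%E.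
  rewrite -[leRHS]N0; apply: le_outer_measure => y xy.
  by apply: hN => Py; have [] := h y.
by rewrite leNgt; have /andP[->] := mu_balls x d0.
Qed.

(** A continuous exponent obeys its essential bounds at every point, because
    balls have positive measure. *)
Lemma p_minus_le pm : (pm%:E <= p_minus mu p)%E -> forall x, pm <= p x.
Proof.
move=> /ess_infP h x; apply/ler_addgt0Pr => e e0.
have [del d0 hd] := log_holder_continuous x e0.
have [y xy] := ae_near_point x d0 h; rewrite lee_fin => hy.
by have := hd _ xy; rewrite ltr_norml; lra.
Qed.

Lemma p_plus_ge pp : (p_plus mu p <= pp%:E)%E -> forall x, p x <= pp.
Proof.
move=> /ess_supP h x; apply/ler_addgt0Pr => e e0.
have [del d0 hd] := log_holder_continuous x e0.
have [y xy] := ae_near_point x d0 h; rewrite lee_fin => hy.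
by have := hd _ xy; rewrite ltr_norml; lra.
Qed.

End exponent.

(** * A modular capacity *)

Lemma measurable_powR_fun d (X : measurableType d) (R : realType)
    (f q : X -> R) : measurable_fun setT f -> measurable_fun setT q ->
  measurable_fun setT (fun x => f x `^ q x)%R.
Proof.
move=> mf mq; rewrite /powR; apply: measurable_fun_ifT.
- by apply: measurable_fun_eqr.
- apply: (@measurableT_comp _ _ _ _ _ _ (fun b : bool => (b%:R : R))) => //.
  by apply: measurable_fun_eqr.
- apply: measurableT_comp; first exact: measurable_expR.
  by apply: measurable_funM => //; apply: measurableT_comp.
Qed.

Lemma powR_ge1 (R : realType) (a q : R) : (1 <= a)%R -> (0 <= q)%R ->
  (1 <= a `^ q)%R.
Proof. by move=> a1 q0; rewrite -[leLHS](powRr0 a); exact: ler_powR. Qed.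

Lemma powR_le1 (R : realType) (a q : R) : (0 <= a <= 1)%R -> (0 <= q)%R ->
  (a `^ q <= 1)%R.
Proof.
move=> /andP[a0 a1] q0; have := ge0_ler_powR q0 a0 ler01 a1.
by rewrite powR1.
Qed.

Lemma powR_invl (R : realType) (a q : R) : (0 <= a)%R ->
  (a^-1 `^ q = (a `^ q)^-1)%R.
Proof. by move=> a0; rewrite -(powR_inv1 a0) -powRrM mulN1r powRN. Qed.

Lemma powR_inv_exp (R : realType) (a q : R) : (0 <= a)%R -> (0 < q)%R ->
  ((a `^ q^-1) `^ q = a)%R.
Proof.
by move=> a0 q0; rewrite -powRrM mulVf ?gt_eqF// powRr1.
Qed.

Lemma powR_divr (R : realType) (a b s : R) : (0 <= a)%R -> (0 < b)%R ->
  ((a / b) `^ s = a `^ s / b `^ s)%R.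
Proof.
by move=> a0 /ltW b0; rewrite powRM ?invr_ge0// powR_invl.
Qed.

Lemma norm_max_le {R : realType} (a b c d : R) :
  (`|Num.max a b - Num.max c d| <= Num.max `|a - c| `|b - d|)%R.
Proof.
have key (a' b' c' d' : R) : (Num.max a' b' - Num.max c' d' <=
    Num.max `|a' - c'| `|b' - d'|)%R.
  rewrite lerBlDr ge_max; apply/andP; split.
    apply: (@le_trans _ _ (`|a' - c'| + c')%R).
      by rewrite -lerBlDr ler_norm.
    by apply: lerD; rewrite le_max lexx.
  apply: (@le_trans _ _ (`|b' - d'| + d')%R).
    by rewrite -lerBlDr ler_norm.
  by apply: lerD; rewrite le_max lexx orbT.
rewrite ler_norml key andbT lerNl opprB (le_trans (key _ _ _ _))//.
by rewrite (distrC c) (distrC d).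
Qed.

Section modular_capacity.
Context {R : realType} {T : pmetricType R} (mu : {outer_measure set T -> \bar R}).
Local Notation X := (caratheodory_type mu).
Local Notation nu := (caratheodory_restriction mu).
Variables (p : T -> R) (s : R).
Hypothesis mp : mu_measurable mu p.
Hypothesis p_gt0 : forall x, (0 < p x)%R.

Definition pmod (f : T -> R) : \bar R := \int[nu]_x (f x `^ p x)%:E.

Definition hgradient (v h : T -> R) := exists2 N : set T, mu N = 0 &
  forall x y, ~ N x -> ~ N y ->
    (`|v x - v y| <= mdist x y `^ s * (h x + h y))%R.

Definition test_pair (E : set T) (v h : T -> R) :=
  [/\ mu_measurable mu v, mu_measurable mu h, forall x, (0 <= v x <= 1)%R,
      forall x, (0 <= h x)%R & hgradient v h] /\
  (exists G, [/\ open G, E `<=` G & forall x, G x -> v x = 1%R]).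

(** The modular counterpart of the capacity; unlike a quasinorm, the modular is
    countably subadditive for every exponent. *)
Definition mcap_le (E : set T) (e : \bar R) :=
  exists v h, test_pair E v h /\ pmod v + pmod h <= e.

Lemma measurable_pmod (f : T -> R) : mu_measurable mu f ->
  measurable_fun [set: X] (fun x => (f x `^ p x)%:E).
Proof. by move=> mf; apply/measurable_EFinP; exact: measurable_powR_fun. Qed.

Lemma measurable_inv_exponent : mu_measurable mu (fun x => (p x)^-1)%R.
Proof.
apply: (eq_measurable_fun (fun x : X => p x `^ (-1))%R).
  by move=> x _; rewrite powR_inv1// ltW.
by apply: measurable_powR_fun.
Qed.

Lemma pmod_ge0 f : 0 <= pmod f.
Proof. by apply: integral_ge0 => x _; rewrite lee_fin powR_ge0. Qed.

Lemma le_pmod_scale (f g : T -> R) (c : R) : mu_measurable mu f -> mu_measurable mu g ->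
  (0 <= c)%R -> (forall x, f x `^ p x <= c * g x `^ p x)%R ->
  pmod f <= c%:E * pmod g.
Proof.
move=> mf mg c0 fg; rewrite /pmod -ge0_integralZl//; first last.
- by move=> x _; rewrite lee_fin powR_ge0.
- exact: measurable_pmod.
- apply: ge0_le_integral => //.
  + by move=> x _; rewrite lee_fin powR_ge0.
  + exact: measurable_pmod.
  + by apply: emeasurable_funM => //; exact: measurable_pmod.
  + by move=> x _; rewrite -EFinM lee_fin.
Qed.

Lemma le_pmod (f g : T -> R) : mu_measurable mu f -> mu_measurable mu g ->
  (forall x, 0 <= f x <= g x)%R -> pmod f <= pmod g.
Proof.
move=> mf mg fg; rewrite -[leRHS]mul1e; apply: le_pmod_scale => // x.
have /andP[f0 fgx] := fg x; have q0 := ltW (p_gt0 x).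
by rewrite mul1r ge0_ler_powR ?nnegrE// (le_trans f0).
Qed.

Lemma ae_le_pmod (f g : T -> R) (N : set T) : mu_measurable mu f ->
  mu_measurable mu g -> mu N = 0 -> (forall x, ~ N x -> 0 <= f x <= g x)%R ->
  pmod f <= pmod g.
Proof.
move=> mf mg N0 fg; apply: ae_ge0_le_integral => //.
- by move=> x _; rewrite lee_fin powR_ge0.
- exact: measurable_pmod.
- by move=> x _; rewrite lee_fin powR_ge0.
- exact: measurable_pmod.
exists N; split => //; first exact: mu0_measurable.
move=> x /= nle; apply: contrapT => Nx; apply: nle => _.
have /andP[f0 fgx] := fg _ Nx.
by rewrite lee_fin ge0_ler_powR ?nnegrE ?(ltW (p_gt0 x))// (le_trans f0).
Qed.

Lemma chebyshev_modular (f : T -> R) (A : set T) (t c : R) :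
  mu_measurable mu f -> measurable (A : set X) -> (0 <= t)%R -> (0 <= c)%R ->
  (forall x, c <= t `^ p x)%R ->
  c%:E * mu (A `&` [set y | (t < f y)%R]) <= \int[nu]_(x in A) (f x `^ p x)%:E.
Proof.
move=> mf mA t0 c0 ct; set D := A `&` _.
have mD : measurable (D : set X).
  apply: measurableI => //.
  have -> : [set y | (t < f y)%R] = [set: X] `&` f @^-1` `]t, +oo[%classic.
    by rewrite setTI; apply/seteqP; split => x; rewrite /= in_itv/= andbT.
  exact: mf.
have mfp := measurable_pmod mf.
have cD : \int[nu]_(x in D) cst c%:E x = c%:E * mu D by rewrite integral_cst.
rewrite -cD; apply: (@le_trans _ _ (\int[nu]_(x in D) (f x `^ p x)%:E)); last first.
  apply: ge0_subset_integral => //.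
  - exact: measurable_funTS.
  - by move=> x _; rewrite lee_fin powR_ge0.
  - exact: subIsetl.
apply: ge0_le_integral => //; first exact: measurable_funTS.
move=> x [_ /= tf]; rewrite lee_fin (le_trans (ct x))//.
by rewrite ge0_ler_powR ?nnegrE ?(ltW (p_gt0 x)) ?(ltW tf)// (le_trans t0)// ltW.
Qed.

Lemma mcap_le_sub (E F : set T) e f : E `<=` F -> e <= f ->
  mcap_le F e -> mcap_le E f.
Proof.
move=> EF ef [v [h [[vh [G [oG FG v1]]] vhe]]]; exists v, h; split.
  by split => //; exists G; split => //; exact: subset_trans FG.
exact: le_trans ef.
Qed.

Lemma pmod_max (f g : T -> R) : mu_measurable mu f -> mu_measurable mu g ->
  pmod (fun x => Num.max (f x) (g x)) <= pmod f + pmod g.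
Proof.
move=> mf mg; rewrite -ge0_integralD//; last first.
- exact: measurable_pmod.
- by move=> x _; rewrite lee_fin powR_ge0.
- exact: measurable_pmod.
- by move=> x _; rewrite lee_fin powR_ge0.
apply: ge0_le_integral => //.
- by move=> x _; rewrite lee_fin powR_ge0.
- by apply: measurable_pmod => //; exact: measurable_maxr.
- by apply: emeasurable_funD; exact: measurable_pmod.
- move=> x _; rewrite -EFinD lee_fin /Num.max.
  by case: ifP => _; rewrite ?lerDl ?lerDr powR_ge0.
Qed.

Lemma hgradient_max (v w g h : T -> R) : hgradient v g ->
  hgradient w h ->
  hgradient (fun x => Num.max (v x) (w x)) (fun x => Num.max (g x) (h x)).
Proof.
move=> [N1 N10 H1] [N2 N20 H2]; exists (N1 `|` N2).
  apply/eqP; rewrite -measure_le0 (le_trans (outer_measureU2 _ _ _))//.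
  by rewrite N10 N20 adde0.
move=> x y /not_orP[N1x N2x] /not_orP[N1y N2y].
apply: (le_trans (norm_max_le _ _ _ _)); rewrite ge_max; apply/andP; split.
  apply: (le_trans (H1 x y N1x N1y)); rewrite ler_wpM2l ?powR_ge0//.
  by apply: lerD; rewrite le_max lexx.
apply: (le_trans (H2 x y N2x N2y)); rewrite ler_wpM2l ?powR_ge0//.
by apply: lerD; rewrite le_max lexx orbT.
Qed.

Lemma mcap_leU (E F : set T) (a b : \bar R) :
  mcap_le E a -> mcap_le F b -> mcap_le (E `|` F) (a + b).
Proof.
move=> [v [g [[[mv mg v01 g0 vg] [U [oU EU Uv]]] ca]]].
move=> [w [h [[[mw mh w01 h0 wh] [V [oV FV Vw]]] cb]]].
exists (fun x => Num.max (v x) (w x)), (fun x => Num.max (g x) (h x)).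
split; first split; first split.
- exact: measurable_maxr.
- exact: measurable_maxr.
- move=> x; have /andP[v0 v1] := v01 x; have /andP[w0 w1] := w01 x.
  by rewrite le_max v0 ge_max v1.
- by move=> x; rewrite le_max g0.
- exact: hgradient_max.
- exists (U `|` V); split; [exact: openU|exact: setUSS|].
  move=> x [/Uv|/Vw] ->.
    by apply/max_idPl; have /andP[] := w01 x.
  by apply/max_idPr; have /andP[] := v01 x.
apply: (le_trans (leeD (pmod_max mv mw) (pmod_max mg mh))).
by rewrite addeACA; exact: leeD.
Qed.

(** Suprema of test functions are test functions; of the gradients one takes the
    power [1 / p] of the sum of the powers [p], which dominates each of them and
    has for modular the sum of their modulars. *)
Lemma mcap_le_bigcup (E : nat -> set T) (e : nat -> \bar R) :
  (forall n, mcap_le (E n) (e n)) -> \sum_(n <oo) e n < +oo ->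
  mcap_le (\bigcup_n E n) (\sum_(n <oo) e n).
Proof.
move=> hE eoo.
have /choice[v /choice[h H]] := hE.
have mv n : mu_measurable mu (v n) by have [[[]]] := H n.
have mh n : mu_measurable mu (h n) by have [[[]]] := H n.
have v01 n x : (0 <= v n x <= 1)%R by have [[[]]] := H n.
have h0 n x : (0 <= h n x)%R by have [[[]]] := H n.
have cost n : pmod (v n) + pmod (h n) <= e n by have [] := H n.
have e0 n : 0 <= e n by apply: le_trans (cost n); rewrite adde_ge0// pmod_ge0.
have /choice[N HN] : forall n, exists N : set T, mu N = 0 /\
    forall x y, ~ N x -> ~ N y ->
    (`|v n x - v n y| <= mdist x y `^ s * (h n x + h n y))%R.
  by move=> n; have [[[_ _ _ _ [N ? ?]]]] := H n; exists N.
pose Sh x := \sum_(n <oo) (h n x `^ p x)%:E.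
pose Sv x := \sum_(n <oo) (v n x `^ p x)%:E.
have mSh : measurable_fun [set: X] Sh.
  by apply: ge0_emeasurable_sum => *; [rewrite lee_fin powR_ge0|exact: measurable_pmod].
have mSv : measurable_fun [set: X] Sv.
  by apply: ge0_emeasurable_sum => *; [rewrite lee_fin powR_ge0|exact: measurable_pmod].
have Sh0 x : 0 <= Sh x by apply: nneseries_ge0 => *; rewrite lee_fin powR_ge0.
have Sv0 x : 0 <= Sv x by apply: nneseries_ge0 => *; rewrite lee_fin powR_ge0.
have ISh : \int[nu]_x Sh x = \sum_(n <oo) pmod (h n).
  apply: integral_nneseries => // n; first exact: measurable_pmod.
  by move=> x _; rewrite lee_fin powR_ge0.
have ISv : \int[nu]_x Sv x = \sum_(n <oo) pmod (v n).
  apply: integral_nneseries => // n; first exact: measurable_pmod.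
  by move=> x _; rewrite lee_fin powR_ge0.
have IS : \int[nu]_x Sv x + \int[nu]_x Sh x <= \sum_(n <oo) e n.
  rewrite ISh ISv -nneseriesD; try by move=> *; exact: pmod_ge0.
  by apply: lee_nneseries => // *; rewrite adde_ge0// pmod_ge0.
have Shoo : \int[nu]_x Sh x < +oo.
  apply: le_lt_trans eoo; apply: le_trans IS.
  by rewrite leeDr// integral_ge0.
have ShN : {ae nu, forall x, [set: X] x -> Sh x \is a fin_num}.
  have iSh : nu.-integrable [set: X] Sh.
    apply/integrableP; split; first exact: mSh.
    by under eq_integral do rewrite gee0_abs//.
  exact: (integrable_ae measurableT iSh).
have [N' [mN' N'0 hN']] := ShN.
have hub x : has_ubound (range (v ^~ x)).
  by exists 1%R => _ [n _ <-]; have /andP[] := v01 n x.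
have hsup x : has_sup (range (v ^~ x)) by split => //; exists (v 0%N x), 0%N.
pose w x := sup (range (v ^~ x)).
pose g x := ((fine (Sh x)) `^ (p x)^-1)%R.
have vw n x : (v n x <= w x)%R by apply: ub_le_sup => //; exists n.
have w0 x : (0 <= w x)%R.
  by have /andP[h1 _] := v01 0%N x; apply: (le_trans h1 (vw 0%N x)).
have w1 x : (w x <= 1)%R.
  apply: ge_sup; first by exists (v 0%N x), 0%N.
  by move=> _ [n _ <-]; have /andP[] := v01 n x.
have mw : mu_measurable mu w.
  have -> : w = (fun x => sups (v ^~ x) 0%N).
    apply/funext => x; rewrite /w /sups/=; congr sup.
    by apply/seteqP; split => [_ [n _ <-]|_ [n _ <-]]; exists n.
  by apply: measurable_fun_sups => // x _.
have mg : mu_measurable mu g.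
  apply: measurable_powR_fun.
    exact: (measurableT_comp (@fine_measurable R setT measurableT) mSh).
  exact: measurable_inv_exponent.
have hg n x : Sh x \is a fin_num -> (h n x <= g x)%R.
  move=> fS; rewrite /g -[leLHS]powRr1// -[in leLHS](@divff _ (p x)) ?gt_eqF//.
  rewrite powRrM ge0_ler_powR ?nnegrE ?invr_ge0 ?powR_ge0 ?fine_ge0 ?(ltW (p_gt0 x))//.
  rewrite -lee_fin fineK//.
  apply: le_trans (nneseries_lim_ge n.+1 _); last first.
    by move=> *; rewrite lee_fin powR_ge0.
  by rewrite big_nat_recr//= leeDr// sume_ge0// => *; rewrite lee_fin powR_ge0.
exists w, g; split; first split; first split => //.
- by move=> x; rewrite w0 w1.
- by move=> x; rewrite powR_ge0.
- exists (N' `|` \bigcup_n N n).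
    apply/eqP; rewrite -measure_le0.
    apply: (@le_trans _ _ (mu N' + mu (\bigcup_n N n))).
      exact: outer_measureU2.
    rewrite [mu N']N'0 add0e.
    apply: (le_trans (outer_measure_sigma_subadditive mu N)).
    by rewrite eseries0// => n _ _; have [] := HN n.
  have key x y : ~ (N' `|` \bigcup_n N n) x -> ~ (N' `|` \bigcup_n N n) y ->
      (w x <= w y + mdist x y `^ s * (g x + g y))%R.
    move=> /not_orP[N'x Nx] /not_orP[N'y Ny].
    have fx : Sh x \is a fin_num.
      by apply: contrapT => /negP fx; apply: N'x; apply: hN' => /= /(_ Logic.I); exact/negP.
    have fy : Sh y \is a fin_num.
      by apply: contrapT => /negP fy; apply: N'y; apply: hN' => /= /(_ Logic.I); exact/negP.
    apply: ge_sup; first by exists (v 0%N x), 0%N.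
    move=> _ [n _ <-].
    have := (HN n).2 x y; have Nnx : ~ N n x by move=> Nn; apply: Nx; exists n.
    have Nny : ~ N n y by move=> Nn; apply: Ny; exists n.
    move=> /(_ Nnx Nny); rewrite ler_norml => /andP[_].
    rewrite lerBlDl => /le_trans; apply; rewrite lerD//.
    by rewrite ler_wpM2l ?powR_ge0// lerD// hg.
  move=> x y Nx Ny; rewrite ler_norml; apply/andP; split.
    rewrite lerNl opprB lerBlDl metric_sym [(g x + _)%R]addrC.
    exact: key.
  by rewrite lerBlDl; exact: key.
- have /choice[G HG] : forall n, exists G,
      [/\ open G, E n `<=` G & forall x, G x -> v n x = 1%R].
    by move=> n; have [[_ ?]] := H n.
  exists (\bigcup_n G n); split.
  + by apply: bigcup_open => n _; have [] := HG n.
  + by apply: bigcup_sub => n _ x Ex; exists n => //; have [_ + _] := HG n; exact.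
  + move=> x [n _ Gx]; apply/eqP; rewrite eq_le w1 /=.
    by have [_ _ /(_ _ Gx) <-] := HG n.
- apply: le_trans IS; apply: leeD.
  + apply: ge0_le_integral => //.
    * by move=> x _; rewrite lee_fin powR_ge0.
    * exact: measurable_pmod.
    move=> x _; have [->|] := eqVneq (Sv x) +oo; first by rewrite leey.
    rewrite -ltey => Svx.
    have fS : Sv x \is a fin_num by rewrite ge0_fin_numE.
    rewrite -(fineK fS) lee_fin -[leRHS](@powR_inv_exp _ _ (p x)) ?fine_ge0//.
    rewrite ge0_ler_powR ?nnegrE ?powR_ge0 ?(ltW (p_gt0 x))//.
    apply: ge_sup; first by exists (v 0%N x), 0%N.
    move=> _ [n _ <-]; have /andP[vn0 _] := v01 n x.
    rewrite -[leLHS]powRr1// -[in leLHS](@divff _ (p x)) ?gt_eqF//.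
    rewrite powRrM ge0_ler_powR ?nnegrE ?invr_ge0 ?powR_ge0 ?fine_ge0 ?(ltW (p_gt0 x))//.
    rewrite -lee_fin fineK//.
    apply: le_trans (nneseries_lim_ge n.+1 _); last first.
      by move=> *; rewrite lee_fin powR_ge0.
    by rewrite big_nat_recr//= leeDr// sume_ge0// => *; rewrite lee_fin powR_ge0.
  + apply: ge0_le_integral => //.
    * by move=> x _; rewrite lee_fin powR_ge0.
    * exact: measurable_pmod.
    move=> x _; rewrite /g powR_inv_exp ?fine_ge0//.
    have [->|] := eqVneq (Sh x) +oo; first by rewrite leey.
    by rewrite -ltey => Shx; rewrite fineK// ge0_fin_numE.
Qed.

End modular_capacity.

(** * Null sets of the two capacities *)

Definition clip {R : realType} (a : R) : R := Num.min 1%R (Num.max 0%R a).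

Lemma clip01 {R : realType} (a : R) : (0 <= clip a <= 1)%R.
Proof. by rewrite /clip le_min ler01 le_max lexx /= ge_min lexx. Qed.

Lemma clip_lipschitz {R : realType} (a b : R) :
  (`|clip a - clip b| <= `|a - b|)%R.
Proof.
wlog ab : a b / (a <= b)%R.
  move=> W; have [ab|/ltW ab] := leP a b; first exact: W.
  by rewrite distrC [leRHS]distrC; exact: W.
rewrite [leRHS]distrC [leRHS]ger0_norm ?subr_ge0// ler_norml /clip !minEle !maxEle.
by case: (leP 0%R a) => ?; case: (leP 0%R b) => ?; rewrite ?ler10;
  try case: (leP 1%R a) => ?; try case: (leP 1%R b) => ?;
  apply/andP; split; lra.
Qed.

Lemma clip_ge1 {R : realType} (a : R) : (1 <= a)%R -> clip a = 1%R.
Proof. by move=> a1; rewrite /clip max_r ?(le_trans ler01)// min_l. Qed.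

Section capacity_comparison.
Context {R : realType} {T : pmetricType R} (mu : {outer_measure set T -> \bar R}).
Local Notation X := (caratheodory_type mu).
Local Notation nu := (caratheodory_restriction mu).
Variables (p : T -> R) (s pm pp : R).
Hypothesis mp : mu_measurable mu p.
Hypothesis pm_gt0 : (0 < pm)%R.
Hypothesis p_ge : forall x, (pm <= p x)%R.
Hypothesis p_le : forall x, (p x <= pp)%R.

Let p_gt0 x : (0 < p x)%R. Proof. exact: lt_le_trans (p_ge x). Qed.

Lemma modular_EFin (h : T -> R) (l : R) : (forall x, 0 <= h x)%R -> (0 < l)%R ->
  modular mu p (EFin \o h) l = pmod mu p (fun x => h x / l)%R.
Proof.
move=> h0 l0; apply: eq_integral => x _ /=.
by rewrite ger0_norm// inver gt_eqF// -EFinM poweR_EFin.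
Qed.

(** A finite modular forces finite values almost everywhere, so real
    representatives suffice. *)
Lemma Lp_norm_lt_real (g : T -> \bar R) (c : R) : mu_measurable mu g ->
  Lp_norm mu p g < c%:E ->
  exists (h : T -> R) (l : R), [/\ mu_measurable mu h, forall x, (0 <= h x)%R,
    (exists2 N : set T, mu N = 0 & forall x, ~ N x -> `|g x| = (h x)%:E),
    (0 < l < c)%R & pmod mu p (fun x => h x / l)%R <= 1].
Proof.
move=> mg /ereal_inf_lt[_ [l [l0 hl] <-]]; rewrite lte_fin => lc.
pose f x := (`|g x| / l%:E) `^ p x.
have fle x : (((fine `|g x|) / l) `^ p x)%:E <= f x.
  rewrite /f; case: (g x) => [r||] /=.
  - by rewrite inver gt_eqF// -EFinM poweR_EFin.
  - rewrite inver gt_eqF// mulyr gtr0_sg ?invr_gt0// mul1e.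
    by rewrite poweRyr ?leey// gt_eqF.
  - rewrite inver gt_eqF// mulyr gtr0_sg ?invr_gt0// mul1e.
    by rewrite poweRyr ?leey// gt_eqF.
have mh : mu_measurable mu (fun x => fine `|g x|).
  apply: (measurableT_comp (@fine_measurable R setT measurableT)).
  by apply: measurableT_comp.
have h0 x : (0 <= fine `|g x|)%R by rewrite fine_ge0.
have mhl : measurable_fun [set: X] (fun x : X => fine `|g x| / l)%R.
  exact: measurable_funM mh (measurable_cst _).
have mf : measurable_fun [set: X] f.
  have -> : f = (fun x => if `|g x| == +oo then +oo
                          else (((fine `|g x|) / l) `^ p x)%:E).
    apply/funext => x; rewrite /f; case: (g x) => [r||] //=.
    - by rewrite inver gt_eqF// -EFinM poweR_EFin.
    - by rewrite inver gt_eqF// mulyr gtr0_sg ?invr_gt0// mul1e poweRyr// gt_eqF.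
    - by rewrite inver gt_eqF// mulyr gtr0_sg ?invr_gt0// mul1e poweRyr// gt_eqF.
  apply: measurable_fun_ifT.
  - apply: (measurable_fun_bool true).
    rewrite setTI (_ : _ @^-1` _ = (fun x : X => `|g x|) @^-1` [set +oo]).
      rewrite -[X in measurable X]setTI.
      apply: (measurableT_comp (@abse_measurable R setT) mg) => //.
    by apply/seteqP; split => x /=; [move/eqP|move=> ->; rewrite eqxx].
  - exact: measurable_cst.
  - exact: (measurable_pmod mp mhl).
have foo : nu.-integrable [set: X] f.
  apply/integrableP; split => //.
  under eq_integral do rewrite gee0_abs ?poweR_ge0//.
  by apply: le_lt_trans hl _; rewrite ltry.
have [N [mN N0 hN]] := integrable_ae measurableT foo.
exists (fun x => fine `|g x|), l; split => //.
- exists N => // x Nx; rewrite fineK//; apply: contrapT => gx.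
  apply: Nx; apply: hN => /= /(_ Logic.I); rewrite /f; move: gx.
  case: (g x) => [r|_|_] //=; rewrite inver gt_eqF//.
  + by rewrite mulyr gtr0_sg ?invr_gt0// mul1e poweRyr// gt_eqF.
  + by rewrite mulyr gtr0_sg ?invr_gt0// mul1e poweRyr// gt_eqF.
- by rewrite l0 lc.
- apply: le_trans hl; apply: ge0_le_integral => //.
  + by move=> x _; rewrite lee_fin powR_ge0.
  + exact: (measurable_pmod mp mhl).
Qed.

Lemma powR_exp_le1 (l : R) x : (0 < l <= 1)%R -> (l `^ p x <= l `^ pm)%R.
Proof. by move=> l01; apply: ger_powR. Qed.

Lemma pmod_unscale (h : T -> R) (l c : R) : mu_measurable mu h ->
  (forall x, 0 <= h x)%R -> (0 < l)%R -> (forall x, l `^ p x <= c)%R ->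
  pmod mu p (fun x => h x / l)%R <= 1 -> pmod mu p h <= c%:E.
Proof.
move=> mh h0 l0 lc h1.
have c0 : (0 <= c)%R by apply: le_trans (lc point); rewrite powR_ge0.
rewrite -[leRHS]mule1; apply: le_trans (lee_wpmul2l _ h1); last by rewrite lee_fin.
apply: le_pmod_scale => //.
  exact: measurable_funM mh (measurable_cst _).
move=> x; have hE : (h x = h x / l * l)%R by rewrite divfK ?gt_eqF.
have l0' := ltW l0; rewrite [in leLHS]hE powRM ?divr_ge0// mulrC ler_wpM2r ?powR_ge0//.
Qed.

(** For [l <= 1] a quasinorm below [l] makes the modular at most [l `^ pm], and
    truncating a test function to the unit interval keeps its gradients. *)
Lemma capacity_mcap_le (e : R) : (0 < e)%R -> exists2 eta : R, (0 < eta)%R &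
  forall E, capacity mu s p E < eta%:E -> mcap_le mu p s E e%:E.
Proof.
move=> e0; pose eta := Num.min 1%R ((e / 2) `^ pm^-1)%R.
have eta0 : (0 < eta)%R by rewrite lt_min ltr01 powR_gt0 ?divr_gt0.
have small l x : (0 < l < eta)%R -> (l `^ p x <= e / 2)%R.
  rewrite /eta lt_min => /andP[l0 /andP[l1 le2]].
  apply: (@le_trans _ _ (l `^ pm)%R); first by rewrite powR_exp_le1// l0 ltW.
  rewrite -(@powR_inv_exp _ (e / 2)%R pm) ?divr_ge0 ?ltW//.
  by rewrite gt0_ltr_powR ?nnegrE ?powR_ge0// ltW.
exists eta => // E /ereal_inf_lt[_ [u [[[Lu su] Lpu] uE] <-]] ueta.
have nu0 : 0 <= Lp_norm mu p u.
  by apply: le_ereal_inf_tmp => _ [l [/ltW l0 _] <-]; rewrite lee_fin.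
have ns0 : 0 <= hajlasz_seminorm mu s p u.
  apply: le_ereal_inf_tmp => _ [g _ <-].
  by apply: le_ereal_inf_tmp => _ [l [/ltW l0 _] <-]; rewrite lee_fin.
have nu1 : Lp_norm mu p u < eta%:E.
  by apply: le_lt_trans ueta; rewrite /hajlasz_norm leeDl.
have ns1 : hajlasz_seminorm mu s p u < eta%:E.
  by apply: le_lt_trans ueta; rewrite /hajlasz_norm leeDr.
have [mu' _] := Lu.
have [hu [lu [mhu hu0 [Nu Nu0 uhu] lu0 hu1]]] := Lp_norm_lt_real mu' nu1.
have [_ [g [mg g0 [Ng Ng0 ug]] <-]] := ereal_inf_lt ns1.
move=> /(Lp_norm_lt_real mg)[h [l [mh h0 [Nh Nh0 gh] l0 h1]]].
pose v x := fine (mine 1 (maxe 0 (u x))).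
have vE x r : u x = r%:E -> v x = clip r.
  by rewrite /v => ->; rewrite -EFin_max -EFin_min.
have v01 x : (0 <= v x <= 1)%R.
  rewrite /v; case: (u x) => [r||].
  - by rewrite -EFin_max -EFin_min; exact: clip01.
  - by rewrite max_r ?leey// min_l ?leey//= ler01 lexx.
  - by rewrite max_l ?leNye// min_r//= ?lee_fin ?ler01 lexx.
have mv : mu_measurable mu v.
  apply: (measurableT_comp (@fine_measurable R setT measurableT)).
  by apply: measurable_mine => //; apply: measurable_maxe.
exists v, h; split; first split; first split => //.
- exists (Nu `|` Ng `|` Nh).
    apply/eqP; rewrite -measure_le0.
    apply: (le_trans (outer_measureU2 _ _ _)); rewrite Nh0 adde0.
    apply: (le_trans (outer_measureU2 _ _ _)); rewrite Nu0 Ng0 adde0//.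
  move=> x y /not_orP[/not_orP[Nux Ngx] Nhx] /not_orP[/not_orP[Nuy Ngy] Nhy].
  have fin z : ~ Nu z -> exists r, u z = r%:E.
    by move=> /uhu; case: (u z) => [r|//|//] _; exists r.
  have [a ua] := fin _ Nux; have [b ub] := fin _ Nuy.
  have := ug _ _ Ngx Ngy; rewrite ua ub.
  rewrite -(gee0_abs (g0 x)) -(gee0_abs (g0 y)) gh// gh//.
  rewrite -EFinB abse_EFin -EFinD -EFinM lee_fin (vE _ _ ua) (vE _ _ ub).
  exact: le_trans (clip_lipschitz _ _).
- exists [set x | nbhs x [set x | 1 <= u x]]; split.
  + exact: open_interior.
  + by move=> x Ex; exact: uE.
  + move=> x /nbhs_singleton /= u1; rewrite /v max_r ?(le_trans _ u1)//.
    by rewrite min_l.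
- rewrite [in leRHS](splitr e) EFinD; apply: leeD.
  + apply: (@le_trans _ _ (pmod mu p hu)); last first.
      have /andP[lu1 _] := lu0.
      by apply: (pmod_unscale mhu hu0 lu1) hu1 => x; exact: small.
    apply: (ae_le_pmod mp p_gt0 mv mhu Nu0) => x Nux.
    have /andP[-> _] := v01 x; rewrite /=.
    have := uhu _ Nux; case ux : (u x) => [r|//|//]; rewrite abse_EFin => -[rh].
    rewrite (vE _ _ ux) -rh /clip ge_min ge_max normr_ge0 ler_norm orbT//.
  + have /andP[l1 _] := l0.
    by apply: (pmod_unscale mh h0 l1) h1 => x; exact: small.
Qed.

(** Conversely, a modular of at most [l `^ pp] makes the quasinorm at most
    [l]. *)
Lemma mcap_le_capacity0 E :
  (forall e : R, (0 < e)%R -> mcap_le mu p s E e%:E) -> capacity mu s p E = 0.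
Proof.
move=> hE; apply/eqP; rewrite eq_le; apply/andP; split; last first.
  apply: le_ereal_inf_tmp => _ [u _ <-]; apply: adde_ge0.
    by apply: le_ereal_inf_tmp => _ [l [/ltW l0 _] <-]; rewrite lee_fin.
  apply: le_ereal_inf_tmp => _ [g _ <-].
  by apply: le_ereal_inf_tmp => _ [l [/ltW l0 _] <-]; rewrite lee_fin.
apply/lee_addgt0Pr => e e0; rewrite add0e.
pose l := Num.min 1%R (e / 2)%R.
have l0 : (0 < l)%R by rewrite lt_min ltr01 divr_gt0.
have l1 : (l <= 1)%R by rewrite ge_min lexx.
have [v [h [[[mv mh v01 h0 [N N0 vh]] [G [oG EG Gv]]] cost]]] :=
  hE (l `^ pp)%R (powR_gt0 _ l0).
have v0 x : (0 <= v x)%R by have /andP[] := v01 x.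
have unit_mod (f : T -> R) : mu_measurable mu f -> (forall x, 0 <= f x)%R ->
    pmod mu p f <= (l `^ pp)%:E -> pmod mu p (fun x => f x / l)%R <= 1.
  move=> mf f0 fl.
  have c0 : (0 <= (l `^ pp)^-1)%R by rewrite invr_ge0 powR_ge0.
  apply: (@le_trans _ _ (((l `^ pp)^-1)%:E * pmod mu p f)); last first.
    apply: (@le_trans _ _ (((l `^ pp)^-1)%:E * (l `^ pp)%:E)).
      by rewrite lee_wpmul2l.
    by rewrite -EFinM mulVf// gt_eqF// powR_gt0.
  apply: le_pmod_scale => //; first exact: measurable_funM mf (measurable_cst _).
  move=> x; rewrite powRM ?invr_ge0 ?(ltW l0)// mulrC ler_wpM2r ?powR_ge0//.
  rewrite powR_invl ?(ltW l0)// lef_pV2 ?posrE ?powR_gt0//.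
  by apply: ger_powR => //; rewrite l0.
have vl : pmod mu p (fun x => v x / l)%R <= 1.
  by apply: unit_mod => //; apply: le_trans cost; rewrite leeDl// pmod_ge0.
have hl : pmod mu p (fun x => h x / l)%R <= 1.
  by apply: unit_mod => //; apply: le_trans cost; rewrite leeDr// pmod_ge0.
have Lp_le (f : T -> R) : (forall x, 0 <= f x)%R -> pmod mu p (fun x => f x / l)%R <= 1 ->
    Lp_norm mu p (EFin \o f) <= l%:E.
  move=> f0 fl; apply: ereal_inf_lbound; exists l => //; split => //.
  by rewrite modular_EFin.
have sg : s_gradient mu s (EFin \o v) (EFin \o h).
  split.
  - exact/measurable_EFinP.
  - by move=> x /=; rewrite lee_fin.
  - by exists N.
have sl : hajlasz_seminorm mu s p (EFin \o v) <= l%:E.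
  by apply: le_trans (Lp_le _ h0 hl); apply: ereal_inf_lbound; exists (EFin \o h).
have Lv : L0 mu (EFin \o v).
  by split; [exact/measurable_EFinP|apply: nearW].
apply: (@le_trans _ _ (l%:E + l%:E)); last first.
  rewrite -EFinD lee_fin (_ : e = e / 2 + e / 2)%R; last by rewrite -splitr.
  by rewrite lerD// ge_min lexx orbT.
apply: le_trans (leeD (Lp_le _ v0 vl) sl).
apply: ereal_inf_lbound; exists (EFin \o v) => //; split.
- split; first by split => //; exact: le_lt_trans sl (ltry _).
  split=> //; exists l => //; rewrite modular_EFin//; exact: le_lt_trans vl (ltry _).
- move=> x Ex; rewrite /= nbhsE; exists G; first by split => //; exact: EG.
  by move=> y Gy /=; rewrite lee_fin Gv.
Qed.

End capacity_comparison.

(** * Vanishing of the rescaled energy *)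

Section energy.
Context {R : realType} {T : pmetricType R} (mu : {outer_measure set T -> \bar R}).
Local Notation X := (caratheodory_type mu).
Local Notation nu := (caratheodory_restriction mu).
Hypothesis mu_regular : borel_regular mu.
Hypothesis mu_balls : balls_positive_finite mu.
Variable cd : R.
Hypothesis cd_ge1 : (1 <= cd)%R.
Hypothesis vol_dbl :
  forall (x : T) (r : R), (0 < r)%R -> (vol mu x (2 * r) <= cd * vol mu x r)%R.
Variables (p : T -> R) (s pm Cp : R).
Hypothesis mp : mu_measurable mu p.
Hypothesis pm_gt0 : (0 < pm)%R.
Hypothesis p_ge : forall x, (pm <= p x)%R.
Hypothesis Cp_gt0 : (0 < Cp)%R.
Hypothesis p_lh : forall x y : T,
  (`|p x - p y| <= Cp / ln (expR 1 + (mdist x y)^-1))%R.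
Hypothesis s_gt0 : (0 < s)%R.
Hypothesis s_le1 : (s <= 1)%R.

Let p_gt0 x : (0 < p x)%R. Proof. exact: lt_le_trans (p_ge x). Qed.

Lemma mcap_le0 : mcap_le mu p s set0 0.
Proof.
exists (cst 0%R), (cst 0%R); split; first split; first split.
- exact: measurable_cst.
- exact: measurable_cst.
- by move=> x /=; rewrite lexx ler01.
- by move=> x /=; rewrite lexx.
- exists set0; first exact: outer_measure0.
  by move=> x y _ _; rewrite subrr normr0 addr0 mulr0.
- by exists set0; split => //; exact: open0.
have -> : pmod mu p (cst 0%R) = 0; last by rewrite adde0.
by apply: integral0_eq => x _; rewrite powR0// gt_eqF.
Qed.

Lemma mcap_null_bigcup (E : nat -> set T) :
  (forall n (e : R), (0 < e)%R -> mcap_le mu p s (E n) e%:E) ->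
  forall e : R, (0 < e)%R -> mcap_le mu p s (\bigcup_n E n) e%:E.
Proof.
move=> hE e e0.
have eps := @epsilon_trick0 R e xpredT (ltW e0).
apply: (mcap_le_sub (@subset_refl _ _) eps).
apply: mcap_le_bigcup => //.
- by move=> n; apply: hE; rewrite divr_gt0// ltr0n expn_gt0.
- exact: le_lt_trans eps (ltry _).
Qed.

Definition freeze : R := expR (Cp * (s * ln 10 + s)).

(** The logarithm of [r `^ s] is of the order of [ln r^-1], so in its powers the
    exponent may be frozen over a ball of radius comparable to [r]. *)
Lemma freeze_powR x y (r t : R) : (0 < r <= 1)%R -> (mdist x y <= 10 * r)%R ->
  t = (r `^ s)%R \/ t = ((r `^ s)^-1)%R ->
  (t `^ p x <= freeze * t `^ p y)%R.
Proof.
move=> /andP[r0 r1] xyr ht.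
have lnr : (ln r <= 0)%R by rewrite ln_le0.
have t0 : (0 < t)%R by case: ht => ->; rewrite ?invr_gt0 powR_gt0.
have lnt : (`|ln t| = s * ln r^-1)%R.
  rewrite lnV// mulrN; case: ht => ->; rewrite ?lnV ?posrE ?powR_gt0// ln_powR.
    by rewrite ler0_norm// mulr_ge0_le0// ltW.
  by rewrite ger0_norm// oppr_ge0 mulr_ge0_le0// ltW.
have r10 : (0 < 10 * r)%R by rewrite mulr_gt0.
apply: (log_holder_powR Cp_gt0 p_lh r10 xyr t0 _ (ltW s_gt0)) => //.
- by rewrite mulr_ge0 ?(ltW s_gt0)// ln_ge0// ler1n.
- rewrite lnt invfM lnM ?posrE ?invr_gt0// mulrDr addrA -mulrDr.
  by rewrite (@lnV _ 10%R) ?posrE// subrr mulr0 add0r.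
Qed.

(** The Lipschitz cutoff of the ball has the gradient [r ^ (- s)] on the doubled
    ball, and the exponent in its powers may be frozen at the centre. *)
Lemma mcap_le_ball x (r : R) : (0 < r <= 1)%R ->
  mcap_le mu p s (ball x (5 * r))
    (2 * freeze * cd ^+ 4 * (r `^ s)^-1 `^ p x * vol mu x r)%:E.
Proof.
move=> r01; have /andP[r0 r1] := r01.
have rs0 : (0 < r `^ s)%R by rewrite powR_gt0.
have rs1 : (1 <= (r `^ s)^-1)%R.
  by rewrite invf_ge1// powR_le1 ?(ltW s_gt0) ?(ltW r0).
have mB := ball_mu_measurable mu_regular x (10 * r).
pose v y := clip (2 - mdist x y / (5 * r))%R.
pose h y := ((r `^ s)^-1 * \1_(ball x (10 * r)) y)%R.
have mdm := mu_measurable_mdist mu_regular x.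
have mv : mu_measurable mu v.
  apply: measurable_minr; first exact: measurable_cst.
  apply: measurable_maxr; first exact: measurable_cst.
  apply: measurable_funB; first exact: measurable_cst.
  exact: measurable_funM mdm (measurable_cst _).
have mh : mu_measurable mu h.
  by apply: measurable_funM => //; exact: measurable_indic.
have v01 y : (0 <= v y <= 1)%R by exact: clip01.
have h0 y : (0 <= h y)%R by rewrite mulr_ge0// invr_ge0 ltW.
have hB y : ball x (10 * r) y -> h y = ((r `^ s)^-1)%R.
  by move=> By; rewrite /h indicE mem_set// mulr1.
have vB y : ~ ball x (10 * r) y -> v y = 0%R.
  rewrite in_ballE => /negP; rewrite -leNgt => hy; rewrite /v /clip max_l.
    by rewrite min_r.
  by rewrite subr_le0 ler_pdivlMr ?mulr_gt0//; lra.
have vlip y z : (`|v y - v z| <= mdist y z `^ s * (r `^ s)^-1)%R.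
  have d0 := mdist_ge0 y z.
  have [dr|dr] := leP r (mdist y z).
    apply: (@le_trans _ _ 1%R).
      rewrite ler_norml; have := v01 y; have := v01 z; lra.
    rewrite ler_pdivlMr// mul1r ge0_ler_powR ?nnegrE ?(ltW s_gt0) ?(ltW r0)//.
  apply: (le_trans (clip_lipschitz _ _)).
  rewrite (_ : (2 - mdist x y / (5 * r) - (2 - mdist x z / (5 * r)) =
      (mdist x z - mdist x y) / (5 * r))%R); last by rewrite mulrBl; ring.
  apply: (@le_trans _ _ (mdist y z / r)%R).
    rewrite normrM [X in (_ * X)%R]gtr0_norm ?invr_gt0 ?mulr_gt0//.
    rewrite ler_pdivrMr ?mulr_gt0// mulrCA mulfVK ?gt_eqF//.
    have := metric_triangle x y z; have := metric_triangle x z y.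
    rewrite (metric_sym z y) => h1 h2.
    by rewrite ler_norml; lra.
  have -> : (mdist y z `^ s * (r `^ s)^-1 = (mdist y z / r) `^ s)%R.
    by rewrite powR_divr.
  have [->|dn0] := eqVneq (mdist y z) 0%R; first by rewrite mul0r powR_ge0.
  apply: ger1_powR => //; rewrite divr_gt0// ?lt_neqAle 1?eq_sym ?dn0//=.
  by rewrite ler_pdivrMr// mul1r ltW.
exists v, h; split; first split; first split => //.
- exists set0; first exact: outer_measure0.
  move=> y z _ _.
  have [By|nBy] := pselect (ball x (10 * r) y).
    apply: (le_trans (vlip y z)); rewrite ler_wpM2l ?powR_ge0//.
    by rewrite (hB y)// lerDl.
  have [Bz|nBz] := pselect (ball x (10 * r) z).
    apply: (le_trans (vlip y z)); rewrite ler_wpM2l ?powR_ge0//.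
    by rewrite (hB z)// lerDr.
  by rewrite !vB// subrr normr0 mulr_ge0 ?powR_ge0// addr_ge0.
- exists (ball x (5 * r)); split => //; first exact: ball_open_mdist.
  move=> y; rewrite in_ballE => hy; apply: clip_ge1.
  have : (mdist x y / (5 * r) <= 1)%R by rewrite ler_pdivrMr ?mulr_gt0// mul1r ltW.
  by lra.
have vh y : (0 <= v y <= h y)%R.
  have /andP[-> v1] := v01 y; rewrite /=.
  have [By|nBy] := pselect (ball x (10 * r) y).
    by rewrite hB// (le_trans v1).
  by rewrite vB.
have hcost : pmod mu p h <= (freeze * (r `^ s)^-1 `^ p x * (cd ^+ 4 * vol mu x r))%:E.
  apply: (@le_trans _ _ (\int[nu]_y ((freeze * (r `^ s)^-1 `^ p x)%:E *
      (\1_(ball x (10 * r)) y)%:E))).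
    apply: ge0_le_integral => //.
    - by move=> y _; rewrite lee_fin powR_ge0.
    - exact: measurable_pmod.
    - apply: emeasurable_funM => //; apply/measurable_EFinP.
      exact: measurable_indic.
    - move=> y _; rewrite -EFinM lee_fin.
      have [By|nBy] := pselect (ball x (10 * r) y).
        rewrite hB// indicE mem_set// mulr1; apply: freeze_powR r01 _ _.
          by move: By; rewrite in_ballE metric_sym => /ltW.
        by right.
      by rewrite /h indicE memNset// !mulr0 powR0// gt_eqF.
  have c0 : (0 <= freeze * (r `^ s)^-1 `^ p x)%R.
    by rewrite mulr_ge0 ?powR_ge0// expR_ge0.
  rewrite ge0_integralZl//; first last.
  - by apply/measurable_EFinP; exact: measurable_indic.
  rewrite integral_indic// setIT [in leRHS]EFinM lee_wpmul2l//.
  rewrite [leLHS](mu_ballE mu_balls) ?mulr_gt0// lee_fin.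
  apply: (vol_doubling_iter mu_balls cd_ge1 vol_dbl) => //; first by rewrite mulr_gt0.
  by rewrite mdistxx add0r ler_wpM2r ?(ltW r0)// -natrX ler_nat.
apply: (@le_trans _ _ (pmod mu p h + pmod mu p h)).
  by rewrite leeD2r// le_pmod.
apply: (le_trans (leeD hcost hcost)); rewrite -EFinD lee_fin.
rewrite le_eqVlt; apply/orP; left; apply/eqP; ring.
Qed.

Variable g : T -> R.
Hypothesis mg : mu_measurable mu g.
Hypothesis g_ge0 : forall x, (0 <= g x)%R.
Hypothesis g_fin : pmod mu p g < +oo.

Definition tail (K : R) (x : T) : R :=
  if (K < g x)%R then (g x `^ p x)%R else 0%R.

Lemma tail_ge0 K x : (0 <= tail K x)%R.
Proof. by rewrite /tail; case: ifP => // _; rewrite powR_ge0. Qed.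

Lemma measurable_tail K : measurable_fun [set: X] (fun x => (tail K x)%:E).
Proof.
apply/measurable_EFinP; apply: measurable_fun_ifT => //.
  exact: measurable_fun_ltr.
exact: measurable_powR_fun.
Qed.

Lemma integrable_pmod : nu.-integrable [set: X] (fun x => (g x `^ p x)%:E).
Proof.
apply/integrableP; split; first exact: measurable_pmod.
by under eq_integral do rewrite gee0_abs ?lee_fin ?powR_ge0//.
Qed.

Lemma tail_small (e : R) : (0 < e)%R ->
  exists2 K : R, (0 < K)%R & \int[nu]_x (tail K x)%:E <= e%:E.
Proof.
move=> e0.
have [|||||] := @dominated_convergence _ X R nu setT measurableT
  (fun n x => (tail n.+1%:R x)%:E) (cst 0) (fun x => (g x `^ p x)%:E).
- by move=> n; exact: measurable_tail.
- exact: measurable_cst.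
- apply: aeW => x _; apply: cvg_near_cst.
  near=> n; rewrite /tail ifF//; apply/negbTE; rewrite -leNgt.
  apply: (@le_trans _ _ n%:R); last by rewrite ler_nat.
  by near: n; exact: nbhs_infty_ger.
- exact: integrable_pmod.
- apply: aeW => x n _; rewrite gee0_abs ?lee_fin ?tail_ge0// /tail.
  by case: ifP => // _; rewrite powR_ge0.
move=> _ _; rewrite integral0 => /fine_cvgP[fin cv].
have {}cv := cvgr_lt _ cv _ e0.
have lt_e : \forall n \near \oo, (fine (\int[nu]_x (tail n.+1%:R x)%:E) < e)%R.
  exact: cv.
have [n [/= fn le]] : exists n, (\int[nu]_x (tail n.+1%:R x)%:E \is a fin_num) /\
    (fine (\int[nu]_x (tail n.+1%:R x)%:E) < e)%R.
  by have [n _ hn] := filterI fin lt_e; exists n; exact: (hn n (leqnn n)).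
exists n.+1%:R; first by rewrite ltr0n.
by rewrite -(fineK fn) lee_fin ltW.
Unshelve. all: by end_near.
Qed.

(** The modular, over a ball, of the gradient rescaled to unit radius. *)
Definition energy (x : T) (r : R) : \bar R :=
  \int[nu]_(y in ball x r) ((r `^ s * g y) `^ p y)%:E.

(** Where [g <= K] the rescaled gradient is at most [k]; elsewhere the power of
    [r `^ s] is frozen and what remains is the tail of [g ^ p]. *)
Lemma energy_le_tail x (r K k l : R) : (0 < r <= 1)%R -> (0 < K)%R ->
  (r `^ s * K <= k)%R -> (forall y, k `^ p y <= l)%R ->
  energy x r <= (l * vol mu x r)%:E +
    (freeze * (r `^ s) `^ p x)%:E * \int[nu]_(y in ball x r) (tail K y)%:E.
Proof.
move=> r01 K0 rK kl; have /andP[r0 r1] := r01.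
have c0 : (0 <= freeze * (r `^ s) `^ p x)%R.
  by rewrite mulr_ge0 ?powR_ge0// expR_ge0.
have l0 : (0 <= l)%R by apply: le_trans (kl x); rewrite powR_ge0.
have mB := ball_mu_measurable mu_regular x r.
have mtB : measurable_fun (ball x r : set X) (fun y : X => (tail K y)%:E).
  exact: measurable_funTS (measurable_tail K).
rewrite -ge0_integralZl//; last by move=> y _; rewrite lee_fin tail_ge0.
rewrite EFinM -(mu_ballE mu_balls)// -(integral_cst nu mB l%:E).
rewrite -ge0_integralD//; first last.
- by apply: emeasurable_funM.
- by move=> y _; rewrite mule_ge0// lee_fin// tail_ge0.
apply: ge0_le_integral => //.
- by move=> y _; rewrite lee_fin powR_ge0.
- apply: measurable_funTS; apply: measurable_pmod => //.
  by apply: measurable_funM.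
- by apply: emeasurable_funD => //; apply: emeasurable_funM.
move=> y By; rewrite /cst -EFinM -EFinD lee_fin /tail.
have rs0 : (0 <= r `^ s)%R by rewrite powR_ge0.
case: ltP => gK.
  rewrite powRM//; apply: ler_wpDl => //; rewrite ler_wpM2r ?powR_ge0//.
  apply: freeze_powR r01 _ _; last by left.
  move: By; rewrite in_ballE metric_sym => /ltW/le_trans; apply; lra.
rewrite mulr0 addr0; apply: le_trans (kl y).
rewrite ge0_ler_powR ?nnegrE ?(ltW (p_gt0 y)) ?mulr_ge0//.
- by apply: le_trans rK; rewrite mulr_ge0// ltW.
- by apply: le_trans rK; rewrite ler_wpM2l.
Qed.

Definition energetic (l : R) : set T := [set x | forall r1 : R, (0 < r1)%R ->
  exists2 r, (0 < r < r1)%R & (l * vol mu x r)%:E < energy x r].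

(** Where the energy is not small the balls at hand carry much of the tail of
    [g ^ p], because truncated gradients have small energy at small scales;
    disjoint such balls, enlarged, cover at a cost controlled by that tail. *)
Lemma mcap_energetic (l e : R) : (0 < l)%R -> (0 < e)%R ->
  mcap_le mu p s (energetic l) e%:E.
Proof.
move=> l0 e0.
pose C := (2 * freeze * cd ^+ 4 * (2 / l) * freeze)%R.
have f0 : (0 < freeze)%R by exact: expR_gt0.
have cd0 : (0 < cd)%R by exact: lt_le_trans cd_ge1.
have C0 : (0 < C)%R by rewrite !mulr_gt0 ?exprn_gt0 ?invr_gt0.
have [K K0 hK] := @tail_small (e / C)%R (divr_gt0 e0 C0).
pose k := Num.min 1%R ((l / 2) `^ pm^-1)%R.
have l20 : (0 < l / 2)%R by rewrite divr_gt0.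
have k0 : (0 < k)%R by rewrite lt_min ltr01 powR_gt0.
have kl y : (k `^ p y <= l / 2)%R.
  apply: (@le_trans _ _ (k `^ pm)%R).
    by apply: ger_powR => //; rewrite k0/= ge_min lexx.
  rewrite -[leRHS](@powR_inv_exp _ (l / 2)%R pm) ?(ltW l20)//.
  rewrite ge0_ler_powR ?nnegrE ?powR_ge0 ?(ltW pm_gt0) ?(ltW k0)//.
  by rewrite ge_min lexx orbT.
pose r1 := Num.min 1%R ((k / K) `^ s^-1)%R.
have r10 : (0 < r1)%R by rewrite lt_min ltr01 powR_gt0 ?divr_gt0.
have rK r : (0 < r < r1)%R -> (0 < r <= 1)%R /\ (r `^ s * K <= k)%R.
  rewrite /r1 lt_min => /andP[r0 /andP[rl1 rk]]; split; first by rewrite r0 ltW.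
  rewrite -ler_pdivlMr// -[leRHS](@powR_inv_exp _ (k / K)%R s)//; last first.
    by rewrite divr_ge0 ?ltW.
  by rewrite ge0_ler_powR ?nnegrE ?powR_ge0 ?(ltW s_gt0) ?(ltW r0) ?(ltW rk).
pose V := [set b : T * R | (0 < b.2 < r1)%R /\
  (l * vol mu b.1 b.2)%:E < energy b.1 b.2].
have Vtail b : V b ->
    (2 * freeze * cd ^+ 4 * (b.2 `^ s)^-1 `^ p b.1 * vol mu b.1 b.2)%:E
      <= C%:E * \int[nu]_(y in pball b) (tail K y)%:E.
  case: b => x r [/= rr1 hE]; have [r01 rKk] := rK _ rr1.
  have /andP[r0 _] := r01.
  have mB := ball_mu_measurable mu_regular x r.
  have := lt_le_trans hE (energy_le_tail x r01 K0 rKk kl).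
  have Ifin : \int[nu]_(y in ball x r) (tail K y)%:E \is a fin_num.
    rewrite ge0_fin_numE; last by apply: integral_ge0 => y _; rewrite lee_fin tail_ge0.
    apply: le_lt_trans (ltry (e / C)%R); apply: le_trans hK.
    apply: ge0_subset_integral => //; first exact: measurable_tail.
    by move=> y _; rewrite lee_fin tail_ge0.
  rewrite /pball/= -(fineK Ifin); set I := fine _.
  rewrite -EFinM -EFinD -EFinM lte_fin lee_fin => hI.
  have rp0 : (0 < (r `^ s) `^ p x)%R by rewrite !powR_gt0.
  rewrite powR_invl ?powR_ge0//.
  have hv : (vol mu x r * (l / 2) <= freeze * (r `^ s) `^ p x * I)%R by lra.
  have {}hv : (vol mu x r <= (2 / l) * (freeze * (r `^ s) `^ p x * I))%R.
    rewrite -ler_pdivrMl ?divr_gt0// invf_div mulrC//.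
  apply: (@le_trans _ _ (2 * freeze * cd ^+ 4 * ((r `^ s) `^ p x)^-1 *
      ((2 / l) * (freeze * (r `^ s) `^ p x * I)))%R).
    rewrite ler_wpM2l// !mulr_ge0// ?exprn_ge0 ?invr_ge0//; exact: ltW.
  rewrite le_eqVlt; apply/orP; left; apply/eqP; rewrite /C; field.
  by rewrite !gt_eqF.
have VM b : V b -> (0 < b.2 <= 1)%R by move=> [/rK[]].
have Vpos b : V b -> 0 < \int[nu]_(y in pball b) (tail K y)%:E.
  move=> Vb; have := Vtail b Vb; have /andP[b0 _] := VM b Vb.
  set I := (X in _ * X) => h; rewrite ltNge; apply/negP => I0.
  have : C%:E * I <= 0 by rewrite mule_ge0_le0// lee_fin ltW.
  apply/negP; rewrite -ltNge; apply: lt_le_trans h; rewrite lte_fin.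
  by rewrite !mulr_gt0 ?exprn_gt0 ?powR_gt0 ?invr_gt0 ?powR_gt0 ?vol_gt0.
have [b [bV tb covb sumb]] := vitali_sequence mu_regular VM (measurable_tail K)
  (fun x => tail_ge0 K x) (le_lt_trans hK (ltry _)) Vpos.
pose I n := \int[nu]_(y in pball (b n)) (tail K y)%:E.
have I0 n : 0 <= I n by apply: integral_ge0 => y _; rewrite lee_fin tail_ge0.
have sumI : \sum_(n <oo) C%:E * I n <= e%:E.
  rewrite nneseriesZl//.
  apply: (@le_trans _ _ (C%:E * (e / C)%:E)); last first.
    by rewrite -EFinM mulrC divfK// gt_eqF.
  by rewrite lee_wpmul2l ?lee_fin ?(ltW C0)//; exact: le_trans hK.
apply: (mcap_le_sub _ sumI); last first.
  apply: (@mcap_le_bigcup _ _ _ _ _ mp p_gt0 (fun n => ball (b n).1 (5 * (b n).2)%R)).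
    move=> n; have [Vn|b0] := bV n.
      by apply: (mcap_le_sub (@subset_refl _ _) (Vtail _ Vn)); exact: mcap_le_ball (VM _ Vn).
    apply: (@mcap_le_sub _ _ _ _ _ _ set0 0).
    - by rewrite b0/= mulr0 ball_le0.
    - by rewrite mule_ge0// lee_fin ltW.
    - exact: mcap_le0.
  exact: le_lt_trans sumI (ltry _).
move=> x Ex; have [r rr1 hE] := Ex r1 r10.
have [n Vn cov] := covb (x, r) (conj rr1 hE).
exists n => //; apply: cov; rewrite /pball/= in_ballE mdistxx.
by have /andP[] := rr1.
Qed.

Lemma energy_vanishes : exists2 Z : set T,
  (forall e : R, (0 < e)%R -> mcap_le mu p s Z e%:E) &
  forall x, ~ Z x -> forall l : R, (0 < l)%R -> exists2 r1 : R, (0 < r1)%R &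
    forall r, (0 < r < r1)%R -> energy x r <= (l * vol mu x r)%:E.
Proof.
exists (\bigcup_n energetic n.+1%:R^-1).
  by apply: mcap_null_bigcup => n e e0; exact: mcap_energetic.
move=> x Zx l l0; apply: contrapT => /forall2NP h; apply: Zx.
have [n nl] := ltr_add_invr l0.
exists n => //= r1 r10; apply: contrapT => /forall2NP hr.
have [//|] := h r1; apply => r rr1; rewrite leNgt; apply/negP => hl.
have [//|] := hr r; apply; apply: le_lt_trans hl; rewrite lee_fin.
by rewrite ler_wpM2r ?vol_ge0// ltW// -[ltLHS]add0r.
Qed.

End energy.

(** * A maximal function of median type *)

Lemma dyadic_bracket (R : realType) (a : R) : (1 <= a)%R ->
  exists k : nat, (2 ^+ k <= a < 2 ^+ k.+1)%R.
Proof.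
move=> a1; have ex : exists n : nat, (a < 2 ^+ n)%R.
  exists (Num.truncn a).+1; apply: (lt_le_trans (truncnS_gt a)).
  by rewrite -natrX ler_nat ltnW// ltn_expl.
case: (ex_minnP ex) => -[|k] ak hk.
  by move: ak; rewrite expr0 ltNge a1.
exists k; rewrite ak andbT leNgt; apply/negP => /hk.
by rewrite ltnn.
Qed.

Section maximal.
Context {R : realType} {T : pmetricType R} (mu : {outer_measure set T -> \bar R}).
Local Notation X := (caratheodory_type mu).
Local Notation nu := (caratheodory_restriction mu).
Hypothesis mu_regular : borel_regular mu.
Hypothesis mu_balls : balls_positive_finite mu.
Variable cd : R.
Hypothesis cd_ge1 : (1 <= cd)%R.
Hypothesis vol_dbl :
  forall (x : T) (r : R), (0 < r)%R -> (vol mu x (2 * r) <= cd * vol mu x r)%R.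

(** The weak type (1,1) estimate for an indicator: disjoint balls selected by
    Vitali's lemma each hold the proportion [th] of points of [A]. *)
Lemma mu_dense_balls (A : set T) (th : R) : (0 < th)%R ->
  measurable (A : set X) -> mu A < +oo ->
  mu (\bigcup_(b in [set b : T * R | (0 < b.2 <= 1)%R /\
        (th * vol mu b.1 b.2)%:E < mu (pball b `&` A)]) pball b)
    <= (cd ^+ 3 / th)%:E * mu A.
Proof.
move=> th0 mA Aoo; set V := (X in \bigcup_(b in X) _).
have cd0 : (0 < cd)%R by exact: lt_le_trans cd_ge1.
have m1 : measurable_fun [set: X] (fun x : X => (\1_A x : R)%:E).
  by apply/measurable_EFinP; exact: measurable_indic.
have int1 : \int[nu]_x (\1_A x : R)%:E = mu A by rewrite integral_indic// setIT.
have intb (b : T * R) : \int[nu]_(x in pball b) (\1_A x : R)%:E = mu (pball b `&` A).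
  have mB := ball_mu_measurable mu_regular b.1 b.2.
  by rewrite (integral_indic nu mB mA) setIC.
have [||b [bV tb covb sumb]] := vitali_sequence mu_regular
    (fun b (Vb : V b) => Vb.1) m1 (fun x => ltac:(by rewrite lee_fin)).
- by rewrite int1.
- move=> b [/andP[b0 _] hb]; rewrite intb; apply: le_lt_trans hb.
  by rewrite lee_fin mulr_ge0 ?vol_ge0// ltW.
apply: (@le_trans _ _ (mu (\bigcup_n ball (b n).1 (5 * (b n).2)%R))).
  apply: le_outer_measure => x [c Vc cx]; have [n _ h] := covb _ Vc.
  by exists n => //; exact: h.
apply: (le_trans (outer_measure_sigma_subadditive mu _)).
have C0 : (0 <= cd ^+ 3 / th)%R by rewrite divr_ge0 ?exprn_ge0 ?ltW.
rewrite -int1; apply: (@le_trans _ _ (\sum_(n <oo) (cd ^+ 3 / th)%:E *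
    \int[nu]_(x in pball (b n)) (\1_A x : R)%:E)); last first.
  rewrite nneseriesZl//; first by rewrite lee_wpmul2l.
  by move=> n _; apply: integral_ge0 => x _; rewrite lee_fin.
apply: lee_nneseries => // n _.
have [[/andP[b0 _] hb]|bn] := bV n; last first.
  rewrite bn/= mulr0 ball_le0// outer_measure0 mule_ge0//.
  by apply: integral_ge0 => x _; rewrite lee_fin.
rewrite intb mu_ballE ?mulr_gt0//.
apply: (@le_trans _ _ ((cd ^+ 3 / th)%:E * (th * vol mu (b n).1 (b n).2)%:E)).
  rewrite -EFinM lee_fin mulrA divfK ?gt_eqF//.
  apply: (vol_doubling_iter mu_balls cd_ge1 vol_dbl) => //; first by rewrite mulr_gt0.
  by rewrite mdistxx add0r ler_wpM2r ?ltW// -natrX ltr_nat.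
by rewrite lee_wpmul2l// ltW.
Qed.

(** Unlike averages, the levels exceeded on a proportion [th] of some ball have
    an integrable majorant: each dyadic superlevel set of [F] obeys the weak type
    estimate separately, and these estimates sum to the integral of [F]. The
    levels below [e] are left out to have a lowest dyadic level. *)
Lemma maximal_function (F : T -> R) (e th : R) : (0 < e)%R -> (0 < th)%R ->
  mu_measurable mu F -> (forall x, 0 <= F x)%R -> \int[nu]_x (F x)%:E < +oo ->
  exists M : T -> \bar R, [/\ mu_measurable mu M, forall x, 0 <= M x,
    \int[nu]_x M x <= (4 * cd ^+ 3 / th)%:E * \int[nu]_x (F x)%:E &
    forall z r x t, (0 < r <= 1)%R -> ball z r x -> (e <= t)%R -> M x < t%:E ->
      mu (ball z r `&` [set y | (t < F y)%R]) <= (th * vol mu z r)%:E].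
Proof.
move=> e0 th0 mF F0 Foo.
pose A (k : nat) := [set x : T | (e * 2 ^+ k < F x)%R].
have c0 k : (0 < e * 2 ^+ k)%R by rewrite mulr_gt0// exprn_gt0.
have mA k : measurable (A k : set X).
  have -> : A k = setT `&` F @^-1` `](e * 2 ^+ k)%R, +oo[%classic.
    by rewrite setTI; apply/seteqP; split => x; rewrite /= in_itv/= andbT.
  exact: mF.
have mF' : measurable_fun [set: X] (fun x : X => (F x)%:E) by exact/measurable_EFinP.
have m1 (B : set T) : measurable (B : set X) ->
    measurable_fun [set: X] (fun x : X => (\1_B x : R)%:E).
  by move=> mB; apply/measurable_EFinP; exact: measurable_indic.
have Aoo k : mu (A k) < +oo.
  rewrite ltey; apply/eqP => Ak.
  have : (e * 2 ^+ k)%:E * mu (A k) <= \int[nu]_x (F x)%:E.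
    rewrite -[mu (A k)](_ : \int[nu]_x (\1_(A k) x : R)%:E = _); last first.
      by rewrite integral_indic// setIT.
    rewrite -ge0_integralZl//; [|exact: m1|by rewrite lee_fin ltW].
    apply: ge0_le_integral => //.
    - by move=> x _; rewrite mule_ge0// lee_fin// ltW.
    - by apply: emeasurable_funM => //; exact: m1.
    move=> x _; rewrite -EFinM lee_fin indicE; case: (boolP (x \in A k)) => h.
      by rewrite mulr1 ltW//; move: h; rewrite inE.
    by rewrite mulr0.
  by rewrite Ak mulry gtr0_sg// mul1e leye_eq => /eqP hF; rewrite hF ltxx in Foo.
pose V k := [set b : T * R | (0 < b.2 <= 1)%R /\
  (th * vol mu b.1 b.2)%:E < mu (pball b `&` A k)].
pose U k : set T := \bigcup_(b in V k) pball b.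
have mU k : measurable (U k : set X).
  apply: open_mu_measurable => //; apply: bigcup_open => b _.
  exact: ball_open_mdist.
pose M x := \sum_(k <oo) ((e * 2 ^+ k.+1)%:E * (\1_(U k) x : R)%:E).
have M0 x : 0 <= M x.
  by apply: nneseries_ge0 => k _ _; rewrite -EFinM lee_fin mulr_ge0// ltW.
exists M; split => //.
- apply: ge0_emeasurable_sum => [k x _ _|k _].
    by rewrite -EFinM lee_fin mulr_ge0// ltW.
  by apply: emeasurable_funM => //; exact: m1.
- have -> : \int[nu]_x M x = \sum_(k <oo) (e * 2 ^+ k.+1)%:E * mu (U k).
    rewrite integral_nneseries//; first last.
    + by move=> k x _; rewrite -EFinM lee_fin mulr_ge0// ltW.
    + by move=> k; apply: emeasurable_funM => //; exact: m1.
    apply: eq_eseriesr => k _; rewrite ge0_integralZl//.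
    + by rewrite integral_indic// setIT.
    + exact: m1.
    + by rewrite lee_fin ltW.
  have C0 : (0 <= cd ^+ 3 / th)%R.
    by rewrite divr_ge0 ?exprn_ge0 ?ltW// (lt_le_trans _ cd_ge1).
  apply: (@le_trans _ _ (\sum_(k <oo) (cd ^+ 3 / th)%:E *
      ((e * 2 ^+ k.+1)%:E * mu (A k)))).
    apply: lee_nneseries => [k _ _|k _].
      by rewrite mule_ge0// lee_fin ltW.
    rewrite muleCA lee_wpmul2l ?lee_fin ?(ltW (c0 _))//.
    exact: mu_dense_balls.
  rewrite nneseriesZl//; last by move=> k _; rewrite mule_ge0// lee_fin ltW.
  rewrite (_ : 4 * cd ^+ 3 / th = cd ^+ 3 / th * 4)%R; last by rewrite -mulrA mulrC.
  rewrite [in leRHS]EFinM -muleA lee_wpmul2l//.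
  have <- : \int[nu]_x (\sum_(k <oo) ((e * 2 ^+ k.+1)%:E * (\1_(A k) x : R)%:E)) =
      \sum_(k <oo) (e * 2 ^+ k.+1)%:E * mu (A k).
    rewrite integral_nneseries//; first last.
    + by move=> k x _; rewrite -EFinM lee_fin mulr_ge0// ltW.
    + by move=> k; apply: emeasurable_funM => //; exact: m1.
    apply: eq_eseriesr => k _; rewrite ge0_integralZl//.
    + by rewrite integral_indic// setIT.
    + exact: m1.
    + by rewrite lee_fin ltW.
  rewrite -ge0_integralZl//; last by move=> x _; rewrite lee_fin.
  apply: ge0_le_integral => //.
  + move=> x _; apply: nneseries_ge0 => k _ _.
    by rewrite -EFinM lee_fin mulr_ge0// ltW.
  + apply: ge0_emeasurable_sum => [k x _ _|k _].
      by rewrite -EFinM lee_fin mulr_ge0// ltW.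
    by apply: emeasurable_funM => //; exact: m1.
  + exact: emeasurable_funM.
  (* The geometric sum is at most twice its last nonzero term, which is below
     [2 F]. *)
  move=> x _; apply: lime_le.
    by apply: is_cvg_nneseries => k _ _; rewrite -EFinM lee_fin mulr_ge0// ltW.
  apply: nearW => n; rewrite -EFinM.
  elim: n => [|n ih]; first by rewrite big_geq// lee_fin mulr_ge0.
  have [Fn|Fn] := leP (F x) (e * 2 ^+ n)%R.
    rewrite big_nat_recr//= indicE memNset ?mule0 ?adde0//.
    by rewrite /A/=; apply/negP; rewrite -leNgt.
  apply: (@le_trans _ _ (\sum_(0 <= k < n.+1) (e * 2 ^+ k.+1)%:E)).
    apply: lee_sum => k _; rewrite -EFinM lee_fin ler_piMr ?(ltW (c0 _))//.
  rewrite sumEFin lee_fin.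
  apply: (@le_trans _ _ (4 * (e * 2 ^+ n))%R); last by rewrite ler_wpM2l// ltW.
  elim: n {ih Fn} => [|n ih].
    by rewrite big_nat1 expr0 expr1; lra.
  by rewrite big_nat_recr//=; move: ih; rewrite !exprS; lra.
- move=> z r x t r01 zx et Mt; rewrite leNgt; apply/negP => dense.
  have te : (1 <= t / e)%R by rewrite ler_pdivlMr// mul1r.
  have [k /andP[k1 k2]] := dyadic_bracket te.
  rewrite ler_pdivlMr// mulrC in k1; rewrite ltr_pdivrMr// mulrC in k2.
  have Ux : U k x.
    exists (z, r) => //; split => //; apply: lt_le_trans dense _.
    apply: le_outer_measure => y [zy ty]; split => //.
    by rewrite /A/=; exact: le_lt_trans ty.
  have : (e * 2 ^+ k.+1)%:E <= M x.
    apply: le_trans (nneseries_lim_ge k.+1 _); last first.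
      by move=> j _; rewrite -EFinM lee_fin mulr_ge0// ltW.
    rewrite big_nat_recr//= [X in _ + X](_ : _ = (e * 2 ^+ k.+1)%:E).
      rewrite leeDr// sume_ge0// => j _.
      by rewrite -EFinM lee_fin mulr_ge0// ltW.
    by rewrite indicE mem_set// mule1.
  move=> /le_lt_trans/(_ Mt); rewrite lte_fin => /lt_trans/(_ k2).
  by rewrite ltxx.
Qed.

End maximal.

(** * Extending a test function from its superlevel set of positive density *)

Section median_extension.
Context {R : realType} {T : pmetricType R} (mu : {outer_measure set T -> \bar R}).
Local Notation X := (caratheodory_type mu).
Hypothesis mu_regular : borel_regular mu.
Hypothesis mu_balls : balls_positive_finite mu.
Variable cd : R.
Hypothesis cd_ge1 : (1 <= cd)%R.
Hypothesis vol_dbl :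
  forall (x : T) (r : R), (0 < r)%R -> (vol mu x (2 * r) <= cd * vol mu x r)%R.
Variables (s : R) (v h : T -> R) (N : set T) (r0 : R).
Hypothesis s_gt0 : (0 < s)%R.
Hypothesis s_le1 : (s <= 1)%R.
Hypothesis v01 : forall x, (0 <= v x <= 1)%R.
Hypothesis h_ge0 : forall x, (0 <= h x)%R.
Hypothesis N0 : mu N = 0.
Hypothesis vh : forall x y, ~ N x -> ~ N y ->
  (`|v x - v y| <= mdist x y `^ s * (h x + h y))%R.
Hypothesis r0_gt0 : (0 < r0)%R.

(** The proportion is so small that the set [f > t] fills less than half of each
    ball of radius [r] in [B(z,4r)]. *)
Definition rare (z : T) (r : R) (f : T -> R) (t : R) :=
  mu (ball z (4 * r)%R `&` [set y | (t < f y)%R]) <=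
    ((4 * cd ^+ 3)^-1 * vol mu z (4 * r))%:E.

Definition half (z : T) (r a : R) :=
  (vol mu z r / 2)%:E <= mu (ball z r `&` [set y | (a <= v y)%R]).

Hypothesis rare_ex : forall z r, (0 < r)%R ->
  exists2 t : R, (0 <= t)%R & rare z r h t.

Let cd0 : (0 < cd)%R. Proof. exact: lt_le_trans cd_ge1. Qed.

Lemma rare_sub_ball z r f t y : (0 < r)%R -> rare z r f t ->
  (mdist z y <= 3 * r)%R ->
  mu (ball y r `&` [set x | (t < f x)%R]) < (vol mu y r / 2)%:E.
Proof.
move=> r0' hz zy.
apply: (@le_lt_trans _ _ ((4 * cd ^+ 3)^-1 * (cd ^+ 3 * vol mu y r))%:E).
  apply: (@le_trans _ _ (mu (ball z (4 * r)%R `&` [set x | (t < f x)%R]))).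
    apply: le_outer_measure; apply: setSI; apply: subset_ball; lra.
  apply: (le_trans hz); rewrite lee_fin ler_wpM2l ?invr_ge0 ?mulr_ge0 ?exprn_ge0 ?(ltW cd0)//.
  apply: (vol_doubling_iter mu_balls cd_ge1 vol_dbl) => //; first by rewrite mulr_gt0.
  rewrite metric_sym (_ : 2 ^+ 3 = 8%:R)%R; last by rewrite -natrX.
  by lra.
rewrite lte_fin (_ : (4 * cd ^+ 3)^-1 * (cd ^+ 3 * vol mu y r) = vol mu y r / 4)%R.
  by have := vol_gt0 mu_balls y r0'; lra.
by field; rewrite gt_eqF.
Qed.

(** The ball [B(z,r)] contains a point with [v >= a] and [h <= t]; the gradient
    inequality compares it with the points of [B(y,q)] where [h <= t], which are
    more than half of that ball. *)
Lemma half_transfer z r y q a t : (0 < r <= q)%R -> (mdist z y <= 3 * q)%R ->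
  (0 <= t)%R -> half z r a ->
  mu (ball z r `&` [set x | (t < h x)%R]) < (vol mu z r / 2)%:E ->
  mu (ball y q `&` [set x | (t < h x)%R]) < (vol mu y q / 2)%:E ->
  half y q (a - 10 * q `^ s * t)%R.
Proof.
move=> /andP[r_gt0 rq] zy t0 za zt yt; have q0 : (0 < q)%R by exact: lt_le_trans rq.
have [x' [zx' ax' hx' Nx']] : exists x', [/\ ball z r x', (a <= v x')%R,
    (h x' <= t)%R & ~ N x'].
  apply: contrapT => H; move: za; apply/negP; rewrite -ltNge.
  apply: le_lt_trans zt; rewrite -[leRHS]adde0 -N0.
  apply: le_trans (outer_measureU2 _ _ _); apply: le_outer_measure.
  move=> x [zx ax]; have [Nx|Nx] := pselect (N x); first by right.
  left; split => //=; rewrite ltNge; apply/negP => hx.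
  by apply: H; exists x.
rewrite /half -(@leeD2rE _ (vol mu y q / 2)%:E)// -EFinD -splitr -mu_ballE//.
apply: (@le_trans _ _ (mu (ball y q `&` [set x | (a - 10 * q `^ s * t <= v x)%R]) +
  (mu (ball y q `&` [set x | (t < h x)%R]) + mu N))); last first.
  by rewrite leeD2l// N0 adde0 ltW.
pose A1 := ball y q `&` [set x | (a - 10 * q `^ s * t <= v x)%R].
pose A2 := ball y q `&` [set x | (t < h x)%R].
apply: (@le_trans _ _ (mu (A1 `|` (A2 `|` N)))); last first.
  apply: (le_trans (outer_measureU2 _ _ _)); rewrite leeD2l//.
  exact: outer_measureU2.
apply: le_outer_measure => x yx.
have [Nx|Nx] := pselect (N x); first by right; right.
have [tx|xt] := ltP t (h x); first by right; left.
left; split => //=.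
have d5 : (mdist x' x <= 5 * q)%R.
  move: zx' yx; rewrite !in_ballE => zx' yx.
  have := metric_triangle x' z x; have := metric_triangle z y x.
  rewrite (metric_sym x' z) => h1 h2; lra.
have h5 : (mdist x' x `^ s <= 5 * q `^ s)%R.
  apply: (@le_trans _ _ ((5 * q) `^ s)%R).
    by rewrite ge0_ler_powR ?nnegrE ?(ltW s_gt0) ?mdist_ge0// mulr_ge0// ltW.
  rewrite powRM ?(ltW q0)// ler_wpM2r ?powR_ge0//.
  by rewrite ler1_powR// ler1n.
have := vh Nx' Nx; rewrite ler_norml => /andP[_ hv].
have : (mdist x' x `^ s * (h x' + h x) <= 5 * q `^ s * (2 * t))%R.
  by apply: ler_pM => //; [exact: powR_ge0|exact: addr_ge0|lra].
lra.
Qed.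

Definition admissible (z : T) (r a t : R) :=
  [/\ (0 < r < r0)%R, (0 <= a <= 1)%R, (0 <= t)%R, half z r a & rare z r h t].

(** Each admissible ball contributes a cone of height [a]; its slope is such that
    at distance [r] from the centre it has lost what [half_transfer] loses in the
    comparison with a ball of the same radius there. *)
Definition cones (x : T) : set R := [set c | c = 0%R \/
  exists z r a t, [/\ admissible z r a t, (mdist x z < 2 * r)%R &
    c = (a - 10 * (r `^ s / r) * t * mdist x z)%R]].

Definition envelope (x : T) : R := sup (cones x).

Let slope_ge0 r t : (0 < r)%R -> (0 <= t)%R -> (0 <= 10 * (r `^ s / r) * t)%R.
Proof. by move=> r_gt0 t0; rewrite !mulr_ge0 ?powR_ge0 ?invr_ge0// ltW. Qed.

Lemma cones_le1 x c : cones x c -> (c <= 1)%R.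
Proof.
move=> [->|[z [r [a [t [[/andP[r_gt0 _] /andP[a0 a1] t0 _ _] _ ->]]]]]] //.
by rewrite lerBlDr (le_trans a1)// lerDl mulr_ge0 ?mdist_ge0 ?slope_ge0.
Qed.

Lemma cones_has_sup x : has_sup (cones x).
Proof. by split; [exists 0%R; left|exists 1%R => c /cones_le1]. Qed.

Lemma cones_le_envelope x c : cones x c -> (c <= envelope x)%R.
Proof. by move=> xc; apply: ub_le_sup => //; case: (cones_has_sup x). Qed.

Lemma envelope01 x : (0 <= envelope x <= 1)%R.
Proof.
apply/andP; split; first by apply: cones_le_envelope; left.
by apply: ge_sup; [case: (cones_has_sup x)|exact: cones_le1].
Qed.

Lemma half_envelope y q a : (0 < q < r0)%R -> (a <= 1)%R -> half y q a ->
  (a <= envelope y)%R.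
Proof.
move=> q0 a1 ya; have [a0|a0] := leP a 0%R.
  by rewrite (le_trans a0)//; have /andP[] := envelope01 y.
have /andP[q_gt0 _] := q0; have [t t0 ht] := rare_ex y q_gt0.
apply: cones_le_envelope; right; exists y, q, a, t; split.
- by split => //; rewrite (ltW a0).
- by rewrite mdistxx mulr_gt0.
- by rewrite mdistxx mulr0 subr0.
Qed.

(** Cones are continuous on the open balls that carry them, so that their
    supremum is lower semicontinuous: this provides the neighbourhood on which a
    test function is 1. *)
Lemma open_envelope (a : R) : open [set x | (a < envelope x)%R].
Proof.
rewrite openE => x /= ax; rewrite /interior.
have [_ [->|[z [r [b [t [hadm xz ->]]]]]] xc] := sup_gt (cones_has_sup x).1 ax.
  apply/nbhs_ballP; exists 1%R => //= y _ /=; apply: (lt_le_trans xc).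
  by have /andP[] := envelope01 y.
have [/andP[r_gt0 _] _ t0 _ _] := hadm.
set k := (10 * (r `^ s / r) * t)%R in xc.
have k0 : (0 <= k)%R by exact: slope_ge0.
pose del := Num.min (2 * r - mdist x z)%R
  ((b - k * mdist x z - a) / (k + 1))%R.
have del0 : (0 < del)%R by rewrite lt_min subr_gt0 xz divr_gt0 ?subr_gt0// ltr_wpDl.
apply/nbhs_ballP; exists del => //= y; rewrite in_ballE /del lt_min => /andP[y1 y2] /=.
have yz := metric_triangle y x z; rewrite (metric_sym y x) in yz.
apply: (@lt_le_trans _ _ (b - k * mdist y z)%R); last first.
  by apply: cones_le_envelope; right; exists z, r, b, t; split => //; lra.
have kyz : (k * mdist y z <= k * mdist x y + k * mdist x z)%R.
  by rewrite -mulrDr ler_wpM2l.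
have k1 : (0 < k + 1)%R by rewrite ltr_wpDl.
move: y2; rewrite ltr_pdivlMr// mulrDr mulr1 [(_ * k)%R]mulrC => y2.
have := mdist_ge0 x y; lra.
Qed.

Lemma measurable_envelope : mu_measurable mu envelope.
Proof.
apply: (measurability _ (RGenOInfty.measurableE R)) => //.
move=> /= _ [_ [a ->] <-]; rewrite setTI.
have -> : envelope @^-1` `]a, +oo[ = [set x | (a < envelope x)%R].
  by apply/seteqP; split => y; rewrite /= in_itv/= andbT.
exact/(open_mu_measurable mu_regular)/open_envelope.
Qed.

Section at_point.
Variables (x : T) (G : R).
Hypothesis G_ge0 : (0 <= G)%R.
Hypothesis rare_h : forall z r, (0 < r < r0)%R -> ball z (4 * r)%R x -> rare z r h G.
Hypothesis rare_v : forall z r, (0 < r < r0)%R -> ball z (4 * r)%R x -> rare z r v G.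

Let near_ball z (r : R) : (0 < r)%R -> (mdist x z < 2 * r)%R -> ball z (4 * r)%R x.
Proof. by move=> r_gt0; rewrite in_ballE metric_sym; lra. Qed.

Lemma envelope_le : (envelope x <= G)%R.
Proof.
apply: ge_sup; first by case: (cones_has_sup x).
move=> c [->//|[z [r [a [t [[rr0 a01 t0 za _] xz ->]]]]]].
have /andP[r_gt0 _] := rr0.
apply: (@le_trans _ _ a).
  by rewrite gerDl oppr_le0 mulr_ge0 ?mdist_ge0 ?slope_ge0.
rewrite leNgt; apply/negP => Ga; move: za; apply/negP; rewrite -ltNge.
have zv := rare_v rr0 (near_ball r_gt0 xz).
have zz : (mdist z z <= 3 * r)%R by rewrite mdistxx mulr_ge0// ltW.
apply: le_lt_trans (rare_sub_ball r_gt0 zv zz).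
apply: le_outer_measure; apply: setIS => y /=; exact: lt_le_trans.
Qed.

(** Up to the radius of a cone, its slope obeys the Hölder bound, and if [y] has
    left the cone then a ball of the same radius at [y] takes over. Beyond that
    radius a ball at [y] of radius [mdist x y] takes over; and beyond [r0] the
    height of the cone is itself below the bound. *)
Lemma envelope_holder y : (envelope x <=
  envelope y + mdist x y `^ s * ((10 + (r0 `^ s)^-1) * G))%R.
Proof.
have d0 := mdist_ge0 x y; have Ey0 : (0 <= envelope y)%R by have /andP[] := envelope01 y.
have i0 : (0 <= (r0 `^ s)^-1)%R by rewrite invr_ge0 powR_ge0.
have ds0 : (0 <= mdist x y `^ s)%R by exact: powR_ge0.
have B0 : (0 <= mdist x y `^ s * ((10 + (r0 `^ s)^-1) * G))%R.
  by rewrite !mulr_ge0// addr_ge0.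
have bnd (c : R) : (c <= envelope y + mdist x y `^ s * (10 * G) ->
    c <= envelope y + mdist x y `^ s * ((10 + (r0 `^ s)^-1) * G))%R.
  move=> /le_trans; apply; rewrite lerD2l ler_wpM2l// ler_wpM2r// lerDl//.
apply: ge_sup; first by case: (cones_has_sup x).
move=> _ [->|[z [r [a [t0 [[rr0 a01 t00 za ht0] xz ->]]]]]].
  by rewrite addr_ge0.
have /andP[r_gt0 rlt] := rr0; have /andP[a0 a1] := a01.
pose t := Num.min t0 G.
have t_ge0 : (0 <= t)%R by rewrite le_min t00.
have ht : rare z r h t.
  rewrite /t /Num.min; case: ifP => // _.
  exact: rare_h rr0 (near_ball r_gt0 xz).
have tG : (t <= G)%R by rewrite ge_min lexx orbT.
have yz := metric_triangle y x z; rewrite (metric_sym y x) in yz.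
have xy_z := metric_triangle x y z.
have q_ge0 : (0 <= 10 * (r `^ s / r))%R.
  by rewrite mulr_ge0// mulr_ge0 ?powR_ge0 ?invr_ge0// ltW.
apply: (@le_trans _ _ (a - 10 * (r `^ s / r) * t * mdist x z)%R).
  rewrite lerD2l lerN2 ler_wpM2r ?mdist_ge0// ler_wpM2l//.
  by rewrite ge_min lexx.
have [dr|rd] := leP (mdist x y) r.
  have [yz2|yz2] := ltP (mdist y z) (2 * r)%R.
    apply: bnd; apply: (@le_trans _ _ (a - 10 * (r `^ s / r) * t * mdist y z +
        10 * (r `^ s / r) * t * mdist x y)%R).
      have : (10 * (r `^ s / r) * t * mdist y z <=
          10 * (r `^ s / r) * t * (mdist x y + mdist x z))%R.
        by rewrite ler_wpM2l// slope_ge0.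
      lra.
    apply: lerD.
      by apply: cones_le_envelope; right; exists z, r, a, t; split.
    have key : (r `^ s / r * mdist x y <= mdist x y `^ s)%R.
      have [->|dn0] := eqVneq (mdist x y) 0%R; first by rewrite mulr0 powR_ge0.
      have dp : (0 < mdist x y)%R by rewrite lt_neqAle eq_sym dn0.
      have : (mdist x y / r <= (mdist x y / r) `^ s)%R.
        apply: ger1_powR => //; rewrite divr_gt0//=.
        by rewrite ler_pdivrMr// mul1r.
      rewrite powR_divr// ler_pdivlMr ?powR_gt0//.
      by rewrite (_ : mdist x y / r * r `^ s = r `^ s / r * mdist x y)%R//; ring.
    rewrite (_ : 10 * (r `^ s / r) * t * mdist x y =
        (r `^ s / r * mdist x y) * (10 * t))%R; last by ring.
    apply: ler_pM => //; last by rewrite ler_wpM2l.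
    - by rewrite !mulr_ge0 ?powR_ge0 ?invr_ge0 ?(ltW r_gt0).
    - by rewrite mulr_ge0.
  apply: (@le_trans _ _ (envelope y)); last by rewrite lerDl.
  apply: (@le_trans _ _ (a - 10 * r `^ s * t)%R).
    rewrite lerD2l lerN2.
    apply: (@le_trans _ _ (10 * (r `^ s / r) * t * r)%R).
      rewrite le_eqVlt; apply/orP; left; apply/eqP; field.
      by rewrite gt_eqF.
    by rewrite ler_wpM2l ?slope_ge0//; lra.
  apply: half_envelope rr0 _ _; first by rewrite lerBlDr (le_trans a1)// lerDl !mulr_ge0 ?powR_ge0.
  apply: half_transfer za _ _ => //; first by rewrite r_gt0 lexx.
  - by rewrite metric_sym; lra.
  - apply: rare_sub_ball ht _ => //; first by rewrite mdistxx mulr_ge0// ltW.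
  - by apply: rare_sub_ball ht _ => //; rewrite metric_sym; lra.
apply: (@le_trans _ _ a).
  by rewrite gerDl oppr_le0 mulr_ge0 ?mdist_ge0 ?slope_ge0.
have [dr0|r0d] := ltP (mdist x y) r0.
  apply: bnd; rewrite -lerBlDr.
  have rr : (0 < mdist x y < r0)%R by rewrite dr0 (lt_trans r_gt0).
  have /andP[dp _] := rr.
  apply: (half_envelope rr).
    by rewrite lerBlDr (le_trans a1)// lerDl !mulr_ge0.
  rewrite (_ : mdist x y `^ s * (10 * G) = 10 * mdist x y `^ s * G)%R; last by ring.
  apply: half_transfer za _ _ => //; first by rewrite r_gt0 ltW.
  - by rewrite metric_sym; lra.
  - apply: (@rare_sub_ball z r h G) => //; first exact: rare_h rr0 (near_ball r_gt0 xz).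
    by rewrite mdistxx mulr_ge0// ltW.
  - apply: (@rare_sub_ball y (mdist x y) h G) => //; last by rewrite mdistxx mulr_ge0.
    by apply: (rare_h rr); rewrite in_ballE metric_sym; lra.
have aw : (a <= G)%R.
  rewrite leNgt; apply/negP => Ga; move: za; apply/negP; rewrite -ltNge.
  have zv := rare_v rr0 (near_ball r_gt0 xz).
  have zz : (mdist z z <= 3 * r)%R by rewrite mdistxx mulr_ge0// ltW.
  apply: le_lt_trans (rare_sub_ball r_gt0 zv zz).
  apply: le_outer_measure; apply: setIS => y' /=; exact: lt_le_trans.
apply: (le_trans aw); apply: ler_wpDl => //.
rewrite mulrA -[leLHS]mul1r ler_wpM2r//.
apply: (@le_trans _ _ (mdist x y `^ s * (r0 `^ s)^-1)%R).
  by rewrite ler_pdivlMr ?powR_gt0// mul1r ge0_ler_powR ?nnegrE ?(ltW s_gt0) ?(ltW r0_gt0).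
by rewrite ler_wpM2l// lerDr.
Qed.

End at_point.
End median_extension.

(** * Points of density of sets of small capacity *)

Section density.
Context {R : realType} {T : pmetricType R} (mu : {outer_measure set T -> \bar R}).
Local Notation X := (caratheodory_type mu).
Local Notation nu := (caratheodory_restriction mu).
Hypothesis mu_regular : borel_regular mu.
Hypothesis mu_balls : balls_positive_finite mu.
Variable cd : R.
Hypothesis cd_ge1 : (1 <= cd)%R.
Hypothesis vol_dbl :
  forall (x : T) (r : R), (0 < r)%R -> (vol mu x (2 * r) <= cd * vol mu x r)%R.
Variables (p : T -> R) (s pm pp Cp Q : R).
Hypothesis mp : mu_measurable mu p.
Hypothesis pm_gt0 : (0 < pm)%R.
Hypothesis p_ge : forall x, (pm <= p x)%R.
Hypothesis p_le : forall x, (p x <= pp)%R.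
Hypothesis Cp_gt0 : (0 < Cp)%R.
Hypothesis p_lh : forall x y : T,
  (`|p x - p y| <= Cp / ln (expR 1 + (mdist x y)^-1))%R.
Hypothesis s_gt0 : (0 < s)%R.
Hypothesis s_le1 : (s <= 1)%R.
Hypothesis Q_gt0 : (0 < Q)%R.

Let p_gt0 x : (0 < p x)%R. Proof. exact: lt_le_trans (p_ge x). Qed.
Let cd0 : (0 < cd)%R. Proof. exact: lt_le_trans cd_ge1. Qed.

Lemma chebyshev_pmod (f : T -> R) (A : set T) (t : R) : mu_measurable mu f ->
  measurable (A : set X) -> (1 <= t)%R ->
  (t `^ pm)%:E * mu (A `&` [set y | (t < f y)%R]) <= pmod mu p f.
Proof.
move=> mf mA t1; have t0 : (0 <= t)%R by exact: le_trans t1.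
apply: (@le_trans _ _ (\int[nu]_(x in A) (f x `^ p x)%:E)).
  by apply: chebyshev_modular => //; [exact: powR_ge0|move=> x; exact: ler_powR].
apply: ge0_subset_integral => //; first exact: measurable_pmod.
by move=> x _; rewrite lee_fin powR_ge0.
Qed.

Lemma rare_exists (f : T -> R) : mu_measurable mu f ->
  pmod mu p f < +oo -> forall z r, (0 < r)%R ->
  exists2 t : R, (0 <= t)%R & rare mu cd z r f t.
Proof.
move=> mf foo z r r0; set th := ((4 * cd ^+ 3)^-1 * vol mu z (4 * r))%R.
have th0 : (0 < th)%R.
  by rewrite mulr_gt0 ?invr_gt0 ?mulr_gt0 ?exprn_gt0 ?vol_gt0// mulr_gt0.
have Ifin : pmod mu p f \is a fin_num by rewrite ge0_fin_numE// pmod_ge0.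
set I := fine (pmod mu p f).
have I0 : (0 <= I)%R by rewrite fine_ge0// pmod_ge0.
pose t := Num.max 1%R ((I / th) `^ pm^-1)%R.
have t1 : (1 <= t)%R by rewrite le_max lexx.
have t0 : (0 < t)%R by exact: lt_le_trans t1.
exists t; first exact: ltW.
have := chebyshev_pmod mf (ball_mu_measurable mu_regular z (4 * r)%R) t1.
rewrite -(fineK Ifin) -/I => ch.
have tp : (0 < t `^ pm)%R by rewrite powR_gt0.
rewrite /rare -/th -(@lee_pmul2l _ (t `^ pm)%:E) ?lte_fin//.
apply: (le_trans ch); rewrite -EFinM lee_fin -ler_pdivrMr//.
rewrite -[leLHS](@powR_inv_exp _ (I / th)%R pm) ?divr_ge0 ?(ltW th0)//.
by rewrite ge0_ler_powR ?nnegrE ?powR_ge0 ?(ltW pm_gt0) ?(ltW t0)// le_max lexx orbT.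
Qed.

Section localized.
Variables (x0 : T) (R2 c1 : R).
Hypothesis c1_gt0 : (0 < c1)%R.
Hypothesis mass : forall z r, ball x0 R2 z -> (0 < r <= 1)%R ->
  (c1 * r `^ Q <= vol mu z r)%R.

Let ca : R := ((`|ln ((4 * cd ^+ 3)^-1 * c1)| + Q * ln 2) / pm)%R.
Let cb : R := (Q / pm + 2)%R.
Let K : R := expR (Cp * (ca + cb)).

Let ca_ge0 : (0 <= ca)%R.
Proof. by rewrite divr_ge0 ?(ltW pm_gt0)// addr_ge0// mulr_ge0 ?(ltW Q_gt0)// ln_ge0// ler1n. Qed.

Let cb_ge0 : (0 <= cb)%R.
Proof. by rewrite addr_ge0// divr_ge0// ltW. Qed.

(** If [f] exceeds [t] on a fixed proportion of a ball, then the mass bound keeps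
    [t] below a power of the radius, and log-Hölder continuity lets the exponent
    vary over the ball at the cost of a constant. Levels below 1 are covered
    because only radii much smaller than the lowest level are considered. *)
Lemma dense_freeze (f : T -> R) (k z r x y t : _) : mu_measurable mu f ->
  pmod mu p f <= 1 -> (0 < k < 1)%R ->
  (0 < r < k / 8)%R -> ball x0 R2 z -> (k ^+ 2 <= t)%R ->
  ball z (4 * r)%R x -> ball z (4 * r)%R y -> ~ rare mu cd z r f t ->
  (t `^ p x <= K * t `^ p y)%R.
Proof.
move=> mf f1 /andP[k0 k1] /andP[r0 rk] Bz kt zx zy nrare.
have r80 : (0 < 8 * r)%R by rewrite mulr_gt0.
have r8k : (8 * r < k)%R by rewrite mulrC -ltr_pdivlMr.
have t0 : (0 < t)%R by apply: lt_le_trans kt; rewrite exprn_gt0.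
have xy : (mdist x y <= 8 * r)%R.
  move: zx zy; rewrite !in_ballE => zx zy.
  have := metric_triangle x z y; rewrite (metric_sym x z); lra.
have lnr : (ln k^-1 <= ln (8 * r)^-1)%R.
  by rewrite ler_ln ?posrE ?invr_gt0// lef_pV2// ltW.
have lnk : (0 <= ln k^-1)%R by rewrite ln_ge0// invf_ge1// ltW.
have lnr0 : (0 <= ln (8 * r)^-1)%R by exact: le_trans lnr.
apply: (log_holder_powR Cp_gt0 p_lh r80 xy t0 ca_ge0 cb_ge0).
have [t1|t1] := leP 1%R t; last first.
  rewrite ler0_norm ?ln_le0 ?(ltW t1)//.
  have : (- ln t <= 2 * ln k^-1)%R.
    rewrite lnV// mulrN lerN2 -[leLHS]mulrC mulr_natr -lnXn//.
    by rewrite ler_ln ?posrE ?exprn_gt0.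
  move=> /le_trans; apply; apply: (@le_trans _ _ (cb * ln (8 * r)^-1)%R).
    apply: ler_pM => //; rewrite lerDr divr_ge0// ltW//.
  by rewrite lerDr.
rewrite ger0_norm ?ln_ge0//.
have th0 : (0 < (4 * cd ^+ 3)^-1)%R by rewrite invr_gt0 mulr_gt0// exprn_gt0.
set th := ((4 * cd ^+ 3)^-1)%R in th0 *.
have r40 : (0 < 4 * r <= 1)%R by rewrite mulr_gt0//=; lra.
have /andP[r4 _] := r40.
have bound : (t `^ pm * (th * c1 * (4 * r) `^ Q) <= 1)%R.
  rewrite -lee_fin; apply: le_trans f1.
  apply: le_trans (chebyshev_pmod mf (ball_mu_measurable mu_regular z (4 * r)%R) t1).
  rewrite EFinM lee_wpmul2l ?lee_fin ?powR_ge0//.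
  move/negP: nrare; rewrite /rare -ltNge -/th => /ltW; apply: le_trans.
  by rewrite lee_fin -mulrA ler_wpM2l ?(ltW th0)// mass.
have P0 : (0 < th * c1 * (4 * r) `^ Q)%R by rewrite !mulr_gt0// powR_gt0.
have : (ln (t `^ pm * (th * c1 * (4 * r) `^ Q)) <= 0)%R by rewrite ln_le0.
rewrite lnM ?posrE ?powR_gt0// lnM ?posrE ?mulr_gt0 ?powR_gt0// !ln_powR.
have -> : (ln (4 * r) = ln (8 * r) - ln 2)%R.
  rewrite -(@lnV _ 2%R) ?posrE// -lnM ?posrE ?invr_gt0//.
  by congr ln; field.
move=> hln; have habs := ler_norm (- ln (th * c1)); rewrite normrN in habs.
have : (pm * ln t <= `|ln (th * c1)| + Q * ln 2 + Q * ln (8 * r)^-1)%R.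
  rewrite [in leRHS]lnV ?posrE//; lra.
rewrite -ler_pdivlMl// => /le_trans; apply.
set L := ln (8 * r)^-1%R in lnr0 *.
have -> : (pm^-1 * (`|ln (th * c1)| + Q * ln 2 + Q * L) = ca + Q / pm * L)%R.
  by rewrite /ca -/th mulrDr mulrC; congr (_ + _)%R; ring.
by rewrite lerD2l ler_wpM2r// lerDl.
Qed.

Let Cm : R := (2 * K * (4 * cd ^+ 3 / (4 * cd ^+ 3)^-1))%R.

Let Cm_gt0 : (0 < Cm)%R.
Proof.
by rewrite !mulr_gt0 ?expR_gt0 ?invr_gt0 ?invr_gt0 ?mulr_gt0 ?exprn_gt0.
Qed.

(** The maximal function of [f ^ p], transported back through the power [1 / p]
    at each point. *)
Lemma variable_maximal : exists2 C : R, (0 < C)%R &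
  forall (f : T -> R) (k : R), mu_measurable mu f -> (forall x, 0 <= f x)%R ->
    pmod mu p f <= 1 -> (0 < k < 1)%R ->
  exists (G : T -> R) (m : T -> \bar R),
    [/\ mu_measurable mu G, forall x, (0 <= G x)%R, mu_measurable mu m,
        forall x, 0 <= m x & \int[nu]_x m x <= C%:E * pmod mu p f] /\
    (forall x, (G x `^ p x)%:E <= ((k ^+ 2) `^ p x)%:E + m x) /\
    (exists2 N : set T, mu N = 0 & forall x z r, ~ N x -> ball x0 (R2 - 1)%R x ->
       (0 < r < k / 8)%R -> ball z (4 * r)%R x -> rare mu cd z r f (G x)).
Proof.
exists Cm; first exact: Cm_gt0.
move=> f k mf f0 f1 k01; have /andP[k0 k1] := k01.
have K0 : (0 < K)%R by exact: expR_gt0.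
have k20 : (0 < k ^+ 2)%R by rewrite exprn_gt0.
have k21 : (k ^+ 2 <= 1)%R by rewrite exprn_ile1// ltW.
have th0 : (0 < (4 * cd ^+ 3)^-1)%R by rewrite invr_gt0 mulr_gt0// exprn_gt0.
pose e := ((k ^+ 2) `^ pp / K)%R.
have e0 : (0 < e)%R by rewrite divr_gt0// powR_gt0.
have mF : mu_measurable mu (fun x => f x `^ p x)%R by exact: measurable_powR_fun.
have [M [mM M0 IM HM]] := maximal_function mu_regular mu_balls cd_ge1 vol_dbl e0
  th0 mF (fun x => powR_ge0 (f x) (p x)) (le_lt_trans f1 (ltry _)).
have fM0 x : (0 <= fine (M x))%R by rewrite fine_ge0.
pose g x := ((2 * K * fine (M x)) `^ (p x)^-1)%R.
pose G x := Num.max (k ^+ 2)%R (g x).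
have g_pow x : (g x `^ p x = 2 * K * fine (M x))%R.
  by rewrite powR_inv_exp// !mulr_ge0// ltW.
exists G, (fun x => (2 * K)%:E * M x); split; first split.
- apply: measurable_maxr; first exact: measurable_cst.
  apply: measurable_powR_fun; last exact: measurable_inv_exponent.
  apply: measurable_funM; first exact: measurable_cst.
  exact: (measurableT_comp (@fine_measurable R setT measurableT) mM).
- by move=> x; rewrite le_max (ltW k20).
- exact: emeasurable_funM.
- by move=> x; rewrite mule_ge0// lee_fin mulr_ge0// ltW.
- rewrite ge0_integralZl//; last by rewrite lee_fin mulr_ge0// ltW.
  rewrite /Cm [in leRHS]EFinM -muleA lee_wpmul2l// lee_fin mulr_ge0//.
  exact: ltW.
split.
  move=> x; rewrite /G /Num.max; case: ifP => _; last first.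
    by rewrite leeDl// mule_ge0// lee_fin mulr_ge0// ltW.
  apply: (@le_trans _ _ ((2 * K)%:E * M x)); last by rewrite leeDr// lee_fin powR_ge0.
  rewrite g_pow EFinM lee_wpmul2l ?lee_fin ?mulr_ge0 ?(ltW K0)//.
  by case: (M x) (M0 x) => //= _; rewrite leey.
have IMoo : nu.-integrable [set: X] M.
  apply/integrableP; split; first exact: mM.
  under eq_integral do rewrite gee0_abs//.
  apply: (le_lt_trans IM); rewrite -/(pmod mu p f).
  apply: (@le_lt_trans _ _ ((4 * cd ^+ 3 / (4 * cd ^+ 3)^-1)%:E * 1)).
    by rewrite lee_wpmul2l// lee_fin !mulr_ge0 ?invr_ge0 ?invr_ge0 ?mulr_ge0 ?exprn_ge0 ?(ltW cd0).
  by rewrite mule1 ltry.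
have [N [mN N0 hN]] := integrable_ae measurableT IMoo.
exists N => // x z r Nx Bx rk zx.
have fx : M x \is a fin_num.
  by apply: contrapT => /negP fx; apply: Nx; apply: hN => /= /(_ Logic.I); exact/negP.
apply: contrapT => nrare; apply: (nrare).
have /andP[r0 rk8] := rk.
have Bz : ball x0 R2 z.
  move: Bx zx; rewrite !in_ballE => Bx zx.
  have := metric_triangle x0 x z; rewrite (metric_sym x z); lra.
have Gk : (k ^+ 2 <= G x)%R by rewrite le_max lexx.
have G0 : (0 < G x)%R by exact: lt_le_trans Gk.
have Gp0 : (0 < G x `^ p x)%R by rewrite powR_gt0.
have r41 : (0 < 4 * r <= 1)%R by rewrite mulr_gt0//=; lra.
apply: le_trans (HM z (4 * r)%R x (G x `^ p x / K)%R r41 zx _ _).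
- apply: le_outer_measure => y [zy /= Gy]; split => //=.
  rewrite ltr_pdivrMr// mulrC.
  apply: le_lt_trans (dense_freeze mf f1 k01 rk Bz Gk zx zy nrare) _.
  by rewrite ltr_pM2l// gt0_ltr_powR ?nnegrE// ltW.
- rewrite ler_pM2r ?invr_gt0//; apply: (@le_trans _ _ ((k ^+ 2) `^ p x)%R).
    by apply: ger_powR => //; rewrite k20.
  by rewrite ge0_ler_powR ?nnegrE ?(ltW (p_gt0 x)) ?(ltW k20) ?(ltW G0).
- rewrite -(fineK fx) lte_fin ltr_pdivlMr// mulrC.
  have gG : (g x `^ p x <= G x `^ p x)%R.
    rewrite ge0_ler_powR ?nnegrE ?powR_ge0 ?(ltW (p_gt0 x)) ?(ltW G0)//.
    by rewrite le_max lexx orbT.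
  have := fM0 x; move: gG; rewrite g_pow -mulrA; set a := (K * _)%R => gG h0.
  have a0 : (0 <= a)%R by rewrite mulr_ge0// ltW.
  lra.
Qed.

End localized.
End density.

Section dense_capacity.
Context {R : realType} {T : pmetricType R} (mu : {outer_measure set T -> \bar R}).
Local Notation X := (caratheodory_type mu).
Local Notation nu := (caratheodory_restriction mu).
Hypothesis mu_regular : borel_regular mu.
Hypothesis mu_balls : balls_positive_finite mu.
Variable cd : R.
Hypothesis cd_ge1 : (1 <= cd)%R.
Hypothesis vol_dbl :
  forall (x : T) (r : R), (0 < r)%R -> (vol mu x (2 * r) <= cd * vol mu x r)%R.
Variables (p : T -> R) (s pm pp Cp Q : R).
Hypothesis mp : mu_measurable mu p.
Hypothesis pm_gt0 : (0 < pm)%R.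
Hypothesis p_ge : forall x, (pm <= p x)%R.
Hypothesis p_le : forall x, (p x <= pp)%R.
Hypothesis Cp_gt0 : (0 < Cp)%R.
Hypothesis p_lh : forall x y : T,
  (`|p x - p y| <= Cp / ln (expR 1 + (mdist x y)^-1))%R.
Hypothesis s_gt0 : (0 < s)%R.
Hypothesis s_le1 : (s <= 1)%R.
Hypothesis Q_gt0 : (0 < Q)%R.

Let p_gt0 x : (0 < p x)%R. Proof. exact: lt_le_trans (p_ge x). Qed.

Definition cutoff (x0 : T) (q : R) (x : T) : R := clip (q + 1 - mdist x0 x)%R.

Lemma cutoff01 x0 q x : (0 <= cutoff x0 q x <= 1)%R.
Proof. exact: clip01. Qed.

Lemma cutoff_in x0 q x : ball x0 q x -> cutoff x0 q x = 1%R.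
Proof. by rewrite in_ballE => h; apply: clip_ge1; lra. Qed.

Lemma cutoff_out x0 q x : ~ ball x0 (q + 1)%R x -> cutoff x0 q x = 0%R.
Proof.
rewrite in_ballE => /negP; rewrite -leNgt => h.
by rewrite /cutoff /clip max_l ?min_r// subr_le0.
Qed.

Lemma measurable_cutoff x0 q : mu_measurable mu (cutoff x0 q).
Proof.
apply: measurable_minr; first exact: measurable_cst.
apply: measurable_maxr; first exact: measurable_cst.
apply: measurable_funB; first exact: measurable_cst.
exact: mu_measurable_mdist.
Qed.

Lemma cutoff_holder x0 q x y :
  (`|cutoff x0 q x - cutoff x0 q y| <= mdist x y `^ s)%R.
Proof.
have d0 := mdist_ge0 x y; have [d1|d1] := leP 1%R (mdist x y).
  have h1 : (1 <= mdist x y `^ s)%R.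
    by rewrite powR_ge1 ?(ltW s_gt0).
  apply: le_trans h1; rewrite ler_norml.
  by have := cutoff01 x0 q x; have := cutoff01 x0 q y; lra.
apply: (@le_trans _ _ (mdist x y)).
  apply: (le_trans (clip_lipschitz _ _)).
  have h1 := metric_triangle x0 x y; have h2 := metric_triangle x0 y x.
  by rewrite (metric_sym y x) in h2; rewrite ler_norml; lra.
have [->|dn0] := eqVneq (mdist x y) 0%R; first by rewrite powR_ge0.
by apply: ger1_powR => //; rewrite lt_neqAle eq_sym dn0 d0/= ltW.
Qed.

(** Localization: the gradient of a product with a cutoff lives on the support
    of the cutoff. *)
Lemma cutoff_hgradient x0 q (w G : T -> R) (N : set T) :
  (forall x, 0 <= w x)%R -> (forall x, 0 <= G x)%R ->
  (forall x y, ball x0 (q + 1)%R x -> ball x0 (q + 1)%R y -> ~ N x -> ~ N y ->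
    w x - w y <= mdist x y `^ s * (G x + G y))%R ->
  forall x y, ~ N x -> ~ N y ->
    (`|cutoff x0 q x * w x - cutoff x0 q y * w y| <= mdist x y `^ s *
      ((G x + w x) * \1_(ball x0 (q + 1)%R) x +
       (G y + w y) * \1_(ball x0 (q + 1)%R) y))%R.
Proof.
move=> w0 G0 wG.
have key x y : ~ N x -> ~ N y ->
    (cutoff x0 q x * w x - cutoff x0 q y * w y <= mdist x y `^ s *
      ((G x + w x) * \1_(ball x0 (q + 1)%R) x +
       (G y + w y) * \1_(ball x0 (q + 1)%R) y))%R.
  move=> Nx Ny.
  have d0 : (0 <= mdist x y `^ s)%R by exact: powR_ge0.
  have /andP[cx0 cx1] := cutoff01 x0 q x; have /andP[cy0 cy1] := cutoff01 x0 q y.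
  have i0 z : (0 <= (\1_(ball x0 (q + 1)%R) z : R))%R by rewrite indicE ler0n.
  have [Bx|Bx] := pselect (ball x0 (q + 1)%R x); last first.
    rewrite (cutoff_out Bx) mul0r sub0r; apply: (@le_trans _ _ 0%R).
      by rewrite oppr_le0 mulr_ge0.
    by rewrite !(mulr_ge0, addr_ge0).
  have hc := cutoff_holder x0 q x y.
  have {}hc : (cutoff x0 q x - cutoff x0 q y <= mdist x y `^ s)%R.
    exact: le_trans (ler_norm _) hc.
  rewrite [in leRHS]indicE mem_set// mulr1.
  have [By|By] := pselect (ball x0 (q + 1)%R y); last first.
    rewrite indicE memNset// mulr0 addr0.
    rewrite (cutoff_out By) mul0r subr0; rewrite (cutoff_out By) subr0 in hc.
    by apply: ler_pM => //; rewrite lerDr.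
  rewrite indicE mem_set// mulr1.
  rewrite (_ : cutoff x0 q x * w x - cutoff x0 q y * w y =
    cutoff x0 q x * (w x - w y) + w y * (cutoff x0 q x - cutoff x0 q y))%R; last by ring.
  apply: (@le_trans _ _ (mdist x y `^ s * (G x + G y) + mdist x y `^ s * w y)%R).
    apply: lerD; last by rewrite mulrC ler_wpM2r.
    have [ww|/ltW ww] := leP 0%R (w x - w y)%R.
      by apply: (le_trans _ (wG x y Bx By Nx Ny)); rewrite ler_piMl.
    apply: (@le_trans _ _ 0%R); first by rewrite mulr_ge0_le0.
    by rewrite mulr_ge0// addr_ge0.
  rewrite -mulrDr ler_wpM2l//; have := w0 x; lra.
move=> x y Nx Ny; rewrite ler_norml; apply/andP; split.
  rewrite lerNl opprB metric_sym; apply: (le_trans (key y x Ny Nx)).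
  by rewrite ler_wpM2l ?powR_ge0// addrC.
exact: key.
Qed.

Lemma rare_le z (r : R) (f g : T -> R) t : (forall x, g x <= f x)%R ->
  rare mu cd z r f t -> rare mu cd z r g t.
Proof.
move=> gf; apply: le_trans; apply: le_outer_measure; apply: setIS => x /= tg.
exact: lt_le_trans (gf x).
Qed.

(** Where [E] fills half of a small ball, so does the set where its test function
    is 1, and the envelope is 1. Twice the envelope, clipped and cut off, is thus
    1 near all these points, and its gradient costs no more than the maximal
    function of the test pair. *)
Lemma mcap_dense x0 (q c1 : R) : (0 < q)%R -> (0 < c1)%R ->
  (forall z r, ball x0 (q + 2)%R z -> (0 < r <= 1)%R -> c1 * r `^ Q <= vol mu z r)%R ->
  forall e : R, (0 < e)%R -> exists r0 eta : R, [/\ (0 < r0)%R, (0 < eta)%R &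
    forall E : set T, mcap_le mu p s E eta%:E ->
      mcap_le mu p s (ball x0 q `&` [set x | exists2 r, (0 < r < r0)%R &
        (vol mu x r / 2)%:E <= mu (ball x r `&` E)]) e%:E].
Proof.
move=> q0 c10 mass e e0.
have q1 : (0 < q + 1)%R by lra.
have V0 : (0 < vol mu x0 (q + 1))%R by exact: vol_gt0.
pose A0 := (e / (4 * vol mu x0 (q + 1)))%R.
have A00 : (0 < A0)%R by rewrite divr_gt0// mulr_gt0.
(* The new gradient is [A G] with [A k <= 38], and [G] is at least [k ^+ 2]: this
   floor costs up to [(38 k) `^ p] at each point of the ball. *)
pose k := (Num.min 1 (A0 `^ pm^-1) / 39)%R.
have m0 : (0 < Num.min 1 (A0 `^ pm^-1))%R by rewrite lt_min ltr01 powR_gt0.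
have k0 : (0 < k)%R by rewrite divr_gt0.
have k39 : (39 * k <= 1)%R by rewrite /k mulrC divfK// ge_min lexx.
have k1 : (0 < k < 1)%R by rewrite k0/=; lra.
have k38A : (38 * k <= A0 `^ pm^-1)%R.
  apply: (@le_trans _ _ (39 * k)%R); first by rewrite ler_pM2r// ler_nat.
  by rewrite /k mulrC divfK// ge_min lexx orbT.
clearbody k.
have kp : ((38 * k) `^ pm <= A0)%R.
  rewrite -[leRHS](@powR_inv_exp _ A0 pm) ?(ltW A00)//.
  by rewrite ge0_ler_powR ?nnegrE ?powR_ge0 ?(ltW pm_gt0) ?mulr_ge0 ?(ltW k0).
pose r0 := (k / 8)%R.
have r00 : (0 < r0)%R by rewrite divr_gt0.
pose A := (2 * (11 + (r0 `^ s)^-1))%R.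
have rs0 : (0 < r0 `^ s)%R by exact: powR_gt0.
have A_gt0 : (0 < A)%R by rewrite mulr_gt0// addr_gt0// invr_gt0.
have Ak : (A * k <= 38)%R.
  have h1 : (r0 <= r0 `^ s)%R by apply: ger1_powR => //; rewrite r00/= /r0; lra.
  have h2 : ((r0 `^ s)^-1 * k <= 8)%R.
    rewrite mulrC ler_pdivrMr//; move: h1; rewrite /r0; lra.
  have : ((r0 `^ s)^-1 * k + 11 * k <= 19)%R by lra.
  by rewrite /A; lra.
pose B := ((38 / k) `^ pp)%R.
have k38 : (1 <= 38 / k)%R by rewrite ler_pdivlMr// mul1r; lra.
have B0 : (0 < B)%R by rewrite powR_gt0// divr_gt0.
have [C C0 maximalC] := variable_maximal mu_regular mu_balls cd_ge1 vol_dbl mp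
  pm_gt0 p_ge p_le Cp_gt0 p_lh Q_gt0 c10 mass.
pose eta := Num.min 1%R (e / (4 * B * C))%R.
have eta0 : (0 < eta)%R by rewrite lt_min ltr01 divr_gt0// !mulr_gt0.
have eta1 : (eta <= 1)%R by rewrite ge_min lexx.
have etaB : (B * C * eta <= e / 4)%R.
  apply: (@le_trans _ _ (B * C * (e / (4 * B * C)))%R).
    by rewrite ler_wpM2l ?mulr_ge0 ?(ltW B0) ?(ltW C0)// ge_min lexx orbT.
  rewrite le_eqVlt; apply/orP; left; apply/eqP; field.
  by rewrite !gt_eqF.
exists r0, eta; split => // E [v [h [[[mv mh v01 h0 [N1 N10 vh]] [U [oU EU Uv]]] cost]]].
have v0 x : (0 <= v x)%R by have /andP[] := v01 x.
pose f x := Num.max (h x) (v x).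
have mf : mu_measurable mu f by exact: measurable_maxr.
have f0 x : (0 <= f x)%R by rewrite le_max h0.
have fcost : pmod mu p f <= eta%:E.
  by apply: le_trans (pmod_max mp mh mv) _; rewrite addeC.
have f1 : pmod mu p f <= 1 by apply: le_trans fcost _; rewrite lee_fin.
have [G [m [[mG G0 mm M0 Im] [Gm [N2 N20 HG]]]]] :=
  maximalC f k mf f0 f1 k1.
have hf x : (h x <= f x)%R by rewrite le_max lexx.
have vf x : (v x <= f x)%R by rewrite le_max lexx orbT.
have rex := rare_exists mu_regular mu_balls cd_ge1 mp pm_gt0 p_ge mh.
have hoo : pmod mu p h < +oo.
  apply: le_lt_trans (ltry eta); apply: (le_trans _ cost).
  by rewrite leeDr// pmod_ge0.
have {}rex := rex hoo.
pose w := envelope mu cd s v h r0.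
have w01 x : (0 <= w x <= 1)%R by exact: envelope01.
have w0 x : (0 <= w x)%R by have /andP[] := w01 x.
have mw : mu_measurable mu w by exact: measurable_envelope.
have Bq x : ball x0 (q + 1)%R x -> ball x0 (q + 2 - 1)%R x.
  by rewrite !in_ballE; lra.
have rG x : ~ N2 x -> ball x0 (q + 1)%R x -> forall z r, (0 < r < r0)%R ->
    ball z (4 * r)%R x -> rare mu cd z r f (G x).
  by move=> Nx Bx z r rr zx; apply: HG => //; exact: Bq.
have wG x : ~ N2 x -> ball x0 (q + 1)%R x -> (w x <= G x)%R.
  move=> Nx Bx; apply: (envelope_le mu_balls cd_ge1 vol_dbl) => // z r rr zx.
  exact: rare_le vf (rG x Nx Bx z r rr zx).
have wH x y : ~ N2 x -> ball x0 (q + 1)%R x ->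
    (w x <= w y + mdist x y `^ s * ((10 + (r0 `^ s)^-1) * G x))%R.
  move=> Nx Bx; apply: (envelope_holder mu_balls cd_ge1 vol_dbl s_gt0 s_le1 h0
    N10 vh r00 rex) => // z r rr zx.
  - exact: rare_le hf (rG x Nx Bx z r rr zx).
  - exact: rare_le vf (rG x Nx Bx z r rr zx).
pose H x := (A * G x * \1_(ball x0 (q + 1)%R) x)%R.
have mB := ball_mu_measurable mu_regular x0 (q + 1)%R.
have mH : mu_measurable mu H.
  apply: measurable_funM; last exact: measurable_indic.
  by apply: measurable_funM; first exact: measurable_cst.
have A_ge0 : (0 <= A)%R by exact: ltW.
have k380 : (0 <= 38 * k)%R by rewrite mulr_ge0 ?(ltW k0).
have Ak20 : (0 <= A * k ^+ 2)%R by rewrite mulr_ge0 ?A_ge0 ?exprn_ge0 ?(ltW k0).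
have H0 x : (0 <= H x)%R by apply: mulr_ge0 => //; exact: mulr_ge0.
pose V x := clip (2 * (cutoff x0 q x * w x))%R.
have mV : mu_measurable mu V.
  apply: measurable_minr; first exact: measurable_cst.
  apply: measurable_maxr; first exact: measurable_cst.
  apply: measurable_funM; first exact: measurable_cst.
  apply: measurable_funM mw; exact: measurable_cutoff.
have VH x : ~ N2 x -> (0 <= V x <= H x)%R.
  move=> Nx; have /andP[-> _] := clip01 (2 * (cutoff x0 q x * w x))%R.
  rewrite /=; have [Bx|Bx] := pselect (ball x0 (q + 1)%R x); last first.
    by rewrite /V (cutoff_out Bx) mul0r mulr0 /clip maxxx min_r.
  have /andP[cx0 cx1] := cutoff01 x0 q x.
  have cw0 : (0 <= 2 * (cutoff x0 q x * w x))%R by rewrite !mulr_ge0.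
  rewrite /V /clip max_r// ge_min; apply/orP; right.
  rewrite /H indicE mem_set// mulr1 /A -mulrA ler_wpM2l//.
  apply: (@le_trans _ _ (1 * G x)%R); last first.
    by rewrite ler_wpM2r// -[leLHS]addr0 lerD ?invr_ge0 ?(ltW rs0)// ler1n.
  by apply: ler_pM => //; exact: wG.
have costH : pmod mu p H <= (e / 2)%:E.
  apply: (@le_trans _ _ (\int[nu]_x (A0%:E * (\1_(ball x0 (q + 1)%R) x : R)%:E + B%:E * m x))).
    apply: ge0_le_integral => //.
    - by move=> x _; rewrite lee_fin powR_ge0.
    - exact: measurable_pmod.
    - apply: emeasurable_funD; apply: emeasurable_funM => //.
      by apply/measurable_EFinP; exact: measurable_indic.
    move=> x _; have [Bx|Bx] := pselect (ball x0 (q + 1)%R x); last first.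
      rewrite /H indicE memNset// !mulr0 powR0 ?gt_eqF// mule0 add0e.
      by rewrite mule_ge0// lee_fin ltW.
    rewrite /H indicE mem_set// !mulr1 mule1 powRM// ?A_ge0//.
    apply: (@le_trans _ _ ((A `^ p x)%:E * (((k ^+ 2) `^ p x)%:E + m x))).
      by rewrite EFinM lee_wpmul2l// lee_fin powR_ge0.
    rewrite ge0_muleDr ?lee_fin ?powR_ge0//; apply: leeD.
      rewrite -EFinM lee_fin -powRM ?exprn_ge0 ?A_ge0 ?(ltW k0)//.
      apply: le_trans kp; apply: (@le_trans _ _ ((38 * k) `^ p x)%R).
        rewrite ge0_ler_powR ?nnegrE ?(ltW (p_gt0 x)) ?Ak20 ?k380//.
        by rewrite expr2 mulrA ler_wpM2r ?(ltW k0).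
      by apply: ger_powR => //; rewrite mulr_gt0//=; lra.
    rewrite lee_wpmul2r// lee_fin; apply: (@le_trans _ _ ((38 / k) `^ p x)%R).
      rewrite ge0_ler_powR ?nnegrE ?(ltW (p_gt0 x)) ?divr_ge0 ?A_ge0 ?(ltW k0)//.
      by rewrite ler_pdivlMr.
    exact: ler_powR.
  rewrite ge0_integralD//; first last.
  - by apply: emeasurable_funM.
  - by move=> x _; rewrite mule_ge0// lee_fin ltW.
  - by apply: emeasurable_funM => //; apply/measurable_EFinP; exact: measurable_indic.
  - by move=> x _; rewrite -EFinM lee_fin mulr_ge0// ltW.
  rewrite (splitr (e / 2)%R) EFinD; apply: leeD.
    rewrite ge0_integralZl//; first last.
    - by rewrite lee_fin ltW.
    - by apply/measurable_EFinP; exact: measurable_indic.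
    rewrite integral_indic// setIT [X in _ * X](mu_ballE mu_balls)// -EFinM lee_fin.
    rewrite le_eqVlt; apply/orP; left; apply/eqP; rewrite /A0; field.
    by rewrite gt_eqF.
  rewrite ge0_integralZl//; last by rewrite lee_fin ltW.
  apply: (@le_trans _ _ (B%:E * (C%:E * eta%:E))).
    rewrite lee_wpmul2l ?lee_fin ?(ltW B0)//; apply: (le_trans Im).
    by rewrite lee_wpmul2l// lee_fin ltW.
  by rewrite -!EFinM lee_fin mulrA; apply: (le_trans etaB); lra.
exists V, H; split; first split; first split => //.
- by move=> x; exact: clip01.
- exists N2 => // x y Nx Ny; apply: (le_trans (clip_lipschitz _ _)).
  rewrite -mulrBr normrM ger0_norm//.
  have := @cutoff_hgradient x0 q w (fun x => (10 + (r0 `^ s)^-1) * G x)%R N2 w0 _ _ x y Nx Ny.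
  have a0 : (0 <= 10 + (r0 `^ s)^-1)%R by rewrite addr_ge0 ?invr_ge0 ?(ltW rs0).
  move=> /(_ (fun x => mulr_ge0 a0 (G0 x))) hh.
  apply: (@le_trans _ _ (2 * (mdist x y `^ s *
    (((10 + (r0 `^ s)^-1) * G x + w x) * \1_(ball x0 (q + 1)%R) x +
     ((10 + (r0 `^ s)^-1) * G y + w y) * \1_(ball x0 (q + 1)%R) y)))%R).
    rewrite ler_wpM2l//; apply: hh => x1 y1 Bx1 _ Nx1 _.
    rewrite lerBlDl; apply: (le_trans (wH x1 y1 Nx1 Bx1)).
    by rewrite lerD2l ler_wpM2l ?powR_ge0// lerDl mulr_ge0.
  rewrite mulrCA ler_wpM2l ?powR_ge0// mulrDr.
  have half z : ~ N2 z ->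
      (2 * (((10 + (r0 `^ s)^-1) * G z + w z) * \1_(ball x0 (q + 1)%R) z) <= H z)%R.
    move=> Nz; have [Bz|Bz] := pselect (ball x0 (q + 1)%R z); last first.
      by rewrite /H indicE memNset// !mulr0.
    rewrite /H indicE mem_set// !mulr1 /A -mulrA ler_wpM2l//.
    have := wG z Nz Bz; lra.
  by rewrite lerD// half.
- exists (ball x0 q `&` [set x | (2^-1 < w x)%R]); split.
  + by apply: openI; [exact: ball_open_mdist|exact: open_envelope].
  + move=> x [Bx [r rr hx]]; split => //=.
    apply: (@lt_le_trans _ _ 1%R); first by lra.
    apply: half_envelope rr _ _ => //; apply: (le_trans hx).
    apply: le_outer_measure; apply: setIS => y /EU /Uv /= ->.
    by rewrite lexx.
  + move=> x [Bx /= wx]; rewrite /V (cutoff_in Bx) mul1r clip_ge1//; lra.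
- rewrite (splitr e) EFinD; apply: leeD; last exact: costH.
  exact: (le_trans (ae_le_pmod mp p_gt0 mV mH N20 VH) costH).
Qed.

End dense_capacity.

(** * Quasicontinuous functions are finite outside a set of capacity zero *)

Lemma within_near (T S : topologicalType) (u : T -> S) (E : set T) x (A : set S) :
  {within ~` E, continuous u} -> ~ E x -> nbhs (u x) A ->
  nbhs x [set y | ~ E y -> A (u y)].
Proof. by move=> /subspace_continuousP uE Ex /(uE x Ex). Qed.

Section quasicontinuity.
Context {R : realType} {T : pmetricType R} (mu : {outer_measure set T -> \bar R}).
Local Notation X := (caratheodory_type mu).
Local Notation nu := (caratheodory_restriction mu).
Hypothesis mu_regular : borel_regular mu.
Hypothesis mu_balls : balls_positive_finite mu.
Variables (p : T -> R) (s pm pp : R).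
Hypothesis mp : mu_measurable mu p.
Hypothesis pm_gt0 : (0 < pm)%R.
Hypothesis p_ge : forall x, (pm <= p x)%R.
Hypothesis p_le : forall x, (p x <= pp)%R.
Hypothesis s_gt0 : (0 < s)%R.
Hypothesis s_le1 : (s <= 1)%R.

Let p_gt0 x : (0 < p x)%R. Proof. exact: lt_le_trans (p_ge x). Qed.

Variables (u : T -> \bar R) (ur h : T -> R) (N : set T).
Hypothesis mu_u : mu_measurable mu u.
Hypothesis mh : mu_measurable mu h.
Hypothesis h_ge0 : forall x, (0 <= h x)%R.
Hypothesis h_fin : pmod mu p h < +oo.
Hypothesis N0 : mu N = 0.
Hypothesis u_real : forall x, ~ N x -> u x = (ur x)%:E.
Hypothesis u_grad : forall x y, ~ N x -> ~ N y ->
  (`|ur x - ur y| <= mdist x y `^ s * (h x + h y))%R.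
Hypothesis u_qc : quasicontinuous mu s p u.

Lemma quasicontinuous_mcap (e : R) : (0 < e)%R ->
  exists2 E : set T, mcap_le mu p s E e%:E & {within ~` E, continuous u}.
Proof.
move=> e0; have [eta eta0 H] := capacity_mcap_le s mp pm_gt0 p_ge e0.
by have [E cE uE] := u_qc eta0; exists E => //; exact: H.
Qed.

Definition ramp (k : R) (x : T) : R := fine (mine 1 ((k^-1)%:E * `|u x|)).

Lemma ramp_fin k x a : (0 < k)%R -> u x = a%:E -> ramp k x = clip (`|a| / k)%R.
Proof.
move=> k0 ux; rewrite /ramp ux abse_EFin -EFinM -EFin_min /= mulrC /clip max_r//.
by rewrite divr_ge0// ltW.
Qed.

Lemma ramp_infty k x : (0 < k)%R -> `|u x| = +oo -> ramp k x = 1%R.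
Proof.
by move=> k0 ux; rewrite /ramp ux mulry gtr0_sg ?invr_gt0// mul1e min_l// leey.
Qed.

Lemma abse_cases x : (exists a, u x = a%:E) \/ `|u x| = +oo.
Proof. by case: (u x) => [a||]; [left; exists a|right|right]. Qed.

Lemma ramp01 k x : (0 < k)%R -> (0 <= ramp k x <= 1)%R.
Proof.
move=> k0; have [[a ux]|ux] := abse_cases x.
  by rewrite (ramp_fin k0 ux); exact: clip01.
by rewrite ramp_infty// ler01 lexx.
Qed.

Lemma ramp_ge1 k x : (0 < k)%R -> k%:E <= `|u x| -> ramp k x = 1%R.
Proof.
move=> k0; have [[a ux]|ux] := abse_cases x; last by rewrite ramp_infty.
rewrite ux abse_EFin lee_fin => ka; rewrite (ramp_fin k0 ux) clip_ge1//.
by rewrite ler_pdivlMr// mul1r.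
Qed.

Lemma measurable_ramp k : mu_measurable mu (ramp k).
Proof.
apply: (measurableT_comp (@fine_measurable R setT measurableT)).
apply: measurable_mine; first exact: measurable_cst.
apply: emeasurable_funM; first exact: measurable_cst.
by apply: measurableT_comp.
Qed.

Lemma measurable_abse_gt (a : R) : measurable ([set x | a%:E < `|u x|] : set X).
Proof.
have -> : [set x | a%:E < `|u x|] = [set: X] `&` (fun x => `|u x|) @^-1` `]a%:E, +oo[%classic.
  rewrite setTI; apply/seteqP; split => x; rewrite /= in_itv/= andbT//.
have mau : measurable_fun [set: X] (fun x : X => `|u x|) by apply: measurableT_comp.
by apply: mau => //; exact: emeasurable_itv.
Qed.

(** As [k] grows the ramps decrease to the indicator of the null set where [u] is
    infinite. *)
Lemma ramp_vanishes x0 (q e : R) : (0 < q)%R -> (0 < e)%R -> exists2 k : R, (1 <= k)%R &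
  pmod mu p (fun x => ramp k x * \1_(ball x0 q) x)%R <= e%:E /\ (k `^ (- pm) <= e)%R.
Proof.
move=> q0 e0.
pose F (n : nat) := ball x0 q `&` [set x | n%:R%:E < `|u x|].
have mB := ball_mu_measurable mu_regular x0 q.
have mF n : measurable (F n : set X) by apply: measurableI => //; exact: measurable_abse_gt.
have F0 : mu (\bigcap_n F n) = 0.
  apply/eqP; rewrite -measure_le0 -N0; apply: le_outer_measure => x Fx.
  apply: contrapT => Nx; have [_ /=] := Fx (Num.truncn `|ur x|).+1 Logic.I.
  rewrite (u_real Nx) abse_EFin lte_fin => /lt_trans/(_ (truncnS_gt _)).
  by rewrite ltxx.
have cvF : mu (F n) @[n --> \oo] --> 0.
  rewrite -F0; apply: (@nonincreasing_cvg_mu _ X R nu F) => //.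
  - apply: (@le_lt_trans _ _ (mu (ball x0 q))).
      by apply: le_outer_measure; exact: subIsetl.
    by rewrite (mu_ballE mu_balls)// ltry.
  - exact: bigcapT_measurable.
  - move=> m n mn; apply/subsetPset; apply: setIS => x /=; apply: le_lt_trans.
    by rewrite lee_fin ler_nat.
have e20 : (0 < e / 2)%R by rewrite divr_gt0.
pose V := vol mu x0 q; have V0 : (0 < V)%R by exact: vol_gt0.
pose del := Num.min e (e / (2 * V))%R.
have del0 : (0 < del)%R by rewrite lt_min e0 divr_gt0// mulr_gt0.
pose K0 := (del^-1 `^ pm^-1)%R.
have [n [Fn Kn]] : exists n : nat, mu (F n.+1) <= (e / 2)%:E /\ (K0 <= n.+1%:R)%R.
  have lt1 : \forall n \near \oo, mu (F n) < (e / 2)%:E.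
    by apply: (cvF [set y | y < (e / 2)%:E]); apply: open_ereal_lt'; rewrite lte_fin.
  have ge1 : \forall n \near \oo, (K0 <= n%:R)%R by exact: nbhs_infty_ger.
  have [n _ hn] := filterI lt1 ge1.
  by have [/ltW ? ?] := hn n.+1 (leqnSn n); exists n.
set j : R := n.+1%:R.
have j0 : (0 < j)%R by rewrite ltr0n.
have j1 : (1 <= j)%R by rewrite ler1n.
have jp : (j `^ (- pm) <= del)%R.
  rewrite powRN -[leRHS]invrK lef_pV2 ?posrE ?invr_gt0 ?powR_gt0//.
  rewrite -[leLHS](@powR_inv_exp _ del^-1 pm) ?invr_ge0 ?(ltW del0)//.
  by rewrite ge0_ler_powR ?nnegrE ?powR_ge0 ?(ltW pm_gt0) ?(ltW j0).
have jj1 : (1 <= j * j)%R by rewrite mulr_ege1.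
have jj0 : (0 < j * j)%R by exact: mulr_gt0.
exists (j * j)%R => //; split; last first.
  apply: (@le_trans _ _ (j `^ (- pm))%R); last first.
    by apply: (le_trans jp); rewrite ge_min lexx.
  rewrite !powRN lef_pV2 ?posrE ?powR_gt0//.
  rewrite ge0_ler_powR ?nnegrE ?(ltW pm_gt0) ?(ltW j0) ?(ltW jj0)//.
  by rewrite ler_pMl.
apply: (@le_trans _ _ (\int[nu]_x ((\1_(F n.+1) x : R)%:E +
    (j `^ (- pm))%:E * (\1_(ball x0 q) x : R)%:E))).
  apply: ge0_le_integral => //.
  - by move=> x _; rewrite lee_fin powR_ge0.
  - apply: measurable_pmod => //; apply: measurable_funM; first exact: measurable_ramp.
    exact: measurable_indic.
  - apply: emeasurable_funD; first by apply/measurable_EFinP; exact: measurable_indic.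
    apply: emeasurable_funM; first exact: measurable_cst.
    by apply/measurable_EFinP; exact: measurable_indic.
  move=> x _; rewrite -EFinM -EFinD lee_fin.
  have [Bx|Bx] := pselect (ball x0 q x); last first.
    rewrite !indicE (memNset Bx) mulr0 powR0 ?gt_eqF// mulr0 addr0.
    by rewrite ler0n.
  have /andP[r0 r1] := ramp01 x jj0.
  have [ju|uj] := ltP j%:E `|u x|.
    rewrite [in leRHS]indicE mem_set; last by split.
    apply: ler_wpDr; first by rewrite mulr_ge0 ?powR_ge0.
    rewrite indicE mem_set// mulr1.
    by rewrite powR_le1 ?(ltW (p_gt0 x)) ?r0.
  apply: ler_wpDl => //.
  rewrite !indicE !(mem_set Bx) !mulr1.
  have [[a ux]|ux] := abse_cases x; last by rewrite ux leNgt ltry in uj.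
  rewrite ux abse_EFin lee_fin in uj.
  have rj : (ramp (j * j) x <= j^-1)%R.
    rewrite (ramp_fin jj0 ux) /clip max_r ?divr_ge0 ?(ltW jj0)//.
    rewrite ge_min; apply/orP; right.
    by rewrite ler_pdivrMr// mulrA mulVf ?gt_eqF// mul1r.
  apply: (@le_trans _ _ ((j^-1) `^ p x)%R).
    by rewrite ge0_ler_powR ?nnegrE ?(ltW (p_gt0 x)) ?invr_ge0 ?(ltW j0).
  apply: (@le_trans _ _ ((j^-1) `^ pm)%R).
    by apply: ger_powR => //; rewrite invr_gt0 j0/= invf_le1.
  by rewrite powR_invl ?(ltW j0)// powRN.
rewrite ge0_integralD//; first last.
- apply: emeasurable_funM; first exact: measurable_cst.
  by apply/measurable_EFinP; exact: measurable_indic.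
- by move=> x _; rewrite -EFinM lee_fin mulr_ge0 ?powR_ge0.
- by apply/measurable_EFinP; exact: measurable_indic.
rewrite integral_indic// setIT ge0_integralZl//; first last.
- by rewrite lee_fin powR_ge0.
- by apply/measurable_EFinP; exact: measurable_indic.
rewrite integral_indic// setIT [X in _ * X](mu_ballE mu_balls)//.
rewrite (splitr e) EFinD leeD// -EFinM lee_fin -/V.
apply: (@le_trans _ _ (e / (2 * V) * V)%R).
  by rewrite ler_wpM2r ?(ltW V0)// (le_trans jp)// ge_min lexx orbT.
rewrite le_eqVlt; apply/orP; left; apply/eqP; field.
by rewrite gt_eqF.
Qed.

(** Off a set [E] of small capacity, [|u| > k] is a relatively open set
    containing the infinite values; on its union with a neighbourhood of [E] the
    maximum of the two test functions is 1. *)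
Lemma mcap_infinite x0 (q : R) : (0 < q)%R -> forall e : R, (0 < e)%R ->
  mcap_le mu p s (ball x0 q `&` [set x | `|u x| = +oo]) e%:E.
Proof.
move=> q0 e e0.
have e20 : (0 < e / 2)%R by rewrite divr_gt0.
have q1 : (0 < q + 1)%R by lra.
have [E [v [g [[[mv mg v01 g0 vg] [U [oU EU Uv]]] cE]]] uE] := quasicontinuous_mcap e20.
have Ifin : pmod mu p h \is a fin_num by rewrite ge0_fin_numE// pmod_ge0.
set I := fine (pmod mu p h).
have I0 : (0 <= I)%R by rewrite fine_ge0// pmod_ge0.
pose D := (1 + 2 `^ pp * (I + 1))%R.
have D0 : (0 < D)%R by rewrite ltr_wpDr// mulr_ge0 ?powR_ge0// addr_ge0.
have ed0 : (0 < e / 2 / D)%R by rewrite !divr_gt0.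
have [k k1 [ck kp]] := ramp_vanishes x0 q1 ed0.
have k0 : (0 < k)%R by exact: lt_le_trans k1.
pose B := ball x0 (q + 1)%R.
have mB := ball_mu_measurable mu_regular x0 (q + 1)%R.
pose w x := (cutoff x0 q x * ramp k x)%R.
pose rb x := (ramp k x * \1_B x)%R.
pose gw x := ((h x / k + ramp k x) * \1_B x)%R.
have rk01 x : (0 <= ramp k x <= 1)%R by exact: ramp01.
have rk0 x : (0 <= ramp k x)%R by have /andP[] := rk01 x.
have i01 x : (0 <= (\1_B x : R) <= 1)%R by rewrite indicE ler0n lern1 leq_b1.
have i0 x : (0 <= (\1_B x : R))%R by have /andP[] := i01 x.
have hk0 x : (0 <= h x / k)%R by rewrite divr_ge0 ?(ltW k0).
have mw : mu_measurable mu w.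
  by apply: measurable_funM; [exact: measurable_cutoff|exact: measurable_ramp].
have mrb : mu_measurable mu rb.
  by apply: measurable_funM; [exact: measurable_ramp|exact: measurable_indic].
have mhk : mu_measurable mu (fun x => h x / k)%R.
  by apply: measurable_funM => //; exact: measurable_cst.
have mgw : mu_measurable mu gw.
  apply: measurable_funM; last exact: measurable_indic.
  by apply: measurable_funD => //; exact: measurable_ramp.
have w01 x : (0 <= w x <= 1)%R.
  have /andP[c0 c1] := cutoff01 x0 q x; have /andP[r0 r1] := rk01 x.
  by rewrite mulr_ge0//= mulr_ile1.
have gw0 x : (0 <= gw x)%R by apply: mulr_ge0 => //; exact: addr_ge0.
have wg : hgradient mu s w gw.
  exists N => // x y Nx Ny.
  apply: (@cutoff_hgradient _ _ s s_gt0 s_le1 x0 q (ramp k) (fun x => h x / k)%R N)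
    => // x1 y1 _ _ Nx1 Ny1.
  rewrite (ramp_fin k0 (u_real Nx1)) (ramp_fin k0 (u_real Ny1)).
  apply: (le_trans (ler_norm _)); apply: (le_trans (clip_lipschitz _ _)).
  rewrite -mulrBl normrM [X in (_ * X)%R]gtr0_norm ?invr_gt0//.
  rewrite -mulrDl mulrA ler_wpM2r ?invr_ge0 ?(ltW k0)//.
  exact: le_trans (ler_dist_dist _ _) (u_grad Nx1 Ny1).
have cw : pmod mu p w <= (e / 2 / D)%:E.
  apply: (le_trans _ ck); apply: le_pmod => // x.
  have /andP[w0 _] := w01 x; rewrite w0/=.
  have [Bx|Bx] := pselect (B x).
    rewrite indicE mem_set// mulr1 ler_piMl//.
    by have /andP[] := cutoff01 x0 q x.
  by rewrite /w (cutoff_out Bx) mul0r mulr_ge0.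
have cgw : pmod mu p gw <= (2 `^ pp * (e / 2 / D * I + e / 2 / D))%:E.
  apply: (@le_trans _ _ ((2 `^ pp)%:E *
      (pmod mu p (fun x => h x / k)%R + pmod mu p rb))); last first.
    rewrite EFinM lee_wpmul2l ?lee_fin ?powR_ge0// EFinD.
    apply: leeD; last exact: ck.
    apply: (@le_trans _ _ ((k `^ (- pm))%:E * pmod mu p h)).
      apply: le_pmod_scale => //; first exact: powR_ge0.
      move=> x; rewrite powR_divr// mulrC ler_wpM2r ?powR_ge0//.
      rewrite powRN lef_pV2 ?posrE ?powR_gt0//; exact: ler_powR.
    rewrite -(fineK Ifin) -/I -EFinM lee_fin.
    by rewrite ler_wpM2r.
  rewrite -ge0_integralD//; first last.
  - exact: measurable_pmod.
  - by move=> x _; rewrite lee_fin powR_ge0.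
  - exact: measurable_pmod.
  - by move=> x _; rewrite lee_fin powR_ge0.
  rewrite -ge0_integralZl//; first last.
  - by move=> x _; rewrite adde_ge0 ?lee_fin ?powR_ge0.
  - by apply: emeasurable_funD; exact: measurable_pmod.
  apply: ge0_le_integral => //.
  - by move=> x _; rewrite lee_fin powR_ge0.
  - exact: measurable_pmod.
  - apply: emeasurable_funM; first exact: measurable_cst.
    by apply: emeasurable_funD; exact: measurable_pmod.
  move=> x _; rewrite -EFinD -EFinM lee_fin.
  pose a := (h x / k)%R; pose b := rb x.
  have b0 : (0 <= b)%R by exact: mulr_ge0.
  have gab : (gw x <= 2 * Num.max a b)%R.
    apply: (@le_trans _ _ (a + b)%R).
      rewrite /gw mulrDl lerD2r ler_piMr//; by have /andP[] := i01 x.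
    rewrite mulr_natl mulr2n; apply: lerD; rewrite le_max lexx ?orbT//.
  have m0 : (0 <= Num.max a b)%R by rewrite le_max b0 orbT.
  apply: (@le_trans _ _ ((2 * Num.max a b) `^ p x)%R).
    have m20 : (0 <= 2 * Num.max a b)%R by rewrite mulr_ge0.
    by rewrite ge0_ler_powR ?nnegrE ?(ltW (p_gt0 x)) ?gw0 ?m20.
  rewrite (@powRM _ 2%R)//; apply: ler_pM => //; rewrite ?powR_ge0//.
    by apply: ler_powR => //; rewrite ler1n.
  rewrite /Num.max; case: ifP => _; rewrite ?lerDl ?lerDr powR_ge0//.
exists (fun x => Num.max (v x) (w x)), (fun x => Num.max (g x) (gw x)).
split; first split; first split.
- exact: measurable_maxr.
- exact: measurable_maxr.
- move=> x; have /andP[v0 v1] := v01 x; have /andP[w0 w1] := w01 x.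
  by rewrite le_max v0 ge_max v1.
- by move=> x; rewrite le_max g0.
- exact: hgradient_max.
- exists [set x | nbhs x [set y | Num.max (v y) (w y) = 1%R]]; split.
  + exact: open_interior.
  + move=> x [Bx ux].
    have maxv y : U y -> Num.max (v y) (w y) = 1%R.
      by move=> /Uv ->; apply/max_idPl; have /andP[] := w01 y.
    have maxw y : ball x0 q y -> k%:E < `|u y| -> Num.max (v y) (w y) = 1%R.
      move=> By /ltW ku; rewrite /w (cutoff_in By) ramp_ge1// mulr1.
      by apply/max_idPr; have /andP[] := v01 y.
    have [Ex|Ex] := pselect (E x).
      rewrite /= nbhsE; exists U; first by split => //; exact: EU.
      by move=> y; exact: maxv.
    have big : nbhs (u x) [set z | k%:E < `|z|].
      move: ux => /=; case: (u x) => [//|_|_].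
      * by exists k; split => [|z kz]; [exact: num_real|exact: (lt_le_trans kz (lee_abs z))].
      * exists (- k)%R; split => [|z kz]; first exact: num_real.
        rewrite /= -abseN; apply: (@lt_le_trans _ _ (- z)); last exact: lee_abs.
        by rewrite -lteN2 oppeK.
    have near_big := within_near uE Ex big.
    have near_ball : nbhs x (ball x0 q).
      by apply: open_nbhs_nbhs; split => //; exact: ball_open_mdist.
    rewrite /=; apply: filterS (filterI near_big near_ball) => y [hy By] /=.
    have [/EU|Ey] := pselect (E y); first exact: maxv.
    by apply: maxw => //; exact: hy.
  + by move=> x /nbhs_singleton.
apply: (le_trans (leeD (pmod_max mp mv mw) (pmod_max mp mg mgw))).
rewrite addeACA [in leRHS](splitr e) EFinD; apply: leeD; first exact: cE.
apply: (le_trans (leeD cw cgw)); rewrite -EFinD lee_fin.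
rewrite le_eqVlt; apply/orP; left; apply/eqP.
rewrite (_ : e / 2 / D + 2 `^ pp * (e / 2 / D * I + e / 2 / D) = e / 2 / D * D)%R.
  by rewrite divfK// gt_eqF.
by rewrite /D; ring.
Qed.

End quasicontinuity.

(** * Lebesgue points *)

Section limits.
Context {R : realType}.

Lemma near_at_right0 (P : R -> Prop) (r1 : R) : (0 < r1)%R ->
  (forall r, (0 < r < r1)%R -> P r) -> \forall r \near (0 : R)^'+, P r.
Proof.
move=> r10 h; near=> r; apply: h.
by apply/andP; split; near: r; [exact: nbhs_right_gt|exact: nbhs_right_lt].
Unshelve. all: by end_near. Qed.

Lemma cvg_ereal_real (F : set_system R) {FF : Filter F} (f : R -> \bar R) (a : R) :
  (forall e : R, (0 < e)%R ->
    \forall r \near F, (a - e)%:E <= f r <= (a + e)%:E) -> f @ F --> a%:E.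
Proof.
move=> h A [d /= d0 dA].
have d20 : (0 < d / 2)%R by rewrite divr_gt0.
apply: filterS (h _ d20) => r; rewrite /preimage/=; case: (f r) => [b||]; last 2 first.
- by rewrite leye_eq andbF.
- by rewrite leeNy_eq.
rewrite !lee_fin => /andP[h1 h2]; apply: dA => /=.
by rewrite /ball_/= ltr_norml; lra.
Qed.

End limits.

Section medians.
Context {R : realType} {T : pmetricType R} (mu : {outer_measure set T -> \bar R}).

Lemma median_le (gamma : R) (u : T -> \bar R) (A : set T) (a : R) :
  mu (A `&` [set x | a%:E < u x]) < gamma%:E * mu A ->
  median mu gamma u A <= a%:E.
Proof. by move=> h; apply: ereal_inf_lbound; exists a. Qed.

Lemma median_ge (gamma : R) (u : T -> \bar R) (A : set T) (b : R) :
  (forall a : R, (a < b)%R ->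
    gamma%:E * mu A <= mu (A `&` [set x | a%:E < u x])) ->
  b%:E <= median mu gamma u A.
Proof.
move=> h; apply: le_ereal_inf_tmp => _ [a /= ha <-]; rewrite lee_fin leNgt.
by apply/negP => /h; rewrite leNgt ha.
Qed.

End medians.

Section lebesgue_points.
Context {R : realType} {T : pmetricType R} (mu : {outer_measure set T -> \bar R}).
Local Notation X := (caratheodory_type mu).
Local Notation nu := (caratheodory_restriction mu).
Hypothesis mu_regular : borel_regular mu.
Hypothesis mu_balls : balls_positive_finite mu.
Variables (p : T -> R) (s pm pp : R).
Hypothesis mp : mu_measurable mu p.
Hypothesis pm_gt0 : (0 < pm)%R.
Hypothesis p_ge : forall x, (pm <= p x)%R.
Hypothesis p_le : forall x, (p x <= pp)%R.
Hypothesis s_gt0 : (0 < s)%R.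
Hypothesis s_le1 : (s <= 1)%R.

Let p_gt0 x : (0 < p x)%R. Proof. exact: lt_le_trans (p_ge x). Qed.

Variables (u : T -> \bar R) (ur h : T -> R) (N : set T).
Hypothesis mu_u : mu_measurable mu u.
Hypothesis mur : mu_measurable mu ur.
Hypothesis mh : mu_measurable mu h.
Hypothesis h_ge0 : forall x, (0 <= h x)%R.
Hypothesis N0 : mu N = 0.
Hypothesis u_real : forall x, ~ N x -> u x = (ur x)%:E.
Hypothesis u_grad : forall x y, ~ N x -> ~ N y ->
  (`|ur x - ur y| <= mdist x y `^ s * (h x + h y))%R.

(** The exceptional set of quasicontinuity may be chosen to avoid [x] and to
    leave room near [x] at all small scales. *)
Definition approx_continuous (x : T) := exists E : set T, [/\ ~ E x,
  {within ~` E, continuous u} & exists2 r0 : R, (0 < r0)%R &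
    forall r, (0 < r < r0)%R -> mu (ball x r `&` E) < (vol mu x r / 2)%:E].

Definition vanishing_energy (x : T) := forall l : R, (0 < l)%R ->
  exists2 r1 : R, (0 < r1)%R & forall r, (0 < r < r1)%R ->
    energy mu p s h x r <= (l * vol mu x r)%:E.

Variables (x : T) (a : R).
Hypothesis ux : u x = a%:E.
Hypothesis x_cont : approx_continuous x.
Hypothesis x_energy : vanishing_energy x.

Lemma energy_chebyshev (r t c : R) : (0 <= t)%R -> (0 <= c)%R ->
  (forall y, c <= t `^ p y)%R ->
  c%:E * mu (ball x r `&` [set y | (t < r `^ s * h y)%R]) <= energy mu p s h x r.
Proof.
move=> t0 c0 ct; apply: (chebyshev_modular mp p_gt0) => //.
  apply: measurable_funM => //; exact: measurable_cst.
exact: ball_mu_measurable.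
Qed.

(** Where the rescaled gradient is at most [e] the values of [u] differ by at most
    [4 e]; the remaining points are too few to keep all such points inside the
    exceptional set of quasicontinuity, and off that set [u] is within [e] of
    [u x]. *)
Lemma oscillation (e g : R) : (0 < e <= 1)%R -> (0 < g)%R ->
  exists2 r1 : R, (0 < r1)%R & forall r, (0 < r < r1)%R ->
    mu (ball x r `&` [set y | (e < r `^ s * h y)%R]) <= (g * vol mu x r)%:E /\
    forall y, ball x r y -> ~ N y -> (r `^ s * h y <= e)%R ->
      (`|ur y - a| <= 5 * e)%R.
Proof.
move=> /andP[e0 e1] g0.
have [E [Ex uE [r0 r00 Er]]] := x_cont.
pose g' := Num.min g 4^-1%R.
have g'0 : (0 < g')%R by rewrite lt_min g0 /= invr_gt0.
have ep0 : (0 < e `^ pp)%R by rewrite powR_gt0.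
have [r1 r10 hr1] := x_energy (mulr_gt0 g'0 ep0).
have near_a : nbhs (u x) [set z | `|z - a%:E| < e%:E].
  rewrite ux; exists e => //= b; rewrite /ball_/= => ab.
  by rewrite /= lte_fin distrC.
have /nbhs_ballP[d /= d0 dA] := within_near uE Ex near_a.
pose r2 := Num.min r0 (Num.min r1 d).
exists r2; first by rewrite !lt_min r00 r10.
move=> r; rewrite /r2 !lt_min => /andP[rp /and3P[rr0 rr1 rd]].
have V0 : (0 < vol mu x r)%R by exact: vol_gt0.
have bad : mu (ball x r `&` [set y | (e < r `^ s * h y)%R]) <= (g' * vol mu x r)%:E.
  rewrite -(@lee_pmul2l _ (e `^ pp)%:E) ?lte_fin//.
  apply: (@le_trans _ _ (energy mu p s h x r)).
    apply: energy_chebyshev => //; [exact: ltW|exact: ltW|move=> y].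
    by apply: ger_powR => //; rewrite e0.
  apply: (le_trans (hr1 r _)); first by rewrite rp.
  by rewrite -EFinM lee_fin mulrCA mulrA.
split.
  apply: (le_trans bad); rewrite lee_fin ler_wpM2r ?(ltW V0)//.
  by rewrite ge_min lexx.
have [y' [xy' Ey' Ny' hy']] : exists y', [/\ ball x r y', ~ E y', ~ N y' &
    (r `^ s * h y' <= e)%R].
  apply: contrapT => H.
  suff : mu (ball x r) < (vol mu x r)%:E by rewrite (mu_ballE mu_balls)// ltxx.
  apply: (@le_lt_trans _ _ (mu (ball x r `&` E) +
      (mu (ball x r `&` [set y | (e < r `^ s * h y)%R]) + mu N))).
    apply: (@le_trans _ _ (mu ((ball x r `&` E) `|`
        ((ball x r `&` [set y | (e < r `^ s * h y)%R]) `|` N)))).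
      apply: le_outer_measure => y xy.
      have [Ey|Ey] := pselect (E y); first by left.
      have [Ny|Ny] := pselect (N y); first by right; right.
      right; left; split => //=; rewrite ltNge; apply/negP => hy.
      by apply: H; exists y.
    apply: (le_trans (outer_measureU2 _ _ _)); rewrite leeD2l//.
    exact: outer_measureU2.
  rewrite N0 adde0.
  have rr : (0 < r < r0)%R by rewrite rp.
  apply: (@lt_le_trans _ _ ((vol mu x r / 2)%:E + (g' * vol mu x r)%:E)).
    apply: lte_leD => //; last exact: Er.
    rewrite ge0_fin_numE//; exact: le_lt_trans bad (ltry _).
  rewrite -EFinD lee_fin.
  have : (g' <= 4^-1)%R by rewrite ge_min lexx orbT.
  nra.
move=> y xy Ny hy.
have y'a : (`|ur y' - a| < e)%R.
  have : ball x d y' by move: xy'; rewrite !in_ballE => /lt_trans; apply.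
  move=> /dA/(_ Ey') /=; rewrite (u_real Ny') -EFinB abse_EFin lte_fin//.
have rs0 : (0 < r `^ s)%R by exact: powR_gt0.
have dyy : (mdist y y' <= 2 * r)%R.
  move: xy xy'; rewrite !in_ballE => xy xy'.
  have := metric_triangle y x y'; rewrite (metric_sym y x); lra.
have dyys : (mdist y y' `^ s <= 2 * r `^ s)%R.
  apply: (@le_trans _ _ ((2 * r) `^ s)%R).
    by rewrite ge0_ler_powR ?nnegrE ?(ltW s_gt0) ?mdist_ge0// mulr_ge0// ltW.
  by rewrite powRM ?(ltW rp)// ler_wpM2r ?(ltW rs0)// ler1_powR// ler1n.
have yy' : (`|ur y - ur y'| <= 4 * e)%R.
  apply: (le_trans (u_grad Ny Ny')).
  apply: (@le_trans _ _ (2 * r `^ s * (h y + h y'))%R).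
    by rewrite ler_wpM2r// addr_ge0.
  by rewrite -mulrA mulrDr; lra.
have := ler_distD (ur y') (ur y) a; lra.
Qed.

Lemma generalized_point : generalized_lebesgue_point mu u x.
Proof.
move=> gamma /andP[ga0 ga1].
suff H : forall e : R, (0 < e)%R -> exists2 r1 : R, (0 < r1)%R &
    forall r, (0 < r < r1)%R ->
      (0 - e)%:E <= median mu gamma (fun y => `|u y - u x|) (ball x r) <= (0 + e)%:E /\
      (a - e)%:E <= median mu gamma u (ball x r) <= (a + e)%:E.
  split; [|rewrite ux]; apply: cvg_ereal_real => e /H[r1 r10 hr].
    by apply: near_at_right0 r10 _ => r /hr[].
  by apply: near_at_right0 r10 _ => r /hr[].
move=> e' e'0; pose e := Num.min 1%R (e' / 5)%R.
have e0 : (0 < e)%R by rewrite lt_min ltr01 divr_gt0.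
have e01 : (0 < e <= 1)%R by rewrite e0 ge_min lexx.
have e5 : (5 * e <= e')%R by rewrite mulrC -ler_pdivlMr// ge_min lexx orbT.
pose g := (Num.min gamma (1 - gamma) / 2)%R.
have g0 : (0 < g)%R by rewrite divr_gt0// lt_min ga0 subr_gt0.
have gg : (g < gamma)%R.
  have : (Num.min gamma (1 - gamma) <= gamma)%R by rewrite ge_min lexx.
  by move: g0; rewrite /g; lra.
have g1 : (g <= 1 - gamma)%R.
  have : (Num.min gamma (1 - gamma) <= 1 - gamma)%R by rewrite ge_min lexx orbT.
  by move: g0; rewrite /g; lra.
have [r1 r10 hr1] := oscillation e01 g0.
exists r1 => // r rr; have /andP[r0 _] := rr.
have [bad good] := hr1 r rr.
have V0 := vol_gt0 mu_balls x r0.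
have muB := mu_ballE mu_balls x r0.
pose Z := (ball x r `&` [set y | (e < r `^ s * h y)%R]) `|` N.
have muZ : mu Z <= (g * vol mu x r)%:E.
  by apply: (le_trans (outer_measureU2 _ _ _)); rewrite N0 adde0.
have goodZ y : ball x r y -> ~ Z y -> u y = (ur y)%:E /\ (`|ur y - a| <= 5 * e)%R.
  move=> xy /not_orP[Zy Ny]; split; first exact: u_real.
  by apply: good => //; rewrite leNgt; apply/negP => hy; apply: Zy.
have lt_half (P : set T) : ball x r `&` P `<=` Z -> mu (ball x r `&` P) < gamma%:E * mu (ball x r).
  move=> PZ; apply: (le_lt_trans (le_outer_measure mu _ _ PZ)).
  by apply: (le_lt_trans muZ); rewrite muB -EFinM lte_fin ltr_pM2r.
have ge_half (P : set T) : (forall y, ball x r y -> ~ Z y -> P y) ->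
    gamma%:E * mu (ball x r) <= mu (ball x r `&` P).
  move=> ZP; rewrite -(@leeD2rE _ (g * vol mu x r)%:E)//.
  apply: (@le_trans _ _ (mu (ball x r))).
    by rewrite muB -EFinM -EFinD lee_fin; nra.
  apply: (@le_trans _ _ (mu ((ball x r `&` P) `|` Z))).
    apply: le_outer_measure => y xy.
    by have [Zy|Zy] := pselect (Z y); [right|left; split => //; exact: ZP].
  by apply: (le_trans (outer_measureU2 _ _ _)); rewrite leeD2l.
split; apply/andP; split.
- apply: median_ge => b; rewrite sub0r => b0; apply: ge_half => y xy Zy /=.
  by apply: lt_le_trans (abse_ge0 _); rewrite lte_fin; lra.
- rewrite add0r; apply: median_le; apply: lt_half => y [xy /= hy].
  apply: contrapT => Zy; have [uy hya] := goodZ y xy Zy.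
  move: hy; rewrite uy ux -EFinB abse_EFin lte_fin; lra.
- apply: median_ge => b ba; apply: ge_half => y xy Zy /=.
  have [uy] := goodZ y xy Zy; rewrite ler_norml uy lte_fin; lra.
- apply: median_le; apply: lt_half => y [xy /= hy].
  apply: contrapT => Zy; have [uy] := goodZ y xy Zy.
  move: hy; rewrite uy lte_fin ler_norml; lra.
Qed.

Variable cd : R.
Hypothesis cd_ge1 : (1 <= cd)%R.
Hypothesis vol_dbl :
  forall (x : T) (r : R), (0 < r)%R -> (vol mu x (2 * r) <= cd * vol mu x r)%R.
Variables (c Q : R).
Hypothesis c_gt0 : (0 < c)%R.
Hypothesis Q_gt0 : (0 < Q)%R.
Hypothesis vol_lower : forall (x y : T) (r r' : R), (0 < r <= r')%R ->
  ball x r' y -> (c * (r / r') `^ Q * vol mu x r' <= vol mu y r)%R.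
Hypothesis pm_ge : (Q / (Q + s) <= pm)%R.

Let exponent_gap : (1 - pm * s / Q <= pm)%R.
Proof.
have Qs : (0 < Q + s)%R by exact: addr_gt0.
move: pm_ge; rewrite ler_pdivrMr// => h1.
have : (1 - pm * s / Q = (Q - pm * s) / Q)%R by field; rewrite gt_eqF.
by move=> ->; rewrite ler_pdivrMr//; lra.
Qed.

(** A point where the rescaled gradient [G] is large is joined to a point where
    it is at most 1 by points [y_j] with [G y_j <= 2 ^ j], chosen in balls so
    small that the steps are summable up to [2 ^ (j pm)], and so large, by the
    lower mass bound, that they are not filled by the set [G > 2 ^ j]. *)
Lemma growth : exists2 C : R, (0 < C)%R & exists2 r1 : R, (0 < r1)%R &
  forall r, (0 < r < r1)%R -> forall y, ball x (r / 2)%R y -> ~ N y ->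
    (`|ur y - a| <= C * (1 + (r `^ s * h y) `^ pm))%R.
Proof.
pose l := (c * (2^-1) `^ Q / 2)%R.
have l0 : (0 < l)%R by rewrite divr_gt0// mulr_gt0// powR_gt0// invr_gt0.
have [r1 r10 hr1] := x_energy l0.
have e11 : (0 < (1 : R) <= 1)%R by rewrite ltr01 lexx.
have [r2 r20 hr2] := oscillation e11 ltr01.
have two_pm : (1 < 2 `^ pm)%R.
  have e1 : (1 `^ pm = 1 :> R)%R by rewrite powR1.
  by rewrite -[ltLHS]e1 gt0_ltr_powR ?nnegrE ?ler01 ?ler0n// ltr1n.
pose A := (3 / (2 `^ pm - 1))%R.
have A0 : (0 < A)%R by rewrite divr_gt0// subr_gt0.
have AE : (A + 3 = A * 2 `^ pm)%R.
  by rewrite /A; field; rewrite gt_eqF// subr_gt0.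
clearbody A.
pose b (j : nat) : R := ((2 ^+ j) `^ pm)%R.
have bE j : b j = ((2 ^+ j) `^ pm)%R by [].
clearbody b.
have b1 j : (1 <= b j)%R.
  by rewrite bE powR_ge1 ?(ltW pm_gt0)// exprn_ege1// ler1n.
have bS j : (b j.+1 = b j * 2 `^ pm)%R.
  by rewrite !bE exprSr powRM.
have b0 j : (0 < b j)%R by exact: lt_le_trans (b1 j).
have A_ge0 : (0 <= A)%R by exact: ltW.
exists (5 + (2 * A + 4) * 2 `^ pm)%R.
  by rewrite addr_gt0// mulr_gt0 ?powR_gt0// addr_gt0// mulr_gt0.
exists (Num.min r1 r2); first by rewrite lt_min r10.
move=> r; rewrite lt_min => /andP[r0 /andP[rr1 rr2]] y xy Ny.
have rI1 : (0 < r < r1)%R by rewrite r0.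
have rI2 : (0 < r < r2)%R by rewrite r0.
have [_ good] := hr2 r rI2.
have en := hr1 r rI1.
have rs0 : (0 < r `^ s)%R by exact: powR_gt0.
have V0 : (0 < vol mu x r)%R by exact: vol_gt0.
pose G z := (r `^ s * h z)%R.
have G0 z : (0 <= G z)%R by rewrite mulr_ge0// ltW.
pose th j := (2^-1 * (b j)^-1 `^ Q^-1)%R.
have thE j : th j = (2^-1 * (b j)^-1 `^ Q^-1)%R by [].
clearbody th.
have th0 j : (0 < th j)%R.
  by rewrite thE mulr_gt0 ?invr_gt0// powR_gt0// invr_gt0.
have th1 j : (th j <= 2^-1)%R.
  rewrite thE ler_piMr ?invr_ge0//.
  by rewrite powR_le1 ?invr_ge0 ?(ltW Q_gt0) ?(ltW (b0 j))//= invf_le1.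
have xyr : ball x r y by move: xy; rewrite !in_ballE; lra.
have ex_y j : exists z, [/\ (mdist y z < r * th j)%R, ~ N z & (G z <= 2 ^+ j)%R].
  apply: contrapT => H.
  have rt : (0 < r * th j <= r)%R.
    by rewrite mulr_gt0//= ler_piMr ?(ltW r0)// (le_trans (th1 j)); lra.
  have /andP[rt0 _] := rt.
  have low := vol_lower rt xyr.
  have sub : mu (ball y (r * th j)%R) <=
      mu (ball x r `&` [set z | (2 ^+ j < r `^ s * h z)%R]).
    apply: (@le_trans _ _ (mu ((ball x r `&` [set z | (2 ^+ j < r `^ s * h z)%R]) `|` N))).
      apply: le_outer_measure => z yz; have [Nz|Nz] := pselect (N z); first by right.
      left; split => /=.
        move: xy yz; rewrite !in_ballE => xy yz.
        have := metric_triangle x y z; have : (r * th j <= r * 2^-1)%R.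
          by rewrite ler_wpM2l// ltW.
        by lra.
      rewrite ltNge; apply/negP => hz; apply: H; exists z; split => //.
      by move: yz; rewrite in_ballE.
    by apply: (le_trans (outer_measureU2 _ _ _)); rewrite N0 adde0.
  have bj0 := b0 j.
  have up : (b j)%:E * mu (ball x r `&` [set z | (2 ^+ j < r `^ s * h z)%R]) <=
      (l * vol mu x r)%:E.
    apply: le_trans en; apply: energy_chebyshev; rewrite ?exprn_ge0 ?(ltW bj0)//.
    by move=> z; rewrite bE; apply: ler_powR => //; rewrite exprn_ege1// ler1n.
  have : (b j)%:E * (vol mu y (r * th j))%:E <= (l * vol mu x r)%:E.
    rewrite -(mu_ballE mu_balls)//; apply: le_trans up.
    by rewrite lee_wpmul2l// lee_fin ltW.
  rewrite -EFinM lee_fin => up'.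
  have thQ : ((r * th j / r) `^ Q = (2^-1) `^ Q * (b j)^-1)%R.
    rewrite mulrAC divff ?gt_eqF// mul1r thE powRM ?invr_ge0 ?powR_ge0//.
    by rewrite powR_inv_exp// invr_ge0 ltW.
  rewrite thQ in low.
  have : (b j * (c * ((2^-1) `^ Q * (b j)^-1) * vol mu x r) <= l * vol mu x r)%R.
    by apply: le_trans up'; rewrite ler_wpM2l// ltW.
  rewrite (_ : b j * (c * ((2^-1) `^ Q * (b j)^-1) * vol mu x r) =
     2 * l * vol mu x r)%R; last by rewrite /l; field; rewrite gt_eqF.
  have : (0 < l * vol mu x r)%R by exact: mulr_gt0.
  lra.
have step j : ((r * th j) `^ s * 2 ^+ j <= r `^ s * b j)%R.
  have bj0 := b0 j.
  rewrite powRM ?(ltW r0) ?(ltW (th0 j))// -mulrA ler_wpM2l ?(ltW rs0)//.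
  rewrite thE powRM ?invr_ge0 ?powR_ge0//.
  apply: (@le_trans _ _ (((b j)^-1 `^ Q^-1) `^ s * 2 ^+ j)%R).
    rewrite ler_wpM2r ?exprn_ge0// ler_piMl ?powR_ge0//.
    by apply: powR_le1; [lra|exact: ltW].
  have -> : (((b j)^-1 `^ Q^-1) `^ s * 2 ^+ j = (2 ^+ j) `^ (1 - pm * s / Q))%R.
    have t0 : (0 <= (2 ^+ j : R))%R by rewrite exprn_ge0.
    rewrite bE -powRN -!powRrM -[X in (_ * X)%R]powRr1// -powRD; last first.
      by apply/implyP => _; rewrite expf_neq0.
    by congr (_ `^ _)%R; ring.
  rewrite bE; apply: ler_powR exponent_gap.
  by rewrite exprn_ege1// ler1n.
have /choice[z hz] := ex_y.
have zN j : ~ N (z j) by have [] := hz j.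
have zG j : (G (z j) <= 2 ^+ j)%R by have [] := hz j.
have zy j : (mdist y (z j) < r * th j)%R by have [] := hz j.
have th_dec j : (th j.+1 <= th j)%R.
  rewrite !thE ler_wpM2l ?invr_ge0//.
  rewrite ge0_ler_powR ?nnegrE ?invr_ge0 ?(ltW Q_gt0) ?(ltW (b0 _))//.
  by rewrite lef_pV2 ?posrE// bS ler_peMr ?(ltW two_pm) ?(ltW (b0 j)).
have jump w w' j : ~ N w -> ~ N w' -> (mdist w w' <= 2 * (r * th j))%R ->
    (`|ur w - ur w'| <= 2 * (r * th j) `^ s * (h w + h w'))%R.
  move=> Nw Nw' d; apply: (le_trans (u_grad Nw Nw')).
  rewrite ler_wpM2r ?addr_ge0//.
  have rt0 : (0 <= r * th j)%R by rewrite mulr_ge0 ?(ltW r0) ?(ltW (th0 j)).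
  apply: (@le_trans _ _ ((2 * (r * th j)) `^ s)%R).
    by rewrite ge0_ler_powR ?nnegrE ?(ltW s_gt0) ?mdist_ge0// mulr_ge0.
  by rewrite powRM// ler_wpM2r ?powR_ge0// ler1_powR// ler1n.
have scale w (k : R) j : (G w <= k * 2 ^+ j)%R -> (0 <= k)%R ->
    ((r * th j) `^ s * h w <= k * b j)%R.
  move=> Gw k0.
  have : ((r * th j) `^ s * G w <= k * (r `^ s * b j))%R.
    apply: (@le_trans _ _ ((r * th j) `^ s * (k * 2 ^+ j))%R).
      by rewrite ler_wpM2l ?powR_ge0.
    by rewrite mulrCA ler_wpM2l.
  rewrite /G mulrCA [leRHS]mulrCA ler_pM2l//.
have chain j : (`|ur (z j) - ur (z 0%N)| <= 2 * A * b j)%R.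
  elim: j => [|j ih].
    by rewrite subrr normr0 !mulr_ge0 ?A_ge0 ?(ltW (b0 _)).
  have d : (mdist (z j.+1) (z j) <= 2 * (r * th j))%R.
    have := metric_triangle (z j.+1) y (z j); rewrite (metric_sym (z j.+1) y).
    have : (r * th j.+1 <= r * th j)%R by rewrite ler_wpM2l ?(ltW r0).
    have := zy j; have := zy j.+1; lra.
  have J := jump _ _ j (zN j.+1) (zN j) d.
  have S1 : ((r * th j) `^ s * h (z j.+1) <= 2 * b j)%R.
    by apply: scale => //; rewrite -exprS; exact: zG.
  have S2 : ((r * th j) `^ s * h (z j) <= 1 * b j)%R.
    by apply: scale => //; rewrite mul1r; exact: zG.
  have T1 : (`|ur (z j.+1) - ur (z j)| <= 6 * b j)%R.
    by apply: (le_trans J); rewrite -mulrA mulrDr; lra.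
  have := ler_distD (ur (z j)) (ur (z j.+1)) (ur (z 0%N)).
  rewrite bS.
  have -> : (2 * A * (b j * 2 `^ pm) = 2 * A * b j + 6 * b j)%R.
    rewrite (_ : 2 * A * (b j * 2 `^ pm) = 2 * (A * 2 `^ pm) * b j)%R; last by ring.
    by rewrite -AE; ring.
  by lra.
have d0 : (mdist y (z 0%N) < r / 2)%R.
  by apply: (lt_le_trans (zy 0%N)); rewrite ler_wpM2l ?(ltW r0).
have z0a : (`|ur (z 0%N) - a| <= 5)%R.
  rewrite -[leRHS]mulr1; apply: good; [|exact: zN|exact: zG].
  move: xy; rewrite !in_ballE => xy.
  have := metric_triangle x y (z 0%N); lra.
have last_step j : (G y <= 2 ^+ j)%R -> (`|ur y - a| <= 5 + (2 * A + 4) * b j)%R.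
  move=> Gy; have d : (mdist y (z j) <= 2 * (r * th j))%R.
    have := zy j; have := mdist_ge0 y (z j); lra.
  have J := jump _ _ j Ny (zN j) d.
  have S1 : ((r * th j) `^ s * h y <= 1 * b j)%R by apply: scale => //; rewrite mul1r.
  have S2 : ((r * th j) `^ s * h (z j) <= 1 * b j)%R.
    by apply: scale => //; rewrite mul1r; exact: zG.
  have T1 : (`|ur y - ur (z j)| <= 4 * b j)%R.
    by apply: (le_trans J); rewrite -mulrA mulrDr; lra.
  have := chain j.
  have := ler_distD (ur (z j)) (ur y) (ur (z 0%N)).
  have := ler_distD (ur (z 0%N)) (ur y) a.
  lra.
have Gp0 : (0 <= G y `^ pm)%R by exact: powR_ge0.
have c0 : (0 <= 2 * A + 4)%R by rewrite addr_ge0// mulr_ge0// ltW.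
have p2 : (0 <= 2 `^ pm)%R by exact: powR_ge0.
suff [j Gj bj] : exists2 j, (G y <= 2 ^+ j)%R & (b j <= 2 `^ pm * (1 + G y `^ pm))%R.
  apply: (le_trans (last_step j Gj)); rewrite [in leRHS]mulrDl; apply: lerD.
    by rewrite ler_peMr// lerDl.
  by rewrite -mulrA ler_wpM2l.
have [G1|G1] := leP (G y) 1%R.
  exists 0%N; first by rewrite expr0.
  apply: (@le_trans _ _ (2 `^ pm)%R); last by rewrite ler_peMr// lerDl.
  by rewrite bE expr0 powR1 ltW.
have [k /andP[k1 k2]] := dyadic_bracket (ltW G1).
exists k.+1; first exact: ltW.
rewrite bS mulrC ler_wpM2l// ler_wpDl//.
by rewrite bE ge0_ler_powR ?nnegrE ?(ltW pm_gt0) ?exprn_ge0.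
Qed.

(** Where the rescaled gradient [G] exceeds [e] the bound of [growth] is at most
    a multiple of [G `^ p], whose mean is small. *)
Lemma mean_oscillation (e : R) : (0 < e <= 1)%R ->
  exists2 r1 : R, (0 < r1)%R & forall r, (0 < r < r1)%R ->
    \int[nu]_(y in ball x r) `|ur y - a|%:E <= (6 * e * vol mu x r)%:E.
Proof.
move=> e01; have /andP[e0 e1] := e01.
have [C C0 [r1 r10 hr1]] := growth.
have [r2 r20 hr2] := oscillation e01 ltr01.
have ep0 : (0 < e `^ pp)%R by exact: powR_gt0.
have cd0 : (0 < cd)%R by exact: lt_le_trans cd_ge1.
pose K := (2 * C / e `^ pp)%R.
have K0 : (0 < K)%R by rewrite divr_gt0// mulr_gt0.
have KE : (K * e `^ pp = 2 * C)%R by rewrite /K divfK// gt_eqF.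
clearbody K.
have [r3 r30 hr3] : exists2 r3 : R, (0 < r3)%R & forall r, (0 < r < r3)%R ->
    energy mu p s h x r <= (e / (K * cd) * vol mu x r)%:E.
  by apply: x_energy; rewrite divr_gt0// mulr_gt0.
exists (Num.min r1 (Num.min r2 r3) / 2)%R.
  by rewrite divr_gt0// !lt_min r10 r20.
move=> r; rewrite ltr_pdivlMr// !lt_min => /andP[r0 /and3P[rr1 rr2 rr3]].
have V0 : (0 < vol mu x r)%R by exact: vol_gt0.
pose t := (2 * r)%R.
have t0 : (0 < t)%R by rewrite /t; lra.
have tr : (t / 2 = r)%R by rewrite /t; field.
have t1 : (0 < t < r1)%R by rewrite t0 /t mulrC.
have t2 : (0 < t < r2)%R by rewrite t0 /t mulrC.
have t3 : (0 < t < r3)%R by rewrite t0 /t mulrC.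
have ball2 : ball x r `<=` ball x t.
  by move=> y; rewrite !in_ballE /t; lra.
have [_ good] := hr2 t t2.
pose G z := (t `^ s * h z)%R.
have G0 z : (0 <= G z)%R by rewrite mulr_ge0 ?powR_ge0.
have mG : mu_measurable mu G.
  by apply: measurable_funM => //; exact: measurable_cst.
have bound y : ball x r y -> ~ N y -> (`|ur y - a| <= 5 * e + K * G y `^ p y)%R.
  move=> xy Ny.
  have GK : (0 <= K * G y `^ p y)%R by rewrite mulr_ge0 ?powR_ge0 ?(ltW K0).
  have [Ge|eG] := leP (G y) e.
    have : (`|ur y - a| <= 5 * e)%R by apply: good => //; exact: ball2.
    by move=> h5; apply: (le_trans h5); rewrite lerDl.
  have xy2 : ball x (t / 2)%R y by rewrite tr.
  apply: (le_trans (hr1 t t1 y xy2 Ny)); rewrite -/(G y).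
  apply: (@le_trans _ _ (K * G y `^ p y)%R); last by rewrite ler_wpDl// mulr_ge0 ?(ltW e0).
  have epG : (e `^ pp <= G y `^ p y)%R.
    apply: (@le_trans _ _ (e `^ p y)%R).
      by apply: ger_powR => //; rewrite e0.
    by rewrite ge0_ler_powR ?nnegrE ?(ltW (p_gt0 y)) ?(ltW e0) ?(ltW eG).
  have ep1 : (e `^ pp <= 1)%R.
    rewrite powR_le1 ?(ltW e0)//.
    exact: le_trans (ltW (p_gt0 x)) (p_le x).
  have KC : (2 * C <= K)%R by rewrite -KE ler_piMr ?(ltW K0).
  have [G1|G1] := leP 1%R (G y).
    have q1 : (1 <= G y `^ p y)%R.
      by rewrite powR_ge1 ?(ltW (p_gt0 y)).
    have q2 : (G y `^ pm <= G y `^ p y)%R by exact: ler_powR.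
    nra.
  have q1 : (G y `^ pm <= 1)%R.
    by rewrite powR_le1 ?G0 ?(ltW pm_gt0) ?(ltW G1).
  apply: (@le_trans _ _ (K * e `^ pp)%R); first by rewrite KE; nra.
  by rewrite ler_wpM2l ?(ltW K0).
have mB := ball_mu_measurable mu_regular x.
have mGp : measurable_fun [set: X] (fun y => (G y `^ p y)%:E).
  exact: measurable_pmod.
have mGB : measurable_fun (ball x r : set X) (fun y => (G y `^ p y)%:E).
  exact: measurable_funTS.
have mGBK : measurable_fun (ball x r : set X) (fun y => K%:E * (G y `^ p y)%:E).
  by apply: emeasurable_funM => //; exact: measurable_cst.
apply: (@le_trans _ _ (\int[nu]_(y in ball x r) ((5 * e)%:E + K%:E * (G y `^ p y)%:E))).
  apply: ae_ge0_le_integral.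
  - exact: mB.
  - by move=> y _; rewrite lee_fin.
  - apply: measurable_funTS; apply/measurable_EFinP.
    apply: (@measurableT_comp _ _ _ _ _ _ (@Num.norm R R)) => //.
    by apply: measurable_funB => //; exact: measurable_cst.
  - by move=> y _; rewrite -EFinM -EFinD lee_fin addr_ge0 ?mulr_ge0 ?powR_ge0 ?(ltW e0) ?(ltW K0).
  - by apply: emeasurable_funD => //; exact: measurable_cst.
  - exists N; split => //; first exact: mu0_measurable.
    move=> y; apply: contra_notP => Ny xy.
    by rewrite -EFinM -EFinD lee_fin; exact: bound.
rewrite ge0_integralD; last 5 first.
- exact: mB.
- by move=> y _; rewrite lee_fin mulr_ge0 ?(ltW e0).
- exact: measurable_cst.
- by move=> y _; rewrite -EFinM lee_fin mulr_ge0 ?powR_ge0 ?(ltW K0).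
- exact: mGBK.
rewrite integral_cst; last exact: mB.
rewrite ge0_integralZl_EFin; [|exact: mB| |exact: mGB|exact: ltW]; last first.
  by move=> y _; rewrite lee_fin powR_ge0.
have small : \int[nu]_(y in ball x r) (G y `^ p y)%:E <= (e / K * vol mu x r)%:E.
  apply: (@le_trans _ _ (energy mu p s h x t)).
    apply: ge0_subset_integral => //; first exact: measurable_funTS.
    by move=> y _; rewrite lee_fin powR_ge0.
  apply: (le_trans (hr3 t t3)); rewrite lee_fin.
  have := vol_dbl x r0; rewrite -/t => vt.
  apply: (@le_trans _ _ (e / (K * cd) * (cd * vol mu x r))%R).
    by rewrite ler_wpM2l// divr_ge0 ?mulr_ge0 ?(ltW e0) ?(ltW K0) ?(ltW cd0).
  by rewrite le_eqVlt; apply/orP; left; apply/eqP; field; rewrite !gt_eqF.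
have -> : caratheodory_restriction mu (ball x r) = (vol mu x r)%:E.
  by rewrite -(mu_ballE mu_balls).
apply: (@le_trans _ _ ((5 * e)%:E * (vol mu x r)%:E + K%:E * (e / K * vol mu x r)%:E)).
  by rewrite leeD2l// lee_wpmul2l// lee_fin ltW.
by rewrite -!EFinM -EFinD lee_fin le_eqVlt; apply/orP; left; apply/eqP; field; rewrite gt_eqF.
Qed.

Lemma mean_value_point : lebesgue_point mu u x.
Proof.
have average e : (0 < e <= 1)%R -> exists2 r1 : R, (0 < r1)%R &
    forall r, (0 < r < r1)%R -> nu.-integrable (ball x r) u /\
      `|\int[nu]_(y in ball x r) u y - (a * vol mu x r)%:E| <= (6 * e * vol mu x r)%:E.
  move=> e01; have [r1 r10 hr1] := mean_oscillation e01.
  exists r1 => // r rr; have /andP[r0 _] := rr.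
  have mB := ball_mu_measurable mu_regular x r.
  have muB : nu (ball x r) = (vol mu x r)%:E by rewrite -(mu_ballE mu_balls).
  have mu_uB : measurable_fun (ball x r : set X) u by exact: measurable_funTS.
  have murB : measurable_fun (ball x r : set X) (EFin \o ur).
    by apply: measurable_funTS; exact/measurable_EFinP.
  have uur : ae_eq nu (ball x r) u (EFin \o ur).
    exists N; split => //; first exact: mu0_measurable.
    by move=> y; apply: contra_notP => Ny _; exact: u_real.
  have mD : measurable_fun (ball x r : set X) (fun y => (ur y - a)%:E).
    apply: measurable_funTS; apply/measurable_EFinP.
    by apply: measurable_funB => //; exact: measurable_cst.
  have iD : nu.-integrable (ball x r) (fun y => (ur y - a)%:E).
    apply/integrableP; split => //.
    exact: le_lt_trans (hr1 r rr) (ltry _).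
  have iA : nu.-integrable (ball x r) (fun=> a%:E).
    apply/integrableP; split; first exact: measurable_cst.
    under eq_integral do rewrite abse_EFin.
    by rewrite integral_cst// muB ltry.
  have urE : \int[nu]_(y in ball x r) (EFin \o ur) y =
      \int[nu]_(y in ball x r) (ur y - a)%:E + (a * vol mu x r)%:E.
    rewrite (eq_integral (fun y : X => (ur y - a)%:E + a%:E)); last first.
      by move=> y _; rewrite -EFinD subrK.
    by rewrite integralD// integral_cst// muB.
  split.
    apply/integrableP; split => //.
    rewrite (ae_eq_integral (fun y : X => `|(EFin \o ur) y|)) //.
    - have : nu.-integrable (ball x r) (EFin \o ur).
        have := integrableD mB iD iA; apply: eq_integrable => // y _ /=.
        by rewrite -EFinD subrK.
      by move=> /integrableP[].
    - exact: measurableT_comp.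
    - exact: measurableT_comp.
    - case: uur => M [mM M0 hM]; exists M; split => // y hy; apply: hM => Hy.
      by apply: hy => xy; rewrite Hy.
  rewrite (ae_eq_integral (EFin \o ur : X -> \bar R))// urE addeK//.
  exact: le_trans (le_abse_integral nu mB mD) (hr1 r rr).
split.
  have [r1 r10 hr1] : exists2 r1 : R, (0 < r1)%R &
    forall r, (0 < r < r1)%R -> nu.-integrable (ball x r) u.
    have e11 : (0 < (1 : R) <= 1)%R by rewrite ltr01 lexx.
    by have [r1 r10 hr1] := average _ e11; exists r1 => // r /hr1[].
  apply: (near_at_right0 r10) => r /hr1 iu; left.
  by apply: integral_funepos_lt_pinfty => //; exact: ball_mu_measurable.
rewrite ux; apply: cvg_ereal_real => e' e'0.
pose e := Num.min 1%R (e' / 6)%R.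
have e01 : (0 < e <= 1)%R.
  by rewrite ge_min lexx andbT lt_min ltr01 divr_gt0.
have e6 : (6 * e <= e')%R by rewrite mulrC -ler_pdivlMr// ge_min lexx orbT.
have [r1 r10 hr1] := average e e01.
apply: (near_at_right0 r10) => r rr; have [iu] := hr1 r rr.
have /andP[r0 _] := rr.
have V0 := vol_gt0 mu_balls x r0.
rewrite (mu_ballE mu_balls)// inver gt_eqF//.
have := integrable_fin_num (ball_mu_measurable mu_regular x r) iu.
case: (\int[nu]_(y in ball x r) u y) => // I _.
rewrite -EFinB abse_EFin -EFinM !lee_fin ler_norml => /andP[I1 I2].
by rewrite ler_pdivlMr// ler_pdivrMr//; apply/andP; split; nra.
Qed.

End lebesgue_points.

(** * Quasievery point *)

Section quasievery_point.
Context {R : realType} {T : pmetricType R} (mu : {outer_measure set T -> \bar R}).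
Hypothesis mu_regular : borel_regular mu.
Hypothesis mu_balls : balls_positive_finite mu.
Variable cd : R.
Hypothesis cd_ge1 : (1 <= cd)%R.
Hypothesis vol_dbl :
  forall (x : T) (r : R), (0 < r)%R -> (vol mu x (2 * r) <= cd * vol mu x r)%R.
Variables (c Q : R).
Hypothesis c_gt0 : (0 < c)%R.
Hypothesis Q_gt0 : (0 < Q)%R.
Hypothesis vol_lower : forall (x y : T) (r r' : R), (0 < r <= r')%R ->
  ball x r' y -> (c * (r / r') `^ Q * vol mu x r' <= vol mu y r)%R.
Variables (p : T -> R) (s pm pp Cp : R).
Hypothesis mp : mu_measurable mu p.
Hypothesis pm_gt0 : (0 < pm)%R.
Hypothesis p_ge : forall x, (pm <= p x)%R.
Hypothesis p_le : forall x, (p x <= pp)%R.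
Hypothesis Cp_gt0 : (0 < Cp)%R.
Hypothesis p_lh :
  forall x y : T, (`|p x - p y| <= Cp / ln (expR 1 + (mdist x y)^-1))%R.
Hypothesis s_gt0 : (0 < s)%R.
Hypothesis s_le1 : (s <= 1)%R.

Let p_gt0 x : (0 < p x)%R. Proof. exact: lt_le_trans (p_ge x). Qed.

(** Membership in the homogeneous space only matters through finite real
    representatives: one null set carries away the infinite values and the
    failures of the gradient inequality. *)
Lemma hajlasz_real (u : T -> \bar R) : hom_hajlasz mu s p u ->
  exists (ur h : T -> R) (N : set T),
    [/\ mu_measurable mu ur, mu_measurable mu h, forall x, (0 <= h x)%R,
        pmod mu p h < +oo &
    [/\ mu N = 0, forall x, ~ N x -> u x = (ur x)%:E &
        forall x y, ~ N x -> ~ N y ->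
          (`|ur x - ur y| <= mdist x y `^ s * (h x + h y))%R]].
Proof.
move=> [[mu_u [M [mM M0 hM]]] /ereal_inf_lt[_ [g [mg g0 [E E0 hE]] <-] gfin]].
have [k gk] : exists k : R, Lp_norm mu p g < k%:E.
  move: gfin; case: (Lp_norm mu p g) => [b||] // _; last by exists 0%R; rewrite ltNyr.
  by exists (b + 1)%R; rewrite lte_fin ltrDl.
have [h [l [mh h0 [F F0 hF] /andP[l0 _] hl]]] := Lp_norm_lt_real mp pm_gt0 p_ge mg gk.
exists (fine \o u), h, ((M `|` E) `|` F); split => //.
- exact: measurableT_comp.
- apply: le_lt_trans (ltry (Num.max 1 l `^ pp)%R).
  apply: (pmod_unscale mp mh h0 l0) hl => x.
  apply: (@le_trans _ _ (Num.max 1 l `^ p x)%R).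
    by rewrite ge0_ler_powR ?nnegrE ?(ltW (p_gt0 x)) ?(ltW l0) ?le_max ?lexx ?orbT ?ler01.
  by apply: ler_powR => //; rewrite le_max lexx.
have fin_u x : ~ M x -> u x \is a fin_num.
  by move=> Mx; apply: contrapT => /hM.
split.
- apply/eqP; rewrite -measure_le0.
  apply: (le_trans (outer_measureU2 _ _ _)); rewrite [X in _ + X]F0 adde0.
  apply: (le_trans (outer_measureU2 _ _ _)); rewrite [X in _ + X]E0 adde0.
  by rewrite [leLHS]M0.
- by move=> x /not_orP[/not_orP[Mx _] _]; rewrite /= fineK ?fin_u.
- move=> x y /not_orP[/not_orP[Mx Ex] Fx] /not_orP[/not_orP[My Ey] Fy].
  have := hE x y Ex Ey.
  rewrite -(gee0_abs (g0 x)) -(gee0_abs (g0 y)) hF// hF//.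
  by rewrite -[u x]fineK ?fin_u// -[u y]fineK ?fin_u// -EFinB abse_EFin lee_fin.
Qed.

Lemma ball_mass (x0 : T) (q : R) : (0 < q)%R -> exists2 c1 : R, (0 < c1)%R &
  forall z r, ball x0 q z -> (0 < r <= q)%R -> (c1 * r `^ Q <= vol mu z r)%R.
Proof.
move=> q0; have qQ : (0 < q^-1 `^ Q)%R by rewrite powR_gt0// invr_gt0.
exists (c * q^-1 `^ Q * vol mu x0 q)%R.
  by rewrite mulr_gt0 ?vol_gt0// mulr_gt0.
move=> z r xz /andP[r0 rq]; have rr : (0 < r <= q)%R by rewrite r0.
apply: le_trans (vol_lower rr xz).
rewrite powRM ?(ltW r0) ?invr_ge0 ?(ltW q0)//.
by rewrite le_eqVlt; apply/orP; left; apply/eqP; ring.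
Qed.

Variable u : T -> \bar R.
Hypothesis u_qc : quasicontinuous mu s p u.

(** The exceptional sets of quasicontinuity have arbitrarily small capacity, and
    each of them serves all points that are neither in it nor points of density
    of it. *)
Lemma mcap_not_approx_continuous (x0 : T) (q e : R) : (0 < q)%R -> (0 < e)%R ->
  mcap_le mu p s (ball x0 q `&` [set x | ~ approx_continuous mu u x]) e%:E.
Proof.
move=> q0 e0; have e20 : (0 < e / 2)%R by rewrite divr_gt0.
have q20 : (0 < q + 2)%R by rewrite addr_gt0.
have [c1 c10 mass] := ball_mass x0 q20.
have mass1 z r : ball x0 (q + 2)%R z -> (0 < r <= 1)%R -> (c1 * r `^ Q <= vol mu z r)%R.
  move=> xz /andP[r0 r1]; apply: mass => //; rewrite r0/=; lra.
have [r0 [eta [r00 eta0 H]]] := mcap_dense mu_regular mu_balls cd_ge1 vol_dbl mp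
  pm_gt0 p_ge p_le Cp_gt0 p_lh s_gt0 s_le1 Q_gt0 q0 c10 mass1 e20.
pose d := Num.min eta (e / 2)%R.
have d0 : (0 < d)%R by rewrite lt_min eta0.
have [E capE contE] := quasicontinuous_mcap mp pm_gt0 p_ge u_qc d0.
have capE1 : mcap_le mu p s E eta%:E.
  by apply: mcap_le_sub capE => //; rewrite lee_fin ge_min lexx.
have capE2 : mcap_le mu p s E (e / 2)%:E.
  by apply: mcap_le_sub capE => //; rewrite lee_fin ge_min lexx orbT.
apply: mcap_le_sub (mcap_leU mp (H E capE1) capE2).
  move=> x [x0x nx]; have [Ex|Ex] := pselect (E x); first by right.
  left; split => //=; apply: contrapT => nd; apply: nx; exists E; split => //.
  exists r0 => // r rr; rewrite ltNge; apply/negP => dense.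
  by apply: nd; exists r.
by rewrite -EFinD lee_fin -splitr.
Qed.

Lemma quasievery_point_fine (ur h : T -> R) (N : set T) :
  mu_measurable mu u -> mu_measurable mu h ->
  (forall x, 0 <= h x)%R -> pmod mu p h < +oo -> mu N = 0 ->
  (forall x, ~ N x -> u x = (ur x)%:E) ->
  (forall x y, ~ N x -> ~ N y ->
    `|ur x - ur y| <= mdist x y `^ s * (h x + h y))%R ->
  exists2 Z : set T, capacity mu s p Z = 0 & forall x, ~ Z x ->
    [/\ u x \is a fin_num, approx_continuous mu u x &
        vanishing_energy mu p s h x].
Proof.
move=> mu_u mh h0 hfin N0 uN gradN.
have [Z Z0 hZ] := energy_vanishes mu_regular mu_balls cd_ge1 vol_dbl mp pm_gt0
  p_ge Cp_gt0 p_lh s_gt0 s_le1 mh h0 hfin.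
pose B (n : nat) := ball (point : T) n.+1%:R.
pose F n := (B n `&` [set x | ~ approx_continuous mu u x]) `|`
  (B n `&` [set x | `|u x| = +oo]).
have F0 n e : (0 < e)%R -> mcap_le mu p s (F n) e%:E.
  move=> e0; have e20 : (0 < e / 2)%R by rewrite divr_gt0.
  have n0 : (0 < n.+1%:R :> R)%R by rewrite ltr0n.
  have F1 := mcap_not_approx_continuous point n0 e20.
  have F2 := mcap_infinite mu_regular mu_balls mp pm_gt0 p_ge p_le s_gt0 s_le1
    mu_u mh h0 hfin N0 uN gradN u_qc point n0 e20.
  by apply: mcap_le_sub (mcap_leU mp F1 F2) => //; rewrite -EFinD lee_fin -splitr.
exists (Z `|` \bigcup_n F n).
  apply: (mcap_le_capacity0 mp p_le) => e e0.
  have e20 : (0 < e / 2)%R by rewrite divr_gt0.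
  have FF := mcap_null_bigcup mp pm_gt0 p_ge F0 e20.
  by apply: mcap_le_sub (mcap_leU mp (Z0 _ e20) FF) => //; rewrite -EFinD lee_fin -splitr.
move=> x /not_orP[Zx Fx].
have [n xn] : exists n, B n x.
  exists (Num.truncn (mdist point x)); rewrite /B in_ballE.
  exact: truncnS_gt.
split; last exact: hZ.
  apply: contrapT => ux; apply: Fx; exists n => //; right; split => //=.
  by move: ux; case: (u x).
by apply: contrapT => ux; apply: Fx; exists n => //; left.
Qed.

End quasievery_point.

Lemma real_between {R : realType} (a : R) (b : \bar R) : a%:E < b ->
  exists2 k : R, (a < k)%R & k%:E <= b.
Proof.
case: b => [b| |]//= ab; first by exists b.
by exists (a + 1)%R; rewrite ?ltrDl ?leey.
Qed.


Theorem theorem7p8 (R : realType) (T : pmetricType R)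
  (mu : {outer_measure set T -> \bar R})
  (mu_regular : borel_regular mu)
  (mu_balls : balls_positive_finite mu)
  (mu_doubling : doubling mu)
  (c Q : R) (c_gt0 : (0 < c)%R) (Q_gt0 : (0 < Q)%R)
  (mu_lower : forall (x y : T) (r r' : R),
    (0 < r <= r')%R -> ball x r' y ->
    mu (ball y r) / mu (ball x r') >= (c * (r / r') `^ Q)%:E)
  (p : T -> R) (p_gt0 : forall x, (0 < p x)%R)
  (p_log_holder : locally_log_holder mu p)
  (p_plus_fin : p_plus mu p < +oo)
  (s : R) (s_bounds : (0 < s <= 1)%R)
  (u : T -> \bar R)
  (u_hajlasz : hom_hajlasz mu s p u)
  (u_quasicontinuous : quasicontinuous mu s p u) :
  (0 < p_minus mu p ->
    quasieverywhere mu s p (generalized_lebesgue_point mu u)) /\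
  ((Q / (Q + s))%:E < p_minus mu p ->
    quasieverywhere mu s p (lebesgue_point mu u)).
Proof.
have /andP[s_gt0 s_le1] := s_bounds.
have [mp [Cp Cp_gt0 p_lh]] := p_log_holder.
have [cd cd_ge1 vol_dbl] := doubling_vol mu_balls mu_doubling.
have [pp p_pp] : exists pp : R, p_plus mu p <= pp%:E.
  move: p_plus_fin; case: (p_plus mu p) => [b| |]// _; first by exists b.
  by exists 0%R; rewrite leNye.
have p_le := p_plus_ge mu_balls Cp_gt0 p_lh p_pp.
have vol_lower (x y : T) (r r' : R) : (0 < r <= r')%R -> ball x r' y ->
    (c * (r / r') `^ Q * vol mu x r' <= vol mu y r)%R.
  move=> rr xy; have /andP[r0 rr'] := rr; have r'0 := lt_le_trans r0 rr'.
  have V0 := vol_gt0 mu_balls x r'0.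
  have := mu_lower x y r r' rr xy.
  rewrite !(mu_ballE mu_balls)// inver gt_eqF// -EFinM lee_fin.
  by rewrite ler_pdivlMr.
have [mu_u _] := u_hajlasz.1.
have fine_points (pm : R) : (0 < pm)%R -> pm%:E <= p_minus mu p ->
    forall P : T -> Prop,
    (forall (ur h : T -> R) (N : set T), mu_measurable mu ur ->
      mu_measurable mu h -> (forall x, 0 <= h x)%R -> mu N = 0 ->
      (forall x, ~ N x -> u x = (ur x)%:E) ->
      (forall x y, ~ N x -> ~ N y ->
        `|ur x - ur y| <= mdist x y `^ s * (h x + h y))%R ->
      forall x a, u x = a%:E -> approx_continuous mu u x ->
        vanishing_energy mu p s h x -> P x) ->
    quasieverywhere mu s p P.
  move=> pm_gt0 /(p_minus_le mu_balls Cp_gt0 p_lh) p_ge P HP.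
  have [ur [h [N [mur mh h0 hfin [N0 uN gradN]]]]] :=
    hajlasz_real mp pm_gt0 p_ge p_le u_hajlasz.
  have [Z Z0 hZ] := quasievery_point_fine mu_regular mu_balls cd_ge1 vol_dbl
    c_gt0 Q_gt0 vol_lower mp pm_gt0 p_ge p_le Cp_gt0 p_lh s_gt0 s_le1
    u_quasicontinuous mu_u mh h0 hfin N0 uN gradN.
  exists Z => // x /hZ[ux x_cont x_energy].
  apply: (HP ur h N mur mh h0 N0 uN gradN x (fine (u x))) => //.
  by rewrite fineK.
split.
  move=> /real_between[pm pm_gt0 pm_le].
  have p_ge := p_minus_le mu_balls Cp_gt0 p_lh pm_le.
  apply: (fine_points pm pm_gt0 pm_le) => ur h N _ mh h0 N0 uN gradN x a ux.
  exact: (generalized_point mu_regular mu_balls mp pm_gt0 p_ge p_le s_gt0 s_le1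
    mh h0 N0 uN gradN ux).
move=> /real_between[pm pm_gt pm_le].
have pm_gt0 : (0 < pm)%R by apply: lt_trans pm_gt; rewrite divr_gt0// addr_gt0.
have p_ge := p_minus_le mu_balls Cp_gt0 p_lh pm_le.
apply: (fine_points pm pm_gt0 pm_le) => ur h N mur mh h0 N0 uN gradN x a ux xc xe.
exact: (mean_value_point mu_regular mu_balls mp pm_gt0 p_ge p_le s_gt0 s_le1
  mu_u mur mh h0 N0 uN gradN ux xc xe cd_ge1 vol_dbl c_gt0 Q_gt0 vol_lower
  (ltW pm_gt)).
Qed.
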